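(* Let $T=(\pi,\lambda)$ be an interval exchange transformation of hyperbolic periodic type with self-similarity matrix $M$. For any $M$-invariant vector $\omega\in\mathbb{R}^{\mathcal A}$ (i.e. $M\omega=\omega$) there exists $\eta>0$ such that for $t\ge0$ we have $$\mathfrak{H}(h^{-1}_{t\omega})=\frac{h_{top}(\overline{X}(\Phi_\omega))+O(e^{-\eta t})}{h_{top}(X)},$$ $$\mathfrak{H}(h_{t\omega})=\frac{h_{top}(X)}{(\overline{\Phi}_\omega-\underline{\Phi}_\omega)t+h_{top}(\overline{X}(\Phi_\omega))+O(e^{-\eta t})},$$ where $h_{t\omega}:I\to I$ is the conjugacy between an AIET $f_{t\omega}\in\operatorname{Aff}(T,t\omega)$ and $T$, and $\mathfrak H$ denotes the supremal Hölder exponent. In particular, $$\lim_{t\to+\infty}\mathfrak{H}(h^{-1}_{t\omega})=\frac{h_{top}(\overline{X}(\Phi_\omega))}{h_{top}(X)}\quad\text{and}\quad\lim_{t\to+\infty}t\,\mathfrak{H}(h_{t\omega})=\frac{h_{top}(X)}{\overline{\Phi}_\omega-\underline{\Phi}_\omega}.$$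
   Context: **GIETs, IETs, AIETs.** Let $\mathcal A$ be an alphabet with $d$ letters and $\pi=(\pi_t,\pi_b)$ a pair of bijections $\mathcal A\to\{1,\dots,d\}$. A generalized interval exchange transformation (GIET) $f:I\to I$ with combinatorial data $\pi$ is a piecewise smooth bijection of an interval $I=[0,|I|)$, increasing and smooth on each of the intervals $I_\alpha$ ($\alpha\in\mathcal A$) of a partition of $I$, where $I_\alpha$ is the $\pi_t(\alpha)$-th interval from the left and $f(I_\alpha)$ is the $\pi_b(\alpha)$-th from the left among the images. It is an affine IET (AIET) if it is affine with positive slope on each $I_\alpha$; its log-slope vector is $\omega_\alpha=\log Df|_{I_\alpha}$. It is an IET if all slopes are $1$; it is then identified with $(\pi,\lambda)$, $\lambda_\alpha=|I_\alpha|$. **Rauzy–Veech induction.** Let $a=\pi_t^{-1}(d)$, $b=\pi_b^{-1}(d)$ and suppose $I_a\ne f(I_b)$. Then $\mathcal{RV}(f)$ is the first return map of $f$ to the longer of $I\setminus I_a$ and $I\setminus f(I_b)$, with the standard labelling: if $f(I_b)\subset I_a$ (top type), $I_a$ is replaced by $I_a\setminus f(I_b)$ and the other intervals are kept; if $I_a\subset f(I_b)$ (bottom type), $I_b$ is replaced by $I_b\setminus f^{-1}(I_a)$, $I_a$ is replaced by $f^{-1}(I_a)$, and the other intervals are kept. $f$ is infinitely renormalizable if this can be iterated forever; $\mathcal{RV}^k(f):I^{(k)}\to I^{(k)}$ exchanges $I^{(k)}_\alpha$, $\alpha\in\mathcal A$. The combinatorial rotation number is the infinite sequence of resulting permutations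 and types (top/bottom). **Hyperbolic periodic type.** An IET $T=(\pi,\lambda)$ is self-similar if for some $n\ge1$, fixed from now on, $\mathcal{RV}^n(T)$ is conjugate to $T$ via a linear rescaling $R:I^{(n)}\to I$, $R(x)=\frac{|I|}{|I^{(n)}|}x$ (so $I^{(n)}_\alpha=R^{-1}I_\alpha$). Let $q^{(n)}_\alpha$ be the first return time of $I^{(n)}_\alpha$ to $I^{(n)}$ under $T$; then $I=\bigsqcup_\alpha\bigsqcup_{0\le i<q^{(n)}_\alpha}T^iI^{(n)}_\alpha$, and each $T^iI^{(n)}_\alpha$ lies in exactly one $I_\beta$; write $\beta(\alpha,i)=\beta$. The self-similarity matrix is $M_{\alpha\beta}=\#\{0\le i<q^{(n)}_\alpha:\beta(\alpha,i)=\beta\}$. Let $g\ge1$ and $\kappa$ be the genus and number of singularities of the translation surfaces associated with $\pi$ (so $d=2g+\kappa-1$). $T$ is of hyperbolic periodic type if $M$ is primitive and has exactly $g$ real simple eigenvalues greater than $1$ and $g$ real simple eigenvalues smaller than $1$, with different moduli, and $\kappa-1$ unit ones; then the right eigenvectors of $M$ form a basis of $\mathbb{R}^{\mathcal A}$ consisting of $g$ expanding, $g$ contracting and $\kappa-1$ fixed vectors. **AIETs, conjugacies, conformal measures.** $\operatorname{Aff}(T,\omega)$ is the set of AIETs $f:I\to I$ with log-slope vector $\omega$ that are semi-conjugate to $T$ (same combinatorial rotation number, $h\circ f=T\circ h$ with $h$ a continuous non-decreasing surjection). For $M\omega=\omega$ it is known that $\operatorname{Aff}(T,\omega)\neq\emptyset$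 and that the semi-conjugacy $h_\omega$ between $f_\omega\in\operatorname{Aff}(T,\omega)$ and $T$ is a homeomorphism. Put $\phi_\omega(x)=\omega_\alpha$ for $x\in I_\alpha$; $\nu_\omega$ is the (unique, known to exist) Borel probability measure on $I$ such that $(T^{-1})_*\nu_\omega$ is equivalent to $\nu_\omega$ with $\frac{d(T^{-1})_*\nu_\omega}{d\nu_\omega}=e^{\phi_\omega}$. **Hölder exponent.** $\mathfrak H(h)=\sup\{\alpha\ge0: D^{\lfloor\alpha\rfloor}h\text{ is }\{\alpha\}\text{-Hölder}\}$, where $\{\alpha\}$ is the fractional part of $\alpha$. **Shift and potential.** $\Sigma=\{(\alpha,i):\alpha\in\mathcal A,\ 0\le i<q^{(n)}_\alpha\}$; $\mathcal G=(\Sigma,\mathcal E)$ is the directed graph with $((\beta,j),(\alpha,i))\in\mathcal E\iff\beta(\alpha,i)=\beta$; $X=\{x\in\Sigma^{\mathbb Z}:(x_k,x_{k+1})\in\mathcal E\ \forall k\in\mathbb Z\}$ with the left shift $\sigma$. For $M\omega=\omega$, $\Phi_\omega:\mathcal E\to\mathbb R$ is $$\Phi_\omega((\beta,j),(\alpha,i))=\log\frac{\nu_\omega(T^iI^{(n)}_\alpha)}{\nu_\omega(I^{(n)}_\alpha)}=\sum_{0\le k<i}\omega_{\beta(\alpha,k)},$$ regarded also as a function on $X$ by $\Phi_\omega(x)=\Phi_\omega(x_0,x_1)$. **Thermodynamic notions.** $h_{top}$ is the topological entropy of a (sub)shift. For an edge potential $\Phi$, $\overline\Phi$ and $\underline\Phi$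 are the maximum and the minimum of $\int_X\Phi\,d\lambda$ over $\sigma$-invariant Borel probability measures $\lambda$ on $X$. A periodic $x\in X$ of least period $k$ is elementary if $x_0,\dots,x_{k-1}$ are pairwise distinct, and an elementary periodic $x$ is $\Phi$-maximizing if $\frac1k\sum_{0\le i<k}\Phi(x_i,x_{i+1})=\overline\Phi$. $\overline X(\Phi)$ is the set of $x\in X$ such that for every $k\in\mathbb Z$ the word $x_kx_{k+1}$ occurs in an elementary $\Phi$-maximizing periodic orbit. $O(e^{-\eta t})$ denotes a function of $t\ge0$ bounded in absolute value by a constant times $e^{-\eta t}$.
   Formalization: The two formulas are stated for t ≥ 0 with tω ≠ 0 and the two limits for ω ≠ 0: if tω = 0 the conjugacy is the identity, whose Hölder exponent is +∞, so the first formula fails, and for ω = 0 the second limit divides by zero. *)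

(* Defs.v *)
From HB Require Import structures.
From mathcomp Require Import all_boot all_order all_algebra.
From mathcomp Require Import all_classical all_reals all_analysis.

Set Implicit Arguments.
Unset Strict Implicit.
Unset Printing Implicit Defensive.

Import Order.TTheory GRing.Theory Num.Theory.
Import numFieldNormedType.Exports.

Local Open Scope classical_set_scope.
Local Open Scope ring_scope.

(* The alphabet has d.+1 letters and is the type 'I_d.+1; its elements are mere
   labels (the order of 'I_d.+1 is never used), the combinatorial data being
   two arbitrary bijections onto {1, ..., d.+1}.  The point below is needed
   because measurable types are pointed in the library. *)
HB.instance Definition _ (d : nat) := isPointed.Build 'I_d.+1 ord0.

(* The least natural number satisfying P (0 if there is none). *)
Definition least (P : nat -> Prop) : nat :=
  match pselect (exists m, `[< P m >]) with
  | left exP => ex_minn exP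
  | right _ => 0%N
  end.

(** * Interval exchanges *)

(* Only the values of gmap on the domain are meaningful. *)
Record giet (R : realType) (d : nat) := Giet {
  gtop : 'I_d.+1 -> nat;
  gbot : 'I_d.+1 -> nat;
  gitv : 'I_d.+1 -> set R;
  gmap : R -> R }.

Definition gdom (R : realType) (d : nat) (F : giet R d) : set R :=
  \bigcup_(a in [set: 'I_d.+1]) gitv F a.

Definition glength (R : realType) (d : nat) (F : giet R d) : R := sup (gdom F).

Definition is_position (d : nat) (p : 'I_d.+1 -> nat) : Prop :=
  set_bij [set: 'I_d.+1] [set k | (1 <= k <= d.+1)%N] p.

(* GIET without the smoothness of the branches, which is automatic for the
   affine maps considered below. *)
Record is_exchange (R : realType) (d : nat) (F : giet R d) : Prop := {
  exch_top : is_position (gtop F);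
  exch_bot : is_position (gbot F);
  exch_dom : exists2 l : R, 0 < l & gdom F = `[0, l[%classic;
  exch_itv : forall a, exists u v : R, u < v /\ gitv F a = `[u, v[%classic;
  exch_order : forall a b x y, (gtop F a < gtop F b)%N ->
    gitv F a x -> gitv F b y -> x < y;
  exch_bij : set_bij (gdom F) (gdom F) (gmap F);
  exch_incr : forall a x y, gitv F a x -> gitv F a y ->
    x < y -> gmap F x < gmap F y;
  exch_image_order : forall a b x y, (gbot F a < gbot F b)%N ->
    gitv F a x -> gitv F b y -> gmap F x < gmap F y }.

Definition is_aiet (R : realType) (d : nat) (F : giet R d)
    (omega : 'cV[R]_d.+1) : Prop :=
  is_exchange F /\
  forall a, exists c : R, forall x, gitv F a x ->
    gmap F x = expR (omega a 0) * x + c.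

Definition is_iet (R : realType) (d : nat) (F : giet R d) : Prop :=
  is_aiet F 0.

(** * Rauzy-Veech induction *)

Definition return_time (R : realType) (f : R -> R) (J : set R) (x : R) : nat :=
  least (fun m => (0 < m)%N /\ J (iter m f x)).

Definition first_return (R : realType) (f : R -> R) (J : set R) (x : R) : R :=
  iter (return_time f J x) f x.

Definition last_letter (d : nat) (p : 'I_d.+1 -> nat) : 'I_d.+1 :=
  odflt ord0 [pick a | p a == d.+1].

(* For y in last position: y is moved immediately to the right of x. *)
Definition move_after (d : nat) (p : 'I_d.+1 -> nat) (x y : 'I_d.+1) :
    'I_d.+1 -> nat :=
  fun c => if c == y then (p x).+1 else if (p c <= p x)%N then p c else (p c).+1.

Section RauzyVeech.
Context {R : realType} {d : nat}.
Implicit Types F G : giet R d.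

Definition last_top F : 'I_d.+1 := last_letter (gtop F).
Definition last_bot F : 'I_d.+1 := last_letter (gbot F).
Definition last_image F : set R := gmap F @` gitv F (last_bot F).
Definition last_preimage F : set R :=
  gdom F `&` gmap F @^-1` gitv F (last_top F).

Definition renormalizable F : Prop := gitv F (last_top F) <> last_image F.

Definition top_type F : bool := `[< last_image F `<=` gitv F (last_top F) >].

Definition RV_itv F (c : 'I_d.+1) : set R :=
  if top_type F then
    if c == last_top F then gitv F c `\` last_image F else gitv F c
  else
    if c == last_bot F then gitv F c `\` last_preimage F
    else if c == last_top F then last_preimage F else gitv F c.

(* The union of the new intervals is the longer of I \ I_a and I \ f(I_b). *)
Definition RV F : giet R d := {|
  gtop := if top_type F then gtop F
          else move_after (gtop F) (last_bot F) (last_top F);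
  gbot := if top_type F then move_after (gbot F) (last_top F) (last_bot F)
          else gbot F;
  gitv := RV_itv F;
  gmap := first_return (gmap F) (\bigcup_(c in [set: 'I_d.+1]) RV_itv F c) |}.

Definition infinitely_renormalizable F : Prop :=
  forall k, renormalizable (iter k RV F).

Definition same_rotation_number F G : Prop :=
  [/\ infinitely_renormalizable F, infinitely_renormalizable G &
      forall k, let Fk := iter k RV F in let Gk := iter k RV G in
        [/\ gtop Fk = gtop Gk, gbot Fk = gbot Gk & top_type Fk = top_type Gk]].

End RauzyVeech.

(** * Genus and number of singularities *)

(* Vertices of the 2(d+1)-gon suspended over the permutation: (i, true), resp.
   (i, false), is the i-th vertex of its upper, resp. lower, boundary path.
   Both paths have the same endpoints, and the upper and lower sides carrying
   the same letter are identified by a translation. *)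
Definition glued (d : nat) (pt pb : 'I_d.+1 -> nat) :
    rel ('I_d.+2 * bool) :=
  fun u v =>
    let pos (s : bool) := if s then pt else pb in
    (u.2 != v.2) &&
    ([|| (u.1 == ord0) && (v.1 == ord0), (u.1 == ord_max) && (v.1 == ord_max) |
      [exists a, [|| ((u.1 : nat) == (pos u.2 a).-1) &&
                     ((v.1 : nat) == (pos v.2 a).-1)
                   | ((u.1 : nat) == pos u.2 a) &&
                     ((v.1 : nat) == pos v.2 a)]]]).

Definition nb_singularities (d : nat) (pt pb : 'I_d.+1 -> nat) : nat :=
  n_comp (glued pt pb) [set: 'I_d.+2 * bool]%SET.

(* Euler characteristic: nb_singularities - (d+1) + 1 = 2 - 2 * genus. *)
Definition genus (d : nat) (pt pb : 'I_d.+1 -> nat) : nat :=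
  (d.+2 - nb_singularities pt pb)./2.

(** * Hyperbolic periodic type *)

Section PeriodicType.
Context {R : realType} {d : nat}.
Variables (T : giet R d) (n : nat).

Let Tn : giet R d := iter n RV T.

Definition rescaling (x : R) : R := glength T / glength Tn * x.

Definition self_similar : Prop :=
  [/\ (0 < n)%N,
      forall k, (k < n)%N -> renormalizable (iter k RV T),
      forall a, gitv Tn a = rescaling @^-1` gitv T a &
      forall x, gdom Tn x -> rescaling (gmap Tn x) = gmap T (rescaling x)].

(* The return time to I^(n) is constant on each I^(n)_a; it is evaluated at the
   left endpoint. *)
Definition height (a : 'I_d.+1) : nat :=
  return_time (gmap T) (gdom Tn) (inf (gitv Tn a)).

(* The letter b such that T^i I^(n)_a is contained in I_b. *)
Definition floor_letter (a : 'I_d.+1) (i : nat) : 'I_d.+1 :=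
  odflt a [pick b | `[< iter i (gmap T) @` gitv Tn a `<=` gitv T b >]].

Definition selfsim_matrix : 'M[R]_d.+1 :=
  \matrix_(a, b) #|[set i : 'I_(height a) | floor_letter a i == b]%SET|%:R.

Definition primitive_mx (M : 'M[R]_d.+1) : Prop :=
  exists2 k : nat, (0 < k)%N & forall a b, 0 < (M ^+ k) a b.

(* s and s' list the expanding and the contracting eigenvalues; they are compared
   with 1 in modulus. *)
Definition hyperbolic_spectrum (M : 'M[R]_d.+1) (g kappa : nat) : Prop :=
  exists s s' : seq R,
    [/\ (size s = g /\ size s' = g),
        (forall x, x \in s -> 1 < `|x|),
        (forall x, x \in s' -> `|x| < 1),
        uniq [seq `|x| | x <- s ++ s'] &
        char_poly M = (\prod_(x <- s ++ s') ('X - x%:P)) * ('X - 1) ^+ kappa.-1].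

Definition hyperbolic_periodic_type : Prop :=
  [/\ self_similar, primitive_mx selfsim_matrix &
      hyperbolic_spectrum selfsim_matrix
        (genus (gtop T) (gbot T)) (nb_singularities (gtop T) (gbot T))].

End PeriodicType.

(** * Affine interval exchanges semi-conjugate to T *)

Section Conjugacy.
Context {R : realType} {d : nat}.
Implicit Types F T : giet R d.

Definition semi_conjugacy F T (h : R -> R) : Prop :=
  [/\ {within gdom F, continuous h},
      forall x y, gdom F x -> gdom F y -> x <= y -> h x <= h y,
      h @` gdom F = gdom T &
      forall x, gdom F x -> h (gmap F x) = gmap T (h x)].

Definition Aff T (omega : 'cV[R]_d.+1) : set (giet R d) :=
  [set F | [/\ is_aiet F omega, gdom F = gdom T, same_rotation_number F T &
               exists h, semi_conjugacy F T h]].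

Definition conjugacy F T (h hinv : R -> R) : Prop :=
  [/\ semi_conjugacy F T h,
      {within gdom T, continuous hinv},
      (forall x, gdom F x -> hinv (h x) = x),
      (forall y, gdom T y -> gdom F (hinv y)) &
      (forall y, gdom T y -> h (hinv y) = y)].

End Conjugacy.

(** * Hoelder exponent *)

Section Hoelder.
Context {R : realType}.
Implicit Types (J : set R) (f g : R -> R).

(* Derivative relative to J, hence one-sided at an endpoint belonging to J. *)
Definition derivative_on J f g : Prop :=
  forall x, J x ->
    (f y - f x) / (y - x) @[y --> within J x^'] --> g x.

Fixpoint iter_derivative_on J (k : nat) f g : Prop :=
  if k is k'.+1 then
    exists2 f1, derivative_on J f f1 & iter_derivative_on J k' f1 g
  else {in J, g =1 f}.

Definition hoelder_on J (e : R) g : Prop :=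
  exists C : R, forall x y, J x -> J y ->
    `|g x - g y| <= C * `|x - y| `^ e.

Definition hoelder_exponent J f : \bar R :=
  ereal_sup [set e%:E | e in [set e : R | 0 <= e /\
    exists2 g, iter_derivative_on J (Num.truncn e) f g &
      hoelder_on J (e - (Num.truncn e)%:R) g]].

End Hoelder.

(** * Topological entropy (by open covers) *)

Section TopologicalEntropy.
Context {R : realType} {S : topologicalType}.
Variables (K : set S) (s : S -> S).

Definition open_cover (U : set (set S)) : Prop :=
  U `<=` open /\ K `<=` \bigcup_(V in U) V.

(* The join of U, s^-1 U, ..., s^-(m-1) U. *)
Definition join_cover (U : set (set S)) (m : nat) : set (set S) :=
  [set W | exists2 c : nat -> set S, (forall i, (i < m)%N -> U (c i)) &
     W = \bigcap_(i in `I_m) (iter i s @^-1` c i)].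

Definition subcover_number (U : set (set S)) : nat :=
  least (fun m => exists2 c : nat -> set S,
    (forall i, (i < m)%N -> U (c i)) & K `<=` \bigcup_(i in `I_m) c i).

Definition cover_entropy (U : set (set S)) : R :=
  limn (fun m : nat => ln ((subcover_number (join_cover U m))%:R : R) / m%:R).

Definition htop : \bar R :=
  ereal_sup [set (cover_entropy U)%:E | U in open_cover].

End TopologicalEntropy.

(** * Shift space and potential *)

(* Pairs (a, i); the finite set Sigma is cut out by is_floor below. *)
Notation symbol d := ('I_d.+1 * nat)%type.

Notation shift_space d := {ptws int -> discrete_topology (symbol d)}.

Definition left_shift (d : nat) (x : shift_space d) : shift_space d :=
  fun k => x (k + 1).

Notation borel_shift_space d :=
  (g_sigma_algebraType (@open (shift_space d))).

Section InvariantMeasures.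
Context {R : realType} {d : nat}.
Variables (X : set (shift_space d)) (Phi : symbol d -> symbol d -> R).

Definition invariant_measure (mu : probability (borel_shift_space d) R) : Prop :=
  mu X = 1%E /\
  forall B : set (borel_shift_space d), measurable B ->
    mu (@left_shift d @^-1` B) = mu B.

Definition invariant_means : set R :=
  [set c | exists2 mu, invariant_measure mu &
     c = \int[mu]_(x in X) Phi (x 0) (x 1)].

Definition max_mean : R := sup invariant_means.
Definition min_mean : R := inf invariant_means.

Definition least_period (x : shift_space d) (k : nat) : Prop :=
  [/\ (0 < k)%N, iter k (@left_shift d) x = x &
      forall m, (0 < m < k)%N -> iter m (@left_shift d) x <> x].

Definition elementary_periodic (x : shift_space d) (k : nat) : Prop :=
  [/\ X x, least_period x k &
      forall i j : nat, (i < k)%N -> (j < k)%N -> x i%:Z = x j%:Z -> i = j].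

Definition elementary_maximizing (x : shift_space d) (k : nat) : Prop :=
  elementary_periodic x k /\
  (\sum_(i < k) Phi (x (i : nat)%:Z) (x i.+1%:Z)) / k%:R = max_mean.

Definition maximizing_subshift : set (shift_space d) :=
  [set x | X x /\ forall k : int,
     exists y m, elementary_maximizing y m /\
       exists j : int, y j = x k /\ y (j + 1) = x (k + 1)].

End InvariantMeasures.

Section Potential.
Context {R : realType} {d : nat}.
Variables (T : giet R d) (n : nat).

Definition is_floor (u : symbol d) : bool := (u.2 < height T n u.1)%N.

Definition edge (u v : symbol d) : bool :=
  [&& is_floor u, is_floor v & floor_letter T n v.1 v.2 == u.1].

Definition path_shift : set (shift_space d) :=
  [set x | forall k : int, edge (x k) (x (k + 1))].

(* This is log (nu (T^i I^(n)_a) / nu (I^(n)_a)) for (a, i) = v and nu the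
   conformal measure: by conformality, nu (T A) = e^(omega_b) nu A whenever A is
   contained in I_b. *)
Definition potential (omega : 'cV[R]_d.+1) (u v : symbol d) : R :=
  \sum_(k < v.2) omega (floor_letter T n v.1 k) 0.

End Potential.

Definition exp_small {R : realType} (eta : R) (r : R -> R) : Prop :=
  exists C : R, forall t : R, 0 <= t -> `|r t| <= C * expR (- (eta * t)).

(* Main.v *)
(* By equality of the rotation numbers, the orbits of 0 under the AIET f and under T
   visit the same letters; since the orbit of 0 under T is dense, the conjugacy
   matches the exchanged intervals.  The inverse conjugacy G is therefore conformal:
   its increments are multiplied by e^(t omega_a) under T on I_a.  Self-similarity
   and a Birkhoff contraction argument show that the increments of G over the letters
   form a Perron eigenvector of the edge weights e^(t Phi), with eigenvalue rho_t, and
   that over the level-k piece coded by a walk p the increment of G is, up to bounded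
   factors, e^(t Phi(p)) rho_t^(-k), whereas the piece has length about rho_0^(-k).
   Comparing both sizes on neighbouring pieces, and along walks of extremal mean, gives
     H(G) = (ln rho_t - t max Phi) / ln rho_0,
     H(h) = ln rho_0 / (ln rho_t - t min Phi).
   Both are < 1 by comparison of Perron eigenvalues: equality would make Phi
   cohomologous to a constant, forcing omega = 0.  Finally, conjugating the weights by
   a strict subaction turns e^(t (Phi - max Phi)) into the adjacency matrix of the
   maximizing subshift plus an O(e^(-eta t)) perturbation, so that
   ln rho_t = t max Phi + h_top(maximizing subshift) + O(e^(-eta t)). *)

Require Import Defs.
From mathcomp Require Import all_boot all_order all_algebra.
From mathcomp Require Import all_classical all_reals all_analysis.
From mathcomp Require Import measurable_realfun.
From mathcomp Require Import ring lra zify.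
Set Implicit Arguments.
Unset Strict Implicit.
Unset Printing Implicit Defensive.
Import Order.TTheory GRing.Theory Num.Theory.
Import numFieldNormedType.Exports.
Local Open Scope classical_set_scope.
Local Open Scope ring_scope.

(** * Subactions and maximal cycle means *)

(** The maximal edges form a union of cycles that need not be connected, so no single Perron
    eigenvector describes them. Recurrence replaces it: every walk can be closed up at bounded cost,
    so the number of walks of length k is at most C e^(h k), without polynomial factor. A
    perturbation of size eps then moves the eigenvalue by O(eps) only, and the error keeps the
    exponential rate given by the gap of the strict subaction.

    The conjugacy is not assumed to respect the self-similarity. Conformality alone makes the letter
    increments of its successive dilations an infinite backward orbit of one positive matrix, and
    such an orbit lies on a ray; this yields the exact masses of the pieces at all levels.

    If Phi is cohomologous to a constant, the transfer function depends on the letter only, and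
    climbing towers turns the relation into one along every orbit of T. Were the function not
    constant, the left endpoint of some interval would also be the image of a left endpoint. Rauzy
    induction preserves such a point, while rescaling pushes it out of the domain. *)

Section WalkWeight.
Context {R : realType} {V : finType}.
Implicit Types (e : rel V) (w : V -> V -> R) (u v : V) (p q c : seq V).

Fixpoint walk_weight w u p : R :=
  if p is v :: p' then w u v + walk_weight w v p' else 0.

Definition cycle_weight w c : R :=
  if c is u :: p then walk_weight w u (rcons p u) else 0.

Lemma walk_weight_cat w u p q :
  walk_weight w u (p ++ q) = walk_weight w u p + walk_weight w (last u p) q.
Proof.
elim: p u => [|v p IHp] u /=; first by rewrite add0r.
by rewrite IHp addrA.
Qed.

Lemma walk_weight_rcons w u p v :
  walk_weight w u (rcons p v) = walk_weight w u p + w (last u p) v.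
Proof. by rewrite -cats1 walk_weight_cat /= addr0. Qed.

(** Loop erasure: a step back to a visited vertex closes a simple cycle, whose weight is at most 0,
    so cutting it out does not lower the weight. *)
Lemma simple_walk e w s p :
  (forall c, uniq c -> cycle e c -> cycle_weight w c <= 0) -> path e s p ->
  exists q, [/\ path e s q, last s q = last s p, uniq (s :: q) &
                walk_weight w s p <= walk_weight w s q].
Proof.
move=> wc; elim/last_ind: p => [|p v IHp]; first by exists [::].
rewrite rcons_path => /andP[/IHp[q [qp ql qu qw]] puv].
rewrite last_rcons walk_weight_rcons.
have [vq|vNq] := boolP (v \in s :: q); last first.
  exists (rcons q v); split => //.
  - by rewrite rcons_path qp ql.
  - by rewrite last_rcons.
  - by rewrite -rcons_cons rcons_uniq vNq.
  - by rewrite walk_weight_rcons ql lerD2r.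
case/splitPl: vq qp ql qu qw => q1 q2 lq1.
rewrite cat_path last_cat lq1 => /andP[q1p q2p] ql.
rewrite -cat_cons cat_uniq => /and3P[q1u q12 q2u] qw.
exists q1; split => //.
have : cycle_weight w (v :: q2) <= 0.
  apply: wc.
    rewrite cons_uniq q2u andbT; apply: contra q12 => vq2.
    by apply/hasP; exists v => //; rewrite -lq1 mem_last.
  by rewrite /= rcons_path q2p ql.
rewrite /= walk_weight_rcons ql => w2.
move: qw; rewrite walk_weight_cat lq1; lra.
Qed.

(** Take for [psi v] the supremum of the weights of the walks ending at [v]. It is finite because
    loop erasure leaves at most [#|V|] steps, and extending a walk by one edge gives the
    inequality. *)
Lemma subaction e w :
  (forall c, uniq c -> cycle e c -> cycle_weight w c <= 0) ->
  exists psi : V -> R, forall u v, e u v -> w u v + psi u <= psi v.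
Proof.
move=> wc.
pose S v := [set x | exists s p, [/\ path e s p, last s p = v &
                                      x = walk_weight w s p]].
pose B := \sum_u \sum_v `|w u v|.
have wB u v : w u v <= B.
  rewrite /B (bigD1 u) //= (bigD1 v) //= -addrA.
  apply: (le_trans (ler_norm _)); rewrite lerDl.
  by apply: addr_ge0; apply: sumr_ge0 => // *; apply: sumr_ge0.
have B0 : 0 <= B by apply: sumr_ge0 => u _; apply: sumr_ge0.
have wwB s p : walk_weight w s p <= B * (size p)%:R.
  elim: p s => [|v p IHp] s /=; first by rewrite mulr0.
  by rewrite -natr1 mulrDr mulr1 addrC lerD.
have Sub v : has_ubound (S v).
  exists (B * #|V|%:R) => _ [s [p [sp _ ->]]].
  have [q [_ _ qu /le_trans ->//]] := simple_walk wc sp.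
  apply: (le_trans (wwB _ _)); rewrite ler_wpM2l // ler_nat.
  by rewrite (leq_trans _ (max_card (mem (s :: q)))) // (card_uniqP qu).
exists (fun v => sup (S v)) => u v euv.
rewrite -lerBrDl; apply: ge_sup; first by exists 0, u, [::].
move=> _ [s [p [sp lp ->]]]; rewrite lerBrDl.
apply: ub_le_sup => //; exists s, (rcons p v); split.
- by rewrite rcons_path sp lp.
- by rewrite last_rcons.
- by rewrite walk_weight_rcons lp addrC.
Qed.

End WalkWeight.

Lemma min_positive_value (R : realType) (I : finType) (F : I -> R) :
  exists2 s : R, 0 < s & forall i, 0 < F i -> s <= F i.
Proof.
have [i0 Fi0|noF] := pickP (fun i => 0 < F i); last first.
  by exists 1 => // i; rewrite noF.
case: (@arg_minP _ _ I i0 (fun i => 0 < F i) F Fi0) => i Fi Fmin.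
by exists (F i) => // j /Fmin.
Qed.

Section MaximalCycles.
Context {R : realType} {V : finType}.
Implicit Types (e : rel V) (w : V -> V -> R) (u v : V) (p q c : seq V).

(** [next] reads the first occurrence of a vertex, whence [uniq]. Written as a sum over vertices,
    weights of cycles can be compared edge by edge. *)
Lemma cycle_weight_next w c : uniq c ->
  cycle_weight w c = \sum_(x <- c) w x (next c x).
Proof.
case: c => [|y0 p] /=; first by rewrite big_nil.
rewrite -/(uniq (y0 :: p)) => yp.
suff: forall y, uniq (y :: p) -> walk_weight w y (rcons p y0) =
    \sum_(x <- y :: p) w x (next_at x y0 y p) by exact.
elim: p {yp} => [|y' p IHp] y /=.
  by rewrite big_seq1 eqxx addr0.
move=> /andP[yp y'p]; rewrite big_cons eqxx IHp //; congr (_ + _).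
apply: eq_big_seq => x xp.
by case: eqP xp yp => // -> ->.
Qed.

Lemma cycle_weight_const (k : R) c : cycle_weight (fun _ _ => k) c = k * (size c)%:R.
Proof.
case: c => [|u p] /=; first by rewrite mulr0.
suff: forall u v, walk_weight (fun _ _ => k) u (rcons p v) = k * (size p).+1%:R.
  exact.
elim: p => [|v p IHp] {}u x /=; first by rewrite addr0 mulr1.
by rewrite IHp [in RHS]mulrSr mulrDr mulr1 addrC.
Qed.

Lemma walk_weight_potential (psi : V -> R) u p :
  walk_weight (fun x y => psi y - psi x) u p = psi (last u p) - psi u.
Proof.
elim: p u => [|v p IHp] u /=; first by rewrite subrr.
by rewrite IHp; ring.
Qed.

Lemma cycle_weight_potential (psi : V -> R) c :
  cycle_weight (fun x y => psi y - psi x) c = 0.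
Proof.
by case: c => //= u p; rewrite walk_weight_potential last_rcons subrr.
Qed.

Lemma cycle_sum_next (psi : V -> R) c : uniq c ->
  \sum_(x <- c) psi (next c x) = \sum_(x <- c) psi x.
Proof.
move=> uc; apply/eqP; rewrite -subr_eq0 -sumrB.
by rewrite -(cycle_weight_next (fun x y => psi y - psi x)) // cycle_weight_potential.
Qed.

Definition maximal_cycle e w (m : R) c : Prop :=
  [/\ c != [::], uniq c, cycle e c & cycle_weight w c = m * (size c)%:R].

Definition maximal_cycle_mean e w (m : R) : Prop :=
  (exists c, maximal_cycle e w m c) /\
  forall c, uniq c -> cycle e c -> cycle_weight w c <= m * (size c)%:R.

Definition maximal_edge e w (m : R) u v : bool :=
  `[< exists c, [/\ maximal_cycle e w m c, u \in c & next c u = v] >].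

Lemma maximal_cycle_mean_exists e w c0 :
  c0 != [::] -> uniq c0 -> cycle e c0 -> exists m, maximal_cycle_mean e w m.
Proof.
move=> c0N c0u c0e.
(* A cycle without repetition has at most [#|V|] vertices, so these cycles fit in a finite type of
   tuples and the largest mean is attained. *)
pose T := {k : 'I_#|V|.+1 & k.-tuple V}.
pose P (t : T) := [&& tagged t != [::] :> seq V, uniq (tagged t) & cycle e (tagged t)].
pose F (t : T) := cycle_weight w (tagged t) / (size (tagged t))%:R.
have cP (c : seq V) : c != [::] -> uniq c -> cycle e c ->
    exists2 t : T, P t & tagged t = c :> seq V.
  move=> cN cu ce.
  have sc : (size c < #|V|.+1)%N.
    by rewrite ltnS -(card_uniqP cu) max_card.
  exists (Tagged (fun k : 'I_#|V|.+1 => k.-tuple V) (in_tuple c : (Ordinal sc).-tuple V)) => //.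
  by rewrite /P /= cN cu ce.
have [t0 Pt0 _] := cP _ c0N c0u c0e.
case: (@arg_maxP _ _ T t0 P F Pt0) => t /and3P[tN tu te] tmax.
have s0 (c : seq V) : c != [::] -> (0 : R) < (size c)%:R.
  by case: c => // ? ? _; rewrite ltr0n.
exists (F t); split.
  exists (tagged t); split => //.
  by rewrite /F divfK // gt_eqF // s0.
move=> c cu ce; have [->|cN] := eqVneq c [::]; first by rewrite mulr0.
have [t' Pt' tc] := cP _ cN cu ce.
by have := tmax _ Pt'; rewrite /= {1}/F tc ler_pdivrMr // s0.
Qed.

(** [psi] telescopes around the cycle, so the total slack does not depend on it and vanishes exactly
    when the weight is [m] times the length. *)
Lemma cycle_weight_maximal_slack w m (psi : V -> R) c : uniq c ->
  \sum_(x <- c) (m + psi (next c x) - psi x - w x (next c x)) =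
  m * (size c)%:R - cycle_weight w c.
Proof.
move=> uc; rewrite (cycle_weight_next w uc) sumrB; congr (_ - _).
rewrite -[RHS]cycle_weight_const (cycle_weight_next _ uc).
rewrite sumrB big_split /= (cycle_sum_next psi uc); ring.
Qed.

Lemma maximal_edge_next e w m c x : maximal_cycle e w m c -> x \in c ->
  maximal_edge e w m x (next c x).
Proof. by move=> cm xc; apply/asboolP; exists c. Qed.

Lemma maximal_edgeW e w m u v : maximal_edge e w m u v -> e u v.
Proof. by move=> /asboolP[c [[_ _ ce _] uc <-]]; exact: next_cycle. Qed.

(* Raising the weight of the non-maximal edges by a small kappa leaves all cycle
   means below m, so that the sub-action of the raised weight is strict there. *)
Lemma strict_subaction e w m : maximal_cycle_mean e w m ->
  exists psi : V -> R, exists2 kappa : R, 0 < kappa &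
  forall u v, e u v ->
    if maximal_edge e w m u v then w u v = m + psi v - psi u
    else w u v + kappa <= m + psi v - psi u.
Proof.
move=> [_ maxm].
have [psi1 psi1P] : exists psi : V -> R,
    forall u v, e u v -> (w u v - m) + psi u <= psi v.
  apply: (@subaction _ _ e (fun u v => w u v - m)) => c cu ce.
  have := maxm c cu ce; rewrite (cycle_weight_next w cu).
  rewrite (cycle_weight_next (fun u v => w u v - m) cu) -cycle_weight_const.
  by rewrite (cycle_weight_next _ cu) sumrB subr_le0.
pose s u v := m + psi1 v - psi1 u - w u v.
have s_ge0 u v : e u v -> 0 <= s u v by move=> /psi1P; rewrite /s; lra.
have [sg sg0 sgP] := @min_positive_value _ (V * V)%type (fun x => s x.1 x.2).
have cV0 : 0 < (#|V|.+1%:R : R) by rewrite ltr0n.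
(* A simple cycle has at most [#|V|] edges, so raising each by [k] adds less than [sg], the smallest
   positive slack. *)
pose k : R := sg / #|V|.+1%:R.
have k0 : 0 < k by rewrite divr_gt0.
have [psi2 psi2P] : exists psi : V -> R, forall u v, e u v ->
    ((if maximal_edge e w m u v then 0 else k) - s u v) + psi u <= psi v.
  apply: (@subaction _ _ e (fun u v => (if maximal_edge e w m u v then 0 else k) - s u v)).
  move=> c cu ce.
  rewrite (cycle_weight_next _ cu) sumrB subr_le0.
  have s0 x : x \in c -> 0 <= s x (next c x).
    by move=> xc; apply/s_ge0/next_cycle.
  (* Along maximal edges nothing is raised. Any other cycle is not maximal, so its total slack is
     positive and one of its edges alone has slack at least [sg]. *)
  have [/allP call|/allPn[x xc xN]] :=
      boolP (all (fun x => maximal_edge e w m x (next c x)) c).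
    rewrite big1_seq => [|x /andP[_ /call ->] //].
    by rewrite big_seq; apply: sumr_ge0 => x /s0.
  have : 0 < \sum_(x <- c) s x (next c x).
    rewrite cycle_weight_maximal_slack // subr_gt0 lt_neqAle maxm // andbT.
    apply: contra xN => /eqP cm; apply: (@maximal_edge_next e w m c) => //.
    by split => //; case: (c) xc.
  rewrite lt0r => /andP[sN0 _].
  have [y yc sy] : exists2 y, y \in c & 0 < s y (next c y).
    apply: contra_notP (negP sN0) => nosy.
    apply/eqP; rewrite big_seq big1 // => y yc; apply/eqP.
    rewrite eq_le s0 // andbT leNgt; apply/negP => sy.
    by apply: nosy; exists y.
  apply: (@le_trans _ _ sg).
    apply: (@le_trans _ _ (\sum_(x <- c) k)).
      by apply: ler_sum => z _; case: ifP => // _; exact: ltW.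
    have := cycle_weight_const k c; rewrite (cycle_weight_next _ cu) => ->.
    rewrite /k mulrAC ler_pdivrMr // ler_wpM2l ?(ltW sg0) // ler_nat.
    by rewrite (leq_trans _ (leqnSn _)) // -(card_uniqP cu) max_card.
  apply: (le_trans (sgP (y, next c y) sy)) => /=.
  rewrite (perm_big _ (perm_to_rem yc)) big_cons lerDl.
  by rewrite big_seq; apply: sumr_ge0 => z /mem_rem /s0.
exists (fun v => psi1 v + psi2 v), k => // u v euv.
have slackP x y : e x y -> w x y + (if maximal_edge e w m x y then 0 else k) <=
    m + (psi1 y + psi2 y) - (psi1 x + psi2 x).
  by move=> /psi2P; rewrite /s; lra.
(* Along a maximal cycle the slacks for [psi1 + psi2] are nonnegative with sum 0, hence all zero. *)
have := slackP u v euv; case: ifPn => // /asboolP[c [cm uc nv]] _.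
have [_ cu ce cw] := cm.
have := cycle_weight_maximal_slack w m (fun v => psi1 v + psi2 v) cu.
rewrite cw subrr big_seq => /eqP; rewrite psumr_eq0 => [/allP/(_ u uc)|x xc].
  by rewrite uc nv /= subr_eq0 => /eqP ->.
have := slackP _ _ (next_cycle ce xc).
by rewrite (maximal_edge_next cm xc) addr0 subr_ge0.
Qed.

End MaximalCycles.

(** * Counting walks and Perron eigenvalues *)

Lemma cvg_div_nat (R : realType) (f : nat -> R) (h : R) :
  (forall eps : R, 0 < eps -> exists K : R, forall m : nat,
     (h - eps) * m%:R - K <= f m <= (h + eps) * m%:R + K) ->
  f m / m%:R @[m --> \oo] --> h.
Proof.
move=> fh; apply/cvgrPdist_le => eps eps0.
have [K fK] := fh (eps / 2) (divr_gt0 eps0 (ltr0n _ 2)).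
exists (Num.truncn (`|K| / (eps / 2))).+1 => // m /= Km.
have m0 : (0 : R) < m%:R by rewrite ltr0n; case: m Km.
have KM : `|K| <= eps / 2 * m%:R.
  rewrite mulrC -ler_pdivrMr ?divr_gt0 //.
  apply: ltW; apply: (lt_le_trans (truncnS_gt _)).
  by rewrite ler_nat.
have := fK m; rewrite distrC ler_distlC => /andP[lo hi].
have := ler_norm K => KK.
apply/andP; split.
  by rewrite lerBlDr ler_pdivrMr //; nra.
by rewrite -lerBlDr ler_pdivlMr //; nra.
Qed.

Section TransferOperators.
Context {R : realType} {V : finType}.
Implicit Types (E : rel V) (a b : V -> V -> R) (x y : V -> R) (u v : V).

Definition transfer a x : V -> R := fun u => \sum_v a u v * x v.

Definition adjacency E u v : R := (E u v)%:R.

Definition nb_walks E k u v : R :=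
  iter k (transfer (adjacency E)) (fun z => (z == v)%:R) u.

Definition nb_walks_from E k u : R :=
  iter k (transfer (adjacency E)) (fun=> 1) u.

Lemma adjacency_ge0 E u v : 0 <= adjacency E u v.
Proof. exact: ler0n. Qed.

Lemma transfer_le a b x y : (forall u v, 0 <= a u v <= b u v) ->
  (forall v, 0 <= x v <= y v) -> forall u, 0 <= transfer a x u <= transfer b y u.
Proof.
move=> ab xy u; apply/andP; split.
  apply: sumr_ge0 => v _.
  by have /andP[? _] := ab u v; have /andP[? _] := xy v; exact: mulr_ge0.
apply: ler_sum => v _; have /andP[? ?] := ab u v; have /andP[? ?] := xy v.
exact: ler_pM.
Qed.

Lemma iter_transfer_le a b x y k : (forall u v, 0 <= a u v <= b u v) ->
  (forall v, 0 <= x v <= y v) ->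
  forall u, 0 <= iter k (transfer a) x u <= iter k (transfer b) y u.
Proof. by move=> ab xy; elim: k => [//|k IHk] /=; exact: transfer_le. Qed.

Lemma iter_adjacency_le E x y k : (forall v, 0 <= x v <= y v) ->
  forall u, 0 <= iter k (transfer (adjacency E)) x u
              <= iter k (transfer (adjacency E)) y u.
Proof. by apply: iter_transfer_le => u v; rewrite adjacency_ge0 /=. Qed.

Lemma iter_transferZ a c x k : iter k (transfer a) (fun v => c * x v) =
  fun u => c * iter k (transfer a) x u.
Proof.
elim: k => //= k ->; apply/funext => u; rewrite /transfer mulr_sumr.
by apply: eq_bigr => v _; rewrite mulrCA.
Qed.

Lemma iter_transferD a x y k : iter k (transfer a) (fun v => x v + y v) =
  fun u => iter k (transfer a) x u + iter k (transfer a) y u.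
Proof.
elim: k => //= k ->; apply/funext => u; rewrite /transfer -big_split.
by apply: eq_bigr => v _; rewrite mulrDr.
Qed.

Lemma nb_walks_ge0 E k u v : 0 <= nb_walks E k u v.
Proof.
have d z : 0 <= ((z == v)%:R : R) <= (z == v)%:R by rewrite ler0n lexx.
by have /andP[] := iter_adjacency_le E k d u.
Qed.

Lemma nb_walks_from_sum E k u : nb_walks_from E k u = \sum_v nb_walks E k u v.
Proof.
elim: k u => [|k IHk] u.
  rewrite /nb_walks /= (bigD1 u) //= eqxx big1 ?addr0 // => v.
  by rewrite eq_sym => /negbTE ->.
transitivity (\sum_v adjacency E u v * nb_walks_from E k v) => //.
under eq_bigr do rewrite IHk mulr_sumr.
by rewrite exchange_big.
Qed.

Lemma nb_walks_le_from E k u v : nb_walks E k u v <= nb_walks_from E k u.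
Proof.
rewrite nb_walks_from_sum (bigD1 v) //= lerDl.
by apply: sumr_ge0 => *; exact: nb_walks_ge0.
Qed.

Lemma nb_walksM E k l u v z :
  nb_walks E k u v * nb_walks E l v z <= nb_walks E (k + l) u z.
Proof.
rewrite /nb_walks iterD.
set y := iter l _ _.
have d t : 0 <= y v * ((t == v)%:R : R) <= y t.
  have y0 s : 0 <= y s by exact: nb_walks_ge0.
  by case: eqP => [->|_]; rewrite ?mulr1 ?mulr0 ?lexx y0.
have /andP[_] := iter_adjacency_le E k d u.
by rewrite iter_transferZ mulrC.
Qed.

Lemma nb_walks_path E u p : path E u p -> 1 <= nb_walks E (size p) u (last u p).
Proof.
elim: p u => [|v p IHp] u /=; first by rewrite /nb_walks /= eqxx.
move=> /andP[uv /IHp vp]; rewrite /nb_walks /= /transfer (bigD1 v) //=.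
rewrite /adjacency uv mul1r -[leLHS]addr0 lerD //.
apply: sumr_ge0 => z _; apply: mulr_ge0; first exact: adjacency_ge0.
exact: nb_walks_ge0.
Qed.

Lemma nb_walks_connect E u v : connect E u v ->
  exists2 l, (l <= #|V|)%N & 1 <= nb_walks E l u v.
Proof.
move=> /connectP[p /shortenP[q uq qu _] ->]; exists (size q).
  by have := max_card (mem (u :: q)); rewrite (card_uniqP qu) => /ltnW.
exact: nb_walks_path.
Qed.

Lemma nb_walks_from_le E k u : nb_walks_from E k u <= #|V|%:R ^+ k.
Proof.
elim: k u => [|k IHk] u; first by rewrite expr0.
rewrite /nb_walks_from iterS.
have d v : 0 <= nb_walks_from E k v <= #|V|%:R ^+ k.
  rewrite IHk andbT nb_walks_from_sum; apply: sumr_ge0 => *; exact: nb_walks_ge0.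
have ab (z t : V) : 0 <= adjacency E z t <= 1 by rewrite ler0n lern1 leq_b1.
have /andP[_ /le_trans ->//] := transfer_le ab d u.
rewrite /transfer; under eq_bigr do rewrite mul1r.
by rewrite sumr_const exprS mulr_natl.
Qed.

(** No edge leads from one strongly connected component to another. This fits the graph of maximal
    edges, which may have several components. *)
Definition recurrent E : Prop := forall u v, E u v -> connect E v u.

Lemma recurrent_connect E u v : recurrent E -> connect E u v -> connect E v u.
Proof.
move=> rE /connectP[p up ->]; elim: p u up => [|z p IHp] u //=.
move=> /andP[/rE uz /IHp zp]; exact: connect_trans zp uz.
Qed.

Lemma nb_walks_recurrent E k u v : recurrent E -> 0 < nb_walks E k u v ->
  connect E u v.
Proof.
move=> rE; elim: k u => [|k IHk] u.
  by rewrite /nb_walks /=; case: eqP => [->//|_]; rewrite ltxx.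
rewrite /nb_walks /= /transfer => s0.
have [z] : exists z, 0 < adjacency E u z * nb_walks E k z v.
  apply: contrapT => noz; move: s0; rewrite ltNge => /negP; apply.
  apply: sumr_le0 => z _; rewrite leNgt; apply/negP => z0; apply: noz.
  by exists z.
rewrite /adjacency; case: (boolP (E u z)) => [uz|_]; last by rewrite mul0r ltxx.
by rewrite mul1r => /IHk; apply: connect_trans; exact: connect1.
Qed.

Lemma nb_walks_from_nonterminal E k u :
  (forall v z, E v z -> exists t, E z t) -> (exists v, E u v) ->
  1 <= nb_walks_from E k u.
Proof.
move=> Enext; elim: k u => [|k IHk] u [v uv]; first by [].
rewrite /nb_walks_from /= /transfer (bigD1 v) //=.
rewrite {1}/adjacency uv mul1r -[leLHS]addr0 lerD //.
  by apply: IHk; exact: Enext uv.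
apply: sumr_ge0 => z _; apply: mulr_ge0; first exact: adjacency_ge0.
by rewrite -/(nb_walks_from E k z) nb_walks_from_sum; apply: sumr_ge0 => *; exact: nb_walks_ge0.
Qed.

(* The exponential growth rate is the supremum of ln c / k over the numbers c of
   closed walks of length k based at some vertex; in a recurrent graph every walk
   can be closed up at a bounded cost. *)
Lemma recurrent_growth E : recurrent E -> (exists u v, E u v) ->
  exists h : R, [/\ 0 <= h,
    exists2 C : R, 0 < C & forall k u, nb_walks_from E k u <= C * expR (h * k%:R),
    (forall rho : R, 0 < rho ->
       (forall k u, nb_walks E k u u <= rho ^+ k) -> h <= ln rho) &
    ln (\sum_u nb_walks_from E k u) / k%:R @[k --> \oo] --> h].
Proof.
move=> rE [u0 [v0 u0v0]].
pose S := [set t : R | exists k u, [/\ (0 < k)%N, 0 < nb_walks E k u u &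
   t = ln (nb_walks E k u u) / k%:R]].
have V0 : (0 : R) < #|V|%:R by rewrite ltr0n; apply/card_gt0P; exists u0.
have Sub : has_ubound S.
  exists (ln #|V|%:R) => _ [k [u [k0 w0 ->]]].
  rewrite ler_pdivrMr ?ltr0n // mulr_natr -lnXn // ler_ln ?posrE ?exprn_gt0 //.
  exact: le_trans (nb_walks_le_from _ _ _ _) (nb_walks_from_le _ _ _).
have [k1 k10 w1] : exists2 k, (0 < k)%N & 1 <= nb_walks E k u0 u0.
  have [l _ lw] := nb_walks_connect (rE _ _ u0v0).
  exists (1 + l)%N => //; apply: le_trans (nb_walksM _ _ _ _ v0 _).
  have := @nb_walks_path E u0 [:: v0]; rewrite /= u0v0 => /(_ isT) w.
  exact: mulr_ege1.
have S0 : S !=set0.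
  by exists (ln (nb_walks E k1 u0 u0) / k1%:R), k1, u0; split => //; exact: lt_le_trans w1.
pose h := sup S.
have h0 : 0 <= h.
  apply: le_trans (ub_le_sup Sub _); last by exists k1, u0; split => //; exact: lt_le_trans w1.
  by rewrite divr_ge0 // ln_ge0.
have closed k u : nb_walks E k u u <= expR (h * k%:R).
  have [w0|w0] := leP (nb_walks E k u u) 0.
    exact: le_trans w0 (expR_ge0 _).
  case: k w0 => [|k] w0; first by rewrite mulr0 expR0 /nb_walks /= eqxx.
  rewrite -[leLHS]lnK ?posrE // ler_expR -ler_pdivrMr ?ltr0n //.
  by apply: ub_le_sup => //; exists k.+1, u.
(* Each of the [#|V|] possible ends is joined back to [u] by at most [#|V|] further steps, and the
   closed walks so obtained are bounded through [h]. *)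
pose C : R := #|V|%:R * expR (h * #|V|%:R).
have C0 : 0 < C by rewrite mulr_gt0 ?expR_gt0.
have from k u : nb_walks_from E k u <= C * expR (h * k%:R).
  rewrite nb_walks_from_sum.
  apply: (@le_trans _ _ (\sum_(v : V) expR (h * #|V|%:R) * expR (h * k%:R))); last first.
    by rewrite sumr_const /C -mulrA mulr_natl.
  apply: ler_sum => v _; rewrite -expRD -mulrDr.
  have [w0|w0] := leP (nb_walks E k u v) 0; first exact: le_trans w0 (expR_ge0 _).
  have [l lV lw] := nb_walks_connect (recurrent_connect rE (nb_walks_recurrent rE w0)).
  apply: (@le_trans _ _ (nb_walks E (k + l) u u)).
    apply: le_trans (nb_walksM _ _ _ _ v _).
    by rewrite ler_peMr // ltW.
  apply: (le_trans (closed _ _)); rewrite ler_expR ler_wpM2l //.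
  by rewrite -natrD ler_nat addnC leq_add2r.
have Enext v z : E v z -> exists t, E z t.
  move=> /[dup] vz /rE /connectP[[|t p] /=]; first by move=> _ <-; exists z.
  by move=> /andP[zt _] _; exists t.
exists h; split => //; first by exists C.
  move=> rho rho0 rhoP; apply: ge_sup => // _ [k [u [k0 w0 ->]]].
  rewrite ler_pdivrMr ?ltr0n // mulr_natr -lnXn // ler_ln ?posrE ?exprn_gt0 //.
pose W k : R := \sum_u nb_walks_from E k u.
have W1 k : 1 <= W k.
  rewrite /W (bigD1 u0) //= -[leLHS]addr0 lerD //.
    by apply: nb_walks_from_nonterminal => //; exists v0.
  apply: sumr_ge0 => u _; rewrite nb_walks_from_sum; apply: sumr_ge0 => *; exact: nb_walks_ge0.
apply: cvg_div_nat => eps eps0.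
have [_ [k0 [u [k00 w0 ->]]] hk] := sup_adherent eps0 (conj S0 Sub : has_sup S).
pose c := nb_walks E k0 u u.
exists (`|ln c| + `|ln (#|V|%:R * C)|) => m; apply/andP; split; last first.
  have : ln (W m) <= ln (#|V|%:R * C) + h * m%:R.
    rewrite -[X in _ + X]expRK -lnM ?posrE ?expR_gt0 ?(mulr_gt0 V0 C0) //.
    rewrite ler_ln ?posrE ?(mulr_gt0 (mulr_gt0 V0 C0) (expR_gt0 _)) ?(lt_le_trans _ (W1 m)) //.
    apply: (@le_trans _ _ (\sum_(u : V) C * expR (h * m%:R))); first exact: ler_sum.
    by rewrite sumr_const -mulrA mulr_natl.
  have := ler_norm (ln (#|V|%:R * C)); have := normr_ge0 (ln c).
  have : 0 <= eps * m%:R by apply: mulr_ge0 => //; exact: ltW.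
  by rewrite mulrDl; lra.
(* Repeat [m %/ k0] times closed walks of nearly optimal rate at [u], then continue freely to reach
   length [m]. *)
have Wc : c ^+ (m %/ k0)%N <= W m.
  have [u1 uu1] : exists v, E u v.
    case: k0 k00 w0 {hk c} => // k0 _; rewrite /nb_walks /= /transfer => w0.
    apply: contrapT => nov; move: w0; rewrite big1 ?ltxx // => v _.
    by rewrite /adjacency; case: (boolP (E u v)) => [uv|]; [case: nov; exists v|rewrite mul0r].
  apply: (@le_trans _ _ (nb_walks_from E m u)); last first.
    rewrite /W (bigD1 u) //= lerDl; apply: sumr_ge0 => v _.
    by rewrite nb_walks_from_sum; apply: sumr_ge0 => *; exact: nb_walks_ge0.
  rewrite {2}(divn_eq m k0) /nb_walks_from iterD -/(nb_walks_from E (m %% k0)).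
  have d v : 0 <= ((v == u)%:R : R) <= nb_walks_from E (m %% k0) v.
    rewrite ler0n /=; case: eqP => [->|_].
      by apply: nb_walks_from_nonterminal => //; exists u1.
    by rewrite nb_walks_from_sum; apply: sumr_ge0 => *; exact: nb_walks_ge0.
  have /andP[_ /(le_trans _)] := iter_adjacency_le E (m %/ k0 * k0) d u; apply.
  elim: (m %/ k0)%N => [|q IHq]; first by rewrite expr0 mul0n /= eqxx.
  rewrite exprS mulSn; apply: le_trans (nb_walksM _ _ _ _ u _).
  by rewrite ler_wpM2l // ltW.
have c0 : 0 < c by [].
have lW : (m %/ k0)%:R * ln c <= ln (W m).
  rewrite mulr_natl -lnXn // ler_ln ?posrE ?exprn_gt0 //.
  exact: lt_le_trans (W1 m).
have mq : m%:R / k0%:R - 1 <= (m %/ k0)%:R :> R.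
  rewrite lerBlDr ler_pdivrMr ?ltr0n // natr1 -natrM ler_nat.
  by rewrite ltnW // ltn_ceil.
have qm : (m %/ k0)%:R <= m%:R / k0%:R :> R.
  by rewrite ler_pdivlMr ?ltr0n // -natrM ler_nat leq_trunc_div.
have : (h - eps) * m%:R <= ln c / k0%:R * m%:R by rewrite ler_wpM2r // ltW.
have -> : ln c / k0%:R * m%:R = m%:R / k0%:R * ln c by rewrite mulrAC -mulrA mulrC.
have := normr_ge0 (ln (#|V|%:R * C)).
(* The sign of [ln c] decides which bound on the quotient [m %/ k0] is used; rounding costs at most
   [|ln c|]. *)
have [l0|l0] := leP 0 (ln c).
  by rewrite (ger0_norm l0); nra.
by rewrite (ltr0_norm l0); nra.
Qed.

(** The eigenvector dominates [y u] times the indicator of [u]. Iterating [a], which dominates the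
    adjacency matrix, and reading the result at [u] gives the bound. *)
Lemma nb_walks_eigen_le E a y rho : (forall u v, adjacency E u v <= a u v) ->
  (forall u, 0 < y u) -> (forall u, transfer a y u = rho * y u) ->
  forall k u, nb_walks E k u u <= rho ^+ k.
Proof.
move=> Ea y0 ay k u.
have ai : iter k (transfer a) y = fun v => rho ^+ k * y v.
  elim: k => [|k IHk] /=; first by apply/funext => v; rewrite expr0 mul1r.
  rewrite IHk; have /= -> := iter_transferZ a (rho ^+ k) y 1; apply/funext => v.
  by rewrite ay mulrA exprSr.
rewrite -(ler_pM2r (y0 u)) -(congr1 (fun f => f u) ai) mulrC /nb_walks.
rewrite -(congr1 (fun f => f u) (iter_transferZ (adjacency E) (y u) _ k)).
have d v : 0 <= y u * ((v == u)%:R : R) <= y v.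
  by case: eqP => [->|_]; rewrite ?mulr1 ?mulr0 ?lexx ltW.
have ab z v : 0 <= adjacency E z v <= a z v by rewrite adjacency_ge0 Ea.
by have /andP[] := iter_transfer_le k ab d u.
Qed.

(* In the norm N x = sup_k exp (- h k) |A^k x|, the adjacency operator A has norm
   at most exp h, and a perturbation of size eps has norm O(eps). *)
Lemma eigenvalue_perturbation E (h C : R) : 0 < C ->
  (forall k u, nb_walks_from E k u <= C * expR (h * k%:R)) ->
  forall a y rho eps, 0 <= eps ->
    (forall u v, 0 <= a u v <= adjacency E u v + eps) ->
    (forall u, 0 < y u) -> (forall u, transfer a y u = rho * y u) ->
    (exists u : V, True) ->
    rho <= expR h + eps * #|V|%:R * C.
Proof.
move=> C0 fromC a y rho eps eps0 aE y0 ay [u0 _].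
pose A := transfer (adjacency E).
pose S := [set t : R | exists k u, t = expR (- (h * k%:R)) * iter k A y u].
pose Y := \sum_u y u.
have yY u : y u <= Y.
  by rewrite /Y (bigD1 u) //= lerDl; apply: sumr_ge0 => v _; rewrite ltW.
have Y0 : 0 <= Y by apply: sumr_ge0 => v _; rewrite ltW.
have it1 t k u : 0 <= t -> iter k A (fun=> t) u <= t * (C * expR (h * k%:R)).
  move=> t0; have -> : (fun=> t) = (fun v : V => t * 1) by apply/funext => v; rewrite mulr1.
  by rewrite iter_transferZ ler_wpM2l // fromC.
have eK k : expR (- (h * k%:R)) * expR (h * k%:R) = 1 :> R by rewrite -expRD addNr expR0.
have e0 k : 0 <= expR (- (h * k%:R)) :> R by exact: expR_ge0.
have Sub : has_ubound S.
  exists (Y * C) => _ [k [u ->]].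
  have d v : 0 <= y v <= Y by rewrite yY ltW.
  have /andP[_ /le_trans /(_ (it1 _ _ _ Y0))] := iter_adjacency_le E k d u.
  move=> /(ler_wpM2l (e0 k))/le_trans; apply.
  have -> : expR (- (h * k%:R)) * (Y * (C * expR (h * k%:R))) =
    Y * C * (expR (- (h * k%:R)) * expR (h * k%:R)) by ring.
  by rewrite eK mulr1.
pose N := sup S.
have yN u : y u <= N by apply: ub_le_sup => //; exists 0%N, u; rewrite mulr0 oppr0 expR0 mul1r.
have N0 : 0 < N by exact: lt_le_trans (y0 u0) (yN u0).
have YN : Y <= #|V|%:R * N.
  rewrite mulr_natl -sumr_const; exact: ler_sum.
have rho0 : 0 <= rho.
  rewrite -(pmulr_lge0 _ (y0 u0)) -ay; apply: sumr_ge0 => v _.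
  by have /andP[? _] := aE u0 v; rewrite mulr_ge0 // ltW.
suff bound t : S t -> rho * t <= expR h * N + eps * Y * C.
  have : rho * N <= expR h * N + eps * Y * C.
    have [rho_eq0|rhoN0] := eqVneq rho 0.
      rewrite rho_eq0 mul0r addr_ge0 // ?mulr_ge0 ?expR_ge0 //; exact: ltW.
    have rhop : 0 < rho by rewrite lt0r rhoN0.
    rewrite mulrC -ler_pdivlMr //; apply: ge_sup.
      by exists (expR (- (h * 0%:R)) * iter 0 A y u0), 0%N, u0.
    by move=> t /bound; rewrite ler_pdivlMr // mulrC.
  move=> rN; rewrite -(ler_pM2r N0); apply: (le_trans rN).
  rewrite mulrDl lerD2l -!mulrA ler_wpM2l // [C * N]mulrC mulrA.
  by rewrite ler_wpM2r // ltW.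
move=> [k [u ->]].
rewrite mulrCA -(congr1 (fun f => f u) (iter_transferZ (adjacency E) rho y k)).
(* After applying exp (- h k) A^k, the first term becomes exp h times a member of [S] of index
   [k.+1], and the second is at most [eps * Y * C]. *)
have d v : 0 <= rho * y v <= A y v + eps * Y.
  rewrite mulr_ge0 ?(ltW (y0 v)) //= -ay.
  rewrite /A /transfer /Y mulr_sumr -big_split /=; apply: ler_sum => z _.
  by rewrite -mulrDl ler_wpM2r ?(ltW (y0 z)) //; have /andP[] := aE v z.
have /andP[_ dk] := iter_adjacency_le E k d u.
apply: (le_trans (ler_wpM2l (e0 k) dk)).
rewrite iter_transferD mulrDr; apply: lerD.
  have -> : expR (- (h * k%:R)) = expR h * expR (- (h * k.+1%:R)) :> R.
    by rewrite -expRD; congr expR; rewrite -natr1; ring.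
  rewrite -mulrA ler_wpM2l ?expR_ge0 //; apply: ub_le_sup => //.
  by exists k.+1, u; rewrite iterSr.
have eY0 : 0 <= eps * Y by rewrite mulr_ge0.
apply: (le_trans (ler_wpM2l (e0 k) (it1 _ k u eY0))).
by rewrite mulrCA [X in _ * X <= _]mulrCA eK mulr1.
Qed.

(* At a vertex where y / z is maximal the two eigenvalue equations can be
   compared; equality propagates along edges. *)
Lemma eigenvalue_comparison (e : rel V) a b y z rho s :
  (forall u v, connect e u v) ->
  (forall u v, 0 <= a u v <= b u v) ->
  (forall u v, e u v -> 0 < b u v) -> (forall u v, ~~ e u v -> b u v = 0) ->
  (forall u, 0 < y u) -> (forall u, transfer a y u = rho * y u) ->
  (forall u, 0 < z u) -> (forall u, transfer b z u = s * z u) ->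
  (exists u : V, True) ->
  rho <= s /\ (rho = s -> forall u v, a u v = b u v).
Proof.
move=> econ ab bpos b0 y0 ay z0 bz [u0 _].
case: (@arg_maxP _ _ V u0 predT (fun u => y u / z u) isT) => u1 _ u1max.
pose c := y u1 / z u1.
have c0 : 0 < c by rewrite divr_gt0.
have yz v : y v <= c * z v by rewrite -ler_pdivrMr //; exact: u1max.
have term u v : a u v * y v <= b u v * (c * z v).
  have /andP[a0 ab'] := ab u v; apply: ler_pM => //; exact: ltW.
have sumz u : \sum_v b u v * (c * z v) = s * (c * z u).
  by under eq_bigr do rewrite mulrCA; rewrite -mulr_sumr -/(transfer b z u) bz mulrCA.
have y1 : y u1 = c * z u1 by rewrite /c divfK // gt_eqF.
split.
  rewrite -(ler_pM2r (y0 u1)) -ay y1 -sumz; exact: ler_sum.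
move=> rs.
have touch u : y u = c * z u -> forall v, a u v * y v = b u v * (c * z v).
  move=> yu v; apply/eqP; rewrite -subr_eq0 -oppr_eq0 opprB.
  have : \sum_v (b u v * (c * z v) - a u v * y v) == 0.
    by rewrite sumrB sumz -/(transfer a y u) ay yu rs subrr.
  rewrite psumr_eq0; last by move=> t _; rewrite subr_ge0.
  by move=> /allP/(_ v); rewrite mem_index_enum => /(_ isT).
have step u v : y u = c * z u -> e u v -> y v = c * z v.
  move=> /touch/(_ v) tv uv; apply/eqP; rewrite eq_le yz /=.
  rewrite -(ler_pM2l (bpos _ _ uv)) -tv ler_wpM2r ?(ltW (y0 v)) //.
  by have /andP[] := ab u v.
have all_touch u : y u = c * z u.
  have /connectP[p up ->] := econ u1 u.
  elim: p (u1) y1 up => [|v p IHp] t //= yt /andP[tv vp].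
  by apply: IHp => //; exact: step tv.
move=> u v; have [uv|uv] := boolP (e u v); last first.
  by have := ab u v; rewrite b0 // => /andP[a0 a1]; apply/eqP; rewrite eq_le a0 a1.
have := touch u (all_touch u) v; rewrite -all_touch; apply: mulIf.
by rewrite gt_eqF.
Qed.

End TransferOperators.

(** * Entropy of edge shifts *)

Lemma leastP (P : nat -> Prop) : (exists m, P m) -> P (least P).
Proof.
move=> [m Pm]; rewrite /least; case: pselect => [exP|[]].
  by case: ex_minnP => k /asboolP.
by exists m; apply/asboolP.
Qed.

Lemma least_le (P : nat -> Prop) m : P m -> (least P <= m)%N.
Proof.
move=> Pm; rewrite /least; case: pselect => [exP|//].
by case: ex_minnP => k _; apply; apply/asboolP.
Qed.

Section ShiftTopology.
Context {d : nat}.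
Local Notation S := (shift_space d).
Implicit Types (x y : S) (N : nat).

Definition window N x : set S :=
  [set y | forall k : int, (`|k| <= N)%N -> y k = x k].

Lemma open_coordinate (k : int) (P : set (symbol d)) : open [set x : S | P (x k)].
Proof.
have pc := @proj_continuous int (fun _ => discrete_topology (symbol d)) k.
have oP : @open (discrete_topology (symbol d)) P by exact: discrete_open.
exact: (open_comp (fun x _ => pc x) oP).
Qed.

Lemma open_window N x : open (window N x).
Proof.
elim: N => [|N IHN].
  rewrite (_ : window 0 x = [set y : S | y 0 = x 0]).
    exact: (open_coordinate 0 [set x 0]).
  apply/seteqP; split => y /=; first by apply.
  by move=> y0 k; rewrite leqn0 absz_eq0 => /eqP ->.
rewrite (_ : window N.+1 x = window N x `&`
   ([set y : S | y N.+1%:Z = x N.+1%:Z] `&`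
    [set y : S | y (- N.+1%:Z) = x (- N.+1%:Z)])).
  apply: openI => //; apply: openI.
    exact: (open_coordinate N.+1%:Z [set x N.+1%:Z]).
  exact: (open_coordinate (- N.+1%:Z) [set x (- N.+1%:Z)]).
apply/seteqP; split => y /=.
  move=> yx; split; first by move=> k kN; apply: yx; rewrite (leq_trans kN).
  by split; apply: yx; rewrite ?abszN.
move=> [yx [y1 y2]] k; rewrite leq_eqVlt => /orP[/eqP kN|]; last exact: yx.
have [->|->] : k = N.+1%:Z \/ k = - N.+1%:Z by lia.
  exact: y1.
exact: y2.
Qed.

Lemma window_refl N x : window N x x. Proof. by []. Qed.

Lemma nbhs_window x (W : set S) : nbhs x W -> exists N, window N x `<=` W.
Proof.
pose F : set_system S := [set W | exists N, window N x `<=` W].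
have FF : Filter F.
  split; first by exists 0%N.
  - move=> P Q [N NP] [M MQ]; exists (maxn N M) => y yx; split.
      by apply: NP => k kN; apply: yx; rewrite leq_max kN.
    by apply: MQ => k kN; apply: yx; rewrite leq_max kN orbT.
  - by move=> P Q PQ [N NP]; exists N; apply: subset_trans PQ.
suff Fx : F --> (x : S) by move=> /Fx.
apply/cvg_sup => k U [W0] [[Q] oQ <-] Qx WU.
exists `|k|%N => y yx; apply: WU => /=.
by rewrite (yx k).
Qed.

End ShiftTopology.

Section EdgeShift.
Context {R : realType} {d : nat} {V : finType}.
Variables (emb : V -> symbol d) (E : rel V).
Hypothesis emb_inj : injective emb.
Local Notation S := (shift_space d).
Implicit Types (y : int -> V) (x : S).

Definition bi_path y : Prop := forall k, E (y k) (y (k + 1)).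

Definition coded y : S := fun k => emb (y k).

Definition edge_shift : set S := [set x | exists2 y, bi_path y & x = coded y].

Lemma iter_left_shift m x (k : int) : iter m (@left_shift d) x k = x (k + m%:Z).
Proof.
elim: m x k => [|m IHm] x k; first by rewrite addr0.
by rewrite iterSr IHm /left_shift -addrA -[in RHS]addn1 PoszD.
Qed.

Lemma coded_shift y m : iter m (@left_shift d) (coded y) = coded (fun k => y (k + m%:Z)).
Proof. by apply/funext => k; rewrite iter_left_shift. Qed.

Lemma bi_path_shift y m : bi_path y -> bi_path (fun k => y (k + m%:Z)).
Proof. by move=> yE k; rewrite addrAC; exact: yE. Qed.

Lemma compact_edge_shift : compact edge_shift.
Proof.
have C : compact [set x : S | forall k : int, (range emb) (x k)].
  apply: (@tychonoff int (fun _ => discrete_topology (symbol d)) (fun _ => range emb)) => k.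
  by apply: finite_compact; apply: finite_image; exact: finite_finset.
apply: subclosed_compact C _; last first.
  by move=> x [y _ ->] k /=; exists (y k).
rewrite -openC openE => x xN.
(* Otherwise the edges chosen at all coordinates fit together by injectivity of [emb] and form a
   path coding [x]. A violation at [k] is shared by all points of a window. *)
have [k kN] : exists k : int, forall u v, E u v -> x k = emb u -> x (k + 1) <> emb v.
  apply: contrapT => noN; apply: xN.
  have {}noN (k : int) : exists uv : V * V, [/\ E uv.1 uv.2, x k = emb uv.1 & x (k + 1) = emb uv.2].
    apply: contrapT => no; apply: noN; exists k => u v uv xu xv; apply: no.
    by exists (u, v).
  have [f fP] := choice noN.
  exists (fun k => (f k).1) => [k|].
    have [fE _ f2] := fP k; have [_ f1 _] := fP (k + 1).
    by rewrite -(emb_inj (etrans (esym f2) f1)).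
  by apply/funext => k; have [] := fP k.
rewrite /interior.
have oW : nbhs x (window (`|k| + `|k + 1|) x).
  by apply: open_nbhs_nbhs; split => //; exact: open_window.
apply: filterS oW => z zx [y yE zy].
by apply: (kN _ _ (yE k)); rewrite -zx ?leq_addr ?leq_addl // zy.
Qed.

(** The Lebesgue number of the cover, by compactness. *)
Lemma edge_shift_lebesgue (U : set (set S)) : open_cover edge_shift U ->
  exists N, forall x, edge_shift x -> exists2 W, U W & window N x `<=` W.
Proof.
move=> [Uo Uc].
have [x /Uc[W UW Wx]|N _ NP] := (compact_near_coveringP edge_shift).1
  compact_edge_shift nat \oo (fun N x => exists2 W, U W & window N x `<=` W) _.
- have [N NW] := @nbhs_window d x W (open_nbhs_nbhs (conj (Uo _ UW) Wx)).
  exists (window N x, [set i | (N <= i)%N]) => /=.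
    split; first by apply: open_nbhs_nbhs; split => //; exact: open_window.
    by exists N.
  move=> [z i] /= [zx Ni]; exists W => // t tz; apply: NW => k kN.
  by rewrite tz ?zx // (leq_trans kN).
- by exists N => x; apply: NP => /=.
Qed.

Fixpoint walks k u : seq (seq V) :=
  if k is k'.+1 then [seq v :: p | v <- [seq v <- enum V | E u v], p <- walks k' v]
  else [:: [::]].

(** The index counts edges, so a word has [k + 1] vertices. *)
Definition words k : seq (seq V) := [seq u :: p | u <- enum V, p <- walks k u].

Lemma mem_walks k u p : (p \in walks k u) = (size p == k) && path E u p.
Proof.
elim: k u p => [|k IHk] u p /=; first by rewrite inE; case: p.
apply/allpairsPdep/andP => [[v [q [+ + ->]]]|].
  by rewrite mem_filter IHk => /andP[uv _] /andP[/eqP <- vq] /=; rewrite uv.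
case: p => [|v p] /= [] // sp /andP[uv vp]; exists v, p.
by rewrite mem_filter uv mem_enum IHk vp andbT; split.
Qed.

Lemma walks_uniq k u : uniq (walks k u).
Proof.
elim: k u => [//|k IHk] u /=; apply: allpairs_uniq_dep.
- by rewrite filter_uniq // enum_uniq.
- by move=> v _.
- by move=> [v p] [v' p'] _ _ /= [-> ->].
Qed.

Lemma size_walks k u : (size (walks k u))%:R = nb_walks_from E k u :> R.
Proof.
elim: k u => [//|k IHk] u /=.
rewrite size_allpairs_dep /nb_walks_from /= /transfer.
under eq_bigr do rewrite -/(nb_walks_from E k _) -IHk /adjacency.
rewrite sumnE big_map big_filter natr_sum big_enum_cond big_mkcond /=.
by apply: eq_bigr => v _; case: ifP; rewrite ?mul1r ?mul0r.
Qed.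

Lemma words_uniq k : uniq (words k).
Proof.
apply: allpairs_uniq_dep; first exact: enum_uniq.
- by move=> u _; exact: walks_uniq.
- by move=> [v p] [v' p'] _ _ /= [-> ->].
Qed.

Lemma size_words k : (size (words k))%:R = \sum_u nb_walks_from E k u :> R.
Proof.
rewrite size_allpairs_dep sumnE big_map natr_sum big_enum.
by apply: eq_bigr => v _; rewrite size_walks.
Qed.

Definition word_at y (a : int) k : seq V := [seq y (a + i%:Z) | i <- iota 0 k.+1].

Lemma nth_word_at y a k u0 i : (i <= k)%N -> nth u0 (word_at y a k) i = y (a + i%:Z).
Proof.
move=> ik; rewrite (nth_map 0%N) ?size_iota ?ltnS //.
by rewrite nth_iota ?ltnS.
Qed.

Lemma word_at_words y a k : bi_path y -> word_at y a k \in words k.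
Proof.
move=> yE; rewrite /word_at /=; apply/allpairsPdep.
exists (y (a + 0%:Z)), [seq y (a + i%:Z) | i <- iota 1 k].
rewrite mem_enum mem_walks size_map size_iota eqxx; split => //=.
have : forall b, path E (y (a + b%:Z)) [seq y (a + i%:Z) | i <- iota b.+1 k].
  elim: k => [//|k IHk] b /=; rewrite IHk andbT.
  by have := yE (a + b%:Z); rewrite -addrA -PoszD addn1.
exact.
Qed.

Lemma word_atP y y' a k (l : int) : word_at y a k = word_at y' a k ->
  a <= l <= a + k%:Z -> y l = y' l.
Proof.
move=> yy' /andP[al lk].
have [i li] : exists i : nat, l = a + i%:Z by exists `|l - a|%N; lia.
have ik : (i <= k)%N by lia.
by rewrite li -(nth_word_at y a (y 0) ik) yy' nth_word_at.
Qed.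

Hypothesis Epred : forall u v, E u v -> exists t, E t u.
Hypothesis Esucc : forall u v, E u v -> exists t, E v t.

(** Chosen successors and predecessors extend the walk in both directions. The word has at least one
    edge because a vertex without edges is a word that lies on no path. *)
Lemma words_realized k w : w \in words k.+1 ->
  exists2 y, bi_path y & word_at y 0 k.+1 = w.
Proof.
move=> /allpairsPdep[u [p [_ + ->]]]; rewrite mem_walks => /andP[/eqP sp up].
pose f v := odflt v [pick t | E v t]; pose g v := odflt v [pick t | E t v].
have fP v t : E v t -> E v (f v).
  by move=> vt; rewrite /f; case: pickP => //= /(_ t); rewrite vt.
have gP v t : E t v -> E (g v) v.
  by move=> vt; rewrite /g; case: pickP => //= /(_ t); rewrite vt.
have itf v t j : E v t -> E (iter j f v) (iter j.+1 f v).
  move=> vt; elim: j => [|j IHj]; first exact: fP vt.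
  by have [t' /fP] := Esucc IHj.
have itg v t j : E t v -> E (iter j.+1 g v) (iter j g v).
  move=> vt; elim: j => [|j IHj]; first exact: gP vt.
  by have [t' /gP] := Epred IHj.
have uv : E u (nth u p 0) by have := pathP u up 0%N; rewrite sp => /(_ isT).
have [u' u'u] := Epred uv.
have [v' lv'] : exists v', E (last u p) v'.
  have := pathP u up k; rewrite sp ltnSn => /(_ isT) /Esucc.
  by rewrite -[X in nth u p X]/(k.+1.-1) -sp nth_last (last_nth u) sp.
pose y (j : int) := match j with
  | Posz i => if (i <= k.+1)%N then nth u (u :: p) i else iter (i - k.+1) f (last u p)
  | Negz i => iter i.+1 g u end.
have yL i : (k.+1 <= i)%N -> y i%:Z = iter (i - k.+1) f (last u p).
  rewrite leq_eqVlt => /orP[/eqP <-|]; last by move=> ki; rewrite /y leqNgt ki.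
  by rewrite /y leqnn subnn /= -[k]/(k.+1.-1) -sp nth_last; case: (p) sp.
exists y.
  move=> [i|[|i]].
  - rewrite -PoszD addn1.
    have [ik|ki] := ltnP i k.+1.
      by rewrite /y ik (ltnW ik); have := pathP u up i; rewrite sp => /(_ ik).
    rewrite !yL // ?(leq_trans ki) // subSn //; exact: itf lv'.
  - by rewrite (_ : Negz 0 + 1 = 0) //; exact: (itg u u' 0%N).
  - rewrite (_ : Negz i.+1 + 1 = Negz i); first exact: (itg u u' i.+1).
    by rewrite !NegzE; lia.
apply: (@eq_from_nth _ u).
  by rewrite size_map size_iota /= sp.
move=> i; rewrite size_map size_iota ltnS => ik.
by rewrite nth_word_at // add0r /y ik.
Qed.

(** The symbols at places [-N] to [m + N] fix the windows of radius [N] around the places [0] to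
    [m], so one member of the join per word suffices. *)
Lemma subcover_words (U : set (set S)) N m :
  (forall x, edge_shift x -> exists2 W, U W & window N x `<=` W) ->
  exists2 n, (n <= size (words (m + N.*2)))%N &
    exists2 c : nat -> set S,
      forall i, (i < n)%N -> join_cover (@left_shift d) U m.+1 (c i) &
      edge_shift `<=` \bigcup_(i in `I_n) c i.
Proof.
move=> NU; set L := (m + N.*2)%N.
pose rw := [seq w <- words L | `[< exists2 y, bi_path y & word_at y (- N%:Z) L = w >]].
have covex w : exists W : set S, (exists2 y, bi_path y & word_at y (- N%:Z) L = w) ->
    join_cover (@left_shift d) U m.+1 W /\
    forall y, bi_path y -> word_at y (- N%:Z) L = w -> W (coded y).
  have [[y yE yw]|no] := pselect (exists2 y, bi_path y & word_at y (- N%:Z) L = w);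
    last by exists set0.
  have /choice[c cP] : forall j : nat, exists W : set S,
      U W /\ window N (iter j (@left_shift d) (coded y)) `<=` W.
    move=> j; have [|W UW Wy] := NU (iter j (@left_shift d) (coded y)); last by exists W.
    rewrite coded_shift; exists (fun k => y (k + j%:Z)) => //; exact: bi_path_shift.
  exists (\bigcap_(i in `I_m.+1) (iter i (@left_shift d) @^-1` c i)) => _; split.
    by exists c => // i _; have [] := cP i.
  move=> y' y'E y'w j /= jm; have [_] := cP j; apply => k kN.
  rewrite !coded_shift /coded (@word_atP y y' (- N%:Z) L) ?yw ?y'w //.
  rewrite /L; lia.
have [cov covP] := choice covex.
exists (size rw); first by rewrite size_filter count_size.
exists (fun i => cov (nth [::] rw i)).
  move=> i irw; have : nth [::] rw i \in rw by exact: mem_nth.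
  by rewrite mem_filter => /andP[/asboolP /covP[]].
move=> _ [y yE ->]; exists (index (word_at y (- N%:Z) L) rw).
  rewrite /= index_mem mem_filter word_at_words // andbT.
  by apply/asboolP; exists y.
rewrite nth_index; last first.
  rewrite mem_filter word_at_words // andbT; by apply/asboolP; exists y.
have [|_] := covP (word_at y (- N%:Z) L); first by exists y.
exact.
Qed.

(** A member of this join fixes [m + 2] consecutive symbols, so distinct words need distinct
    members. *)
Lemma words_subcover m n (c : nat -> set S) :
  (forall i, (i < n)%N -> join_cover (@left_shift d)
     [set W | exists u, W = [set x : S | x 0 = emb u]] m.+2 (c i)) ->
  edge_shift `<=` \bigcup_(i in `I_n) c i ->
  (size (words m.+1) <= n)%N.
Proof.
move=> cU cK.
have /choice[f fP] : forall w, exists i, w \in words m.+1 ->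
    (i < n)%N /\ exists2 y, word_at y 0 m.+1 = w & c i (coded y).
  move=> w; have [/words_realized[y yE yw]|_] := boolP (w \in words m.+1); last by exists 0%N.
  have [i iN ci] := cK (coded y) (ex_intro2 _ _ y yE erefl).
  by exists i => _; split => //; exists y.
rewrite -(size_map f) -[leqRHS](size_iota 0); apply: uniq_leq_size.
  rewrite map_inj_in_uniq ?words_uniq // => w w' /fP[i1 [y yw cy]] /fP[_ [y' y'w cy']] ff.
  rewrite -ff in cy'; have [C CU ci] := cU _ i1.
  rewrite ci in cy cy'; rewrite -yw -y'w /word_at.
  apply/eq_in_map => i; rewrite mem_iota /= add0n => im.
  have [u Cu] := CU i im.
  have := cy i im; have := cy' i im; rewrite Cu /= !coded_shift /coded => <-.
  by rewrite add0r; exact: emb_inj.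
by move=> _ /mapP[w /fP[i1 _] ->]; rewrite mem_iota.
Qed.

Lemma cvg_ln_shift (w : nat -> R) (h : R) a :
  ln (w k) / k%:R @[k --> \oo] --> h -> ln (w (k + a)%N) / k.+1%:R @[k --> \oo] --> h.
Proof.
move=> wh.
have fh : ln (w (k + a)%N) / (k + a)%:R @[k --> \oo] --> h.
  by have /= -> := cvg_shiftn a (fun k => ln (w k) / k%:R : R) (nbhs h).
have gh : (1 + (a%:R - 1) * k.+1%:R^-1 : R) @[k --> \oo] --> (1 + (a%:R - 1) * 0 : R).
  by apply: cvgD; [exact: cvg_cst|apply: cvgM; [exact: cvg_cst|exact: cvg_harmonic]].
have : (ln (w (k + a)%N) / (k + a)%:R * (1 + (a%:R - 1) / k.+1%:R) : R)
    @[k --> \oo] --> h * (1 + (a%:R - 1) * 0) by exact: cvgM fh gh.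
rewrite mulr0 addr0 mulr1.
apply: cvg_trans; apply: near_eq_cvg; exists 1%N => // k /= k0.
have k1 : (k.+1%:R : R) != 0 by rewrite pnatr_eq0.
have k2 : ((k + a)%:R : R) != 0 by rewrite pnatr_eq0 addn_eq0 negb_and -lt0n k0.
have -> : 1 + (a%:R - 1) * k.+1%:R^-1 = (k + a)%:R / k.+1%:R :> R.
  by rewrite natrD -natr1; field; rewrite natr1.
by rewrite mulrA divfK.
Qed.

Lemma htop_edge_shift (h : R) : (exists u v, E u v) -> 0 <= h ->
  ln (\sum_u nb_walks_from E k u) / k%:R @[k --> \oo] --> h ->
  htop edge_shift (@left_shift d) = h%:E.
Proof.
move=> [u0 [v0 uv0]] h0 wh.
pose w k : R := \sum_u nb_walks_from E k u.
have w1 k : 1 <= w k.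
  rewrite /w (bigD1 u0) //= -[leLHS]addr0 lerD //.
    apply: nb_walks_from_nonterminal; last by exists v0.
    by move=> v z /Esucc.
  apply: sumr_ge0 => u _; rewrite nb_walks_from_sum; apply: sumr_ge0 => *; exact: nb_walks_ge0.
have lnw n k : (n <= size (words k))%N -> ln (n%:R : R) <= ln (w k).
  case: n => [|n] nk; first by rewrite ln0 // ln_ge0.
  rewrite ler_ln ?posrE ?ltr0n // ?(lt_le_trans _ (w1 k)) //.
  by rewrite /w -size_words ler_nat.
apply/eqP; rewrite eq_le; apply/andP; split.
  apply: ge_ereal_sup => _ [U Uc <-]; rewrite lee_fin.
  have [N NU] := edge_shift_lebesgue Uc.
  pose s m : R := ln (subcover_number edge_shift (join_cover (@left_shift d) U m))%:R / m%:R.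
  have sw m : s m.+1 <= ln (w (m + N.*2)%N) / m.+1%:R.
    rewrite ler_wpM2r ?invr_ge0 //; apply: lnw.
    have [n nw nc] := subcover_words m NU.
    by apply: leq_trans nw; apply: least_le.
  rewrite /cover_entropy -/s.
  (* A divergent sequence has limit 0 by convention, which is harmless since [h] is nonnegative. *)
  have [sc|/dvgP ->] := pselect (cvgn s); last exact: h0.
  have sc1 : s n.+1 @[n --> \oo] --> limn s by rewrite cvg_shiftS.
  rewrite -(cvg_lim _ sc1) // -(cvg_lim _ (cvg_ln_shift (N.*2) wh)) //.
  apply: ler_lim; [exact: cvgP sc1|exact: cvgP (cvg_ln_shift (N.*2) wh)|].
  by apply: nearW => n; exact: sw.
(* The cover by the symbol at 0 is generating: its joins count words exactly, so it attains the
   bound. *)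
pose U0 : set (set S) := [set W | exists u, W = [set x : S | x 0 = emb u]].
have U0c : open_cover edge_shift U0.
  split; first by move=> _ [u ->]; exact: (open_coordinate 0 [set emb u]).
  by move=> _ [y yE ->]; exists [set x : S | x 0 = emb (y 0)] => //; exists (y 0).
apply: ereal_sup_ubound; exists U0 => //; congr (_%:E).
have NU x : edge_shift x -> exists2 W, U0 W & window 0 x `<=` W.
  move=> [y yE ->]; exists [set x : S | x 0 = emb (y 0)]; first by exists (y 0).
  by move=> z zy; rewrite /= zy.
have scn m : subcover_number edge_shift (join_cover (@left_shift d) U0 m.+2) = size (words m.+1).
  have [n nw nc] := subcover_words m.+1 NU; rewrite /= addn0 in nw.
  apply/eqP; rewrite eqn_leq; apply/andP; split.
    by apply: leq_trans nw; apply: least_le.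
  have [|c cU cK] := @leastP (fun n => exists2 c : nat -> set S,
    (forall i, (i < n)%N -> join_cover (@left_shift d) U0 m.+2 (c i)) &
    edge_shift `<=` \bigcup_(i in `I_n) c i); first by exists n.
  exact: words_subcover cU cK.
apply: cvg_lim => //.
pose s m : R := ln (subcover_number edge_shift (join_cover (@left_shift d) U0 m))%:R / m%:R.
rewrite -(cvg_shiftn 2 s).
pose g n : R := ln (w (n + 0)%N) / n.+1%:R.
rewrite (_ : (fun n => s (n + 2)%N) = (fun n => g (n + 1)%N)).
  by have /= -> := cvg_shiftn 1 g (nbhs h); exact: cvg_ln_shift.
by apply/funext => n; rewrite /g addn0 addn2 addn1 /s scn size_words.
Qed.

End EdgeShift.

(** * Maximizing measures and the maximizing subshift *)

Section UniformProbability.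
Context {R : realType} {disp : measure_display} {T : measurableType disp}.
Variables (k : nat) (p : nat -> T).
Hypothesis k0 : (0 < k)%N.

Lemma uniform_probability : exists mu : probability T R,
  (forall A, measurable A -> mu A = (k%:R^-1 * \sum_(i < k) (p i \in A)%:R)%:E) /\
  forall (D : set T) (f : T -> R), measurable D -> measurable_fun D f ->
    (forall x, D x -> 0 <= f x) -> (forall i, (i < k)%N -> D (p i)) ->
    (\int[mu]_(x in D) (f x)%:E)%E = (k%:R^-1 * \sum_(i < k) f (p i))%:E.
Proof.
pose dm (i : nat) : {measure set T -> \bar R} := [the measure T R of dirac (p i)].
pose nu : {measure set T -> \bar R} := [the measure T R of msum dm k].
have ki0 : 0 <= (k%:R : R)^-1 by rewrite invr_ge0.
pose m : {measure set T -> \bar R} := [the measure T R of mscale (NngNum ki0) nu].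
have mE A : m A = (k%:R^-1 * \sum_(i < k) (p i \in A)%:R)%:E.
  rewrite /m /= /mscale /= /msum EFinM -sumEFin; congr (_ * _)%E.
have m1 : m setT = 1%E.
  rewrite mE; congr (_%:E); under eq_bigr do rewrite in_setT.
  by rewrite sumr_const card_ord mulVf // pnatr_eq0 -lt0n.
(* The total mass is already 1; normalising only supplies the structure of a probability, the Dirac
   mass being a default value. *)
pose mu : probability T R := [the probability T R of mnormalize m (dirac (p 0%N))].
have muE A : mu A = m A.
  by rewrite /mu /= /mnormalize m1 /= onee_eq0 /= invr1 mule1.
exists mu; split => [A mA|D f mD mf f0 Dp]; first by rewrite muE mE.
rewrite (eq_measure_integral m) => [|A _ _]; last exact: muE.
have mf' := (measurable_EFinP D f).2 mf.
rewrite ge0_integral_mscale //.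
rewrite ge0_integral_measure_sum // EFinM -sumEFin; congr (_ * _)%E.
apply: eq_bigr => i _; rewrite integral_dirac // diracE mem_set ?mul1e //.
exact: Dp.
Qed.

End UniformProbability.

Section InvariantMeans.
Context {R : realType} {d : nat}.
Local Notation S := (shift_space d).
Local Notation B := (borel_shift_space d).
Implicit Types (X : set S) (Phi : symbol d -> symbol d -> R).

Lemma open_window_closed N (A : set S) :
  (forall x, A x -> window N x `<=` A) -> open A.
Proof.
move=> NA; rewrite openE => x Ax; apply: filterS (NA x Ax) _.
by apply: open_nbhs_nbhs; split; [exact: open_window|exact: window_refl].
Qed.

Lemma measurable_open (A : set S) : open A -> measurable (A : set B).
Proof. by move=> oA; exact: sub_sigma_algebra. Qed.

Lemma measurable_two_symbols Phi :
  measurable_fun [set: B] (fun x : B => Phi ((x : S) 0) ((x : S) 1)).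
Proof.
move=> _ Y mY; rewrite setTI; apply: measurable_open.
apply: (@open_window_closed 1) => x Yx y yx.
by rewrite /= !yx.
Qed.

Lemma measurable_left_shift : measurable_fun [set: B] (@left_shift d : B -> B).
Proof.
apply: (@measurability _ _ B B setT (@left_shift d) (@open S)) => //.
move=> _ [A oA <-]; rewrite setTI; apply: measurable_open.
rewrite openE => x Ax.
have [N NA] := nbhs_window (open_nbhs_nbhs (conj oA Ax)).
have oW : nbhs x (window N.+1 x).
  by apply: open_nbhs_nbhs; split; [exact: open_window|exact: window_refl].
apply: filterS oW => y yx; apply: NA => k kN; apply: yx.
lia.
Qed.

Lemma bounded_two_symbols_integrable (mu : probability B R) (D : set B) Phi (C : R) :
  measurable D -> (forall x, D x -> `|Phi ((x : S) 0) ((x : S) 1)| <= C) ->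
  mu.-integrable D (EFin \o (fun x : B => Phi ((x : S) 0) ((x : S) 1))).
Proof.
move=> mD DC; apply: measurable_bounded_integrable => //.
- by apply: le_lt_trans (probability_le1 mu mD) _; rewrite ltry.
- apply: measurable_funS (measurable_two_symbols Phi) => //.
- exists C; split; first by rewrite num_real.
  by move=> M CM x Dx; apply: le_trans (DC x Dx) _; exact: ltW.
Qed.

(** The coboundary [psi (x 1) - psi (x 0)] has integral 0 by invariance, so integrating the
    pointwise inequality leaves [m]. *)
Lemma invariant_mean_le X Phi (m C : R) (psi : symbol d -> R) :
  measurable (X : set B) ->
  (forall x, X x -> Phi (x 0) (x 1) <= m + psi (x 1) - psi (x 0)) ->
  (forall s, `|psi s| <= C) -> (forall x, X x -> `|Phi (x 0) (x 1)| <= C) ->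
  forall c, invariant_means X Phi c -> c <= m.
Proof.
move=> mX Xm psiC PhiC c [mu [muX muinv] ->].
have iPhi := bounded_two_symbols_integrable mu mX PhiC.
have i0 (D : set B) : measurable D -> mu.-integrable D (EFin \o (fun x : B => psi ((x : S) 0))).
  move=> mD.
  by apply: (@bounded_two_symbols_integrable mu D (fun s _ => psi s) C).
have i1 (D : set B) : measurable D -> mu.-integrable D (EFin \o (fun x : B => psi ((x : S) 1))).
  move=> mD.
  by apply: (@bounded_two_symbols_integrable mu D (fun _ s => psi s) C).
have im (D : set B) : measurable D -> mu.-integrable D (EFin \o (fun x : B => m)).
  move=> mD.
  by apply: (@bounded_two_symbols_integrable mu D (fun _ _ => m) `|m|).
have i01 : mu.-integrable X (EFin \o (fun x : B => psi ((x : S) 1) - psi ((x : S) 0))).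
  apply: (@bounded_two_symbols_integrable mu X (fun s t => psi t - psi s) (C + C)) => // x _.
  by apply: le_trans (ler_normB _ _) _; exact: lerD.
(* Shift-invariance concerns the measure on the whole space, so the integrals are moved there from
   [X], which has full measure. *)
have XT (f : B -> R) : mu.-integrable setT (EFin \o f) ->
    \int[mu]_(x in X) f x = \int[mu]_x f x.
  move=> fi; rewrite /Rintegral; congr fine.
  rewrite [RHS](@negligible_integral _ _ _ mu setT (~` X)) //.
  - by rewrite setTD setCK.
  - exact: measurableC.
  - have := probability_setC mu mX; rewrite /= muX => ->; by rewrite subee.
apply: (@le_trans _ _ (\int[mu]_(x in X) (m + (psi ((x : S) 1) - psi ((x : S) 0))))).
  apply: le_Rintegral => //; last by move=> x Xx; rewrite addrA; exact: Xm.
  have := integrableD mX (im _ mX) i01; exact.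
rewrite RintegralD //; last exact: im.
rewrite Rintegral_cst // [X in fine X](_ : _ = 1%E) ?mulr1; last exact: muX.
rewrite RintegralB //; [|exact: i1|exact: i0].
rewrite !XT; [|exact: i0|exact: i1].
suff -> : \int[mu]_x psi ((x : S) 1) = \int[mu]_x psi ((x : S) 0) by rewrite subrr addr0.
rewrite /Rintegral; congr fine.
pose g : B -> \bar R := EFin \o (fun x : B => psi ((x : S) 0)).
have mg : measurable_fun [set: B] g by have /integrableP[] := i0 setT measurableT.
transitivity (\int[mu]_x (g \o (@left_shift d)) x)%E => //.
have := @integral_pushforward _ _ B B R _ measurable_left_shift mu setT g mg
  (i1 setT measurableT) measurableT.
rewrite preimage_setT => <-.
apply: eq_measure_integral => [|? A mA _]; first exact: measurable_left_shift.
exact: muinv.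
Qed.

Lemma periodic_mean X Phi (x : S) k (C : R) :
  measurable (X : set B) -> (forall x, X x -> `|Phi (x 0) (x 1)| <= C) ->
  (0 < k)%N -> iter k (@left_shift d) x = x ->
  (forall i, X (iter i (@left_shift d) x)) ->
  invariant_means X Phi ((\sum_(i < k) Phi (x (i : nat)%:Z) (x i.+1%:Z)) / k%:R).
Proof.
move=> mX PhiC k0 xk xX.
have [mu [muE muI]] := @uniform_probability R _ B k (fun i => iter i (@left_shift d) x) k0.
have kN0 : (k%:R : R) != 0 by rewrite pnatr_eq0 -lt0n.
exists mu.
  split.
    rewrite muE //; congr (_%:E); rewrite (eq_bigr (fun=> 1)) => [|i _].
      by rewrite sumr_const card_ord mulVf.
    by rewrite mem_set.
  move=> A mA; rewrite !muE //; last first.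
    by have := measurable_left_shift measurableT mA; rewrite setTI.
  congr (_ * _)%:E.
  case: k k0 xk {muE muI kN0} => // k _ xk.
  (* The shift permutes the orbit cyclically: by periodicity the last term on the left is the first
     one on the right. *)
  rewrite big_ord_recr [RHS]big_ord_recl addrC /=; congr (_ + _).
    congr (nat_of_bool _)%:R; rewrite -[in RHS]xk.
    by apply/idP/idP => /set_mem ?; apply/mem_set.
(* [uniform_probability] integrates nonnegative functions, so [C] is added here and removed at the
   end. *)
have f0 (z : B) : X z -> 0 <= Phi ((z : S) 0) ((z : S) 1) + C.
  by move=> /PhiC; rewrite ler_norml => /andP[? _]; lra.
have mf : measurable_fun (X : set B) (fun z : B => Phi ((z : S) 0) ((z : S) 1) + C).
  by apply: measurable_funS (measurable_two_symbols (fun s t => Phi s t + C)).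
have := muI _ _ mX mf f0 (fun i _ => xX i).
move=> /(congr1 fine) /=.
rewrite -/(Rintegral mu X (fun z : B => Phi ((z : S) 0) ((z : S) 1) + C)).
have iPhi := bounded_two_symbols_integrable mu mX PhiC.
have iC : mu.-integrable (X : set B) (EFin \o (fun=> C)).
  by apply: (@bounded_two_symbols_integrable mu X (fun _ _ => C) `|C|).
have muX : fine (mu (X : set B)) = 1.
  rewrite muE //= (eq_bigr (fun=> 1)) => [|i _]; last by rewrite mem_set.
  by rewrite sumr_const card_ord mulVf.
rewrite RintegralD // Rintegral_cst // muX mulr1 => /eqP.
rewrite eq_sym -subr_eq => /eqP <-.
rewrite big_split /= sumr_const card_ord mulrDr -[C *+ k]mulr_natl mulKf // addrK mulrC.
congr (_ * _); apply: eq_bigr => i _; rewrite !iter_left_shift add0r.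
by rewrite -PoszD.
Qed.

End InvariantMeans.

Section PeriodicPaths.
Context {V : finType}.
Implicit Types (y : int -> V) (c : seq V).

Lemma periodic_mod y n : (forall k, y (k + n%:Z) = y k) -> (0 < n)%N ->
  forall k : int, exists2 i : nat, (i < n)%N & y k = y i%:Z /\ y (k + 1) = y i.+1%:Z.
Proof.
move=> yn n0 k.
have yM (j : int) (q : nat) : y (j + (q * n)%:Z) = y j.
  elim: q => [|q IHq]; first by rewrite mul0n addr0.
  by rewrite mulSn addnC PoszD addrA yn.
have yZ (j q : int) : y (j + q * n%:Z) = y j.
  case: q => q; first by rewrite -PoszM yM.
  by rewrite NegzE mulNr -PoszM -[RHS](yM _ q.+1) -[in RHS](yM _ q.+1) -[RHS](yM _ 0%N) mul0n addr0 -[in LHS](yM _ q.+1) -addrA addNr addr0 yM.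
have n0' : n%:Z != 0 by rewrite eqz_nat -lt0n.
exists `|(k %% n%:Z)%Z|%N.
  have := ltz_pmod k (n0 : 0 < n%:Z); have := modz_ge0 k n0'; lia.
have kE : k = `|(k %% n%:Z)%Z|%N%:Z + (k %/ n%:Z)%Z * n%:Z.
  by rewrite gez0_abs ?modz_ge0 // addrC -divz_eq.
split; first by rewrite {1}kE yZ.
by rewrite {1}kE addrAC yZ -addn1 PoszD.
Qed.

(** A period without repetition is a simple cycle; [cycle_periodic] is the converse. *)
Lemma periodic_next y n : (forall k, y (k + n%:Z) = y k) -> (0 < n)%N ->
  (forall i j : nat, (i < n)%N -> (j < n)%N -> y i%:Z = y j%:Z -> i = j) ->
  uniq [seq y i%:Z | i <- iota 0 n] /\
  forall k, y k \in [seq y i%:Z | i <- iota 0 n] /\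
            next [seq y i%:Z | i <- iota 0 n] (y k) = y (k + 1).
Proof.
move=> yn n0 yinj; set c := [seq _ | _ <- _].
have uc : uniq c.
  rewrite map_inj_in_uniq ?iota_uniq // => i j.
  by rewrite !mem_iota !add0n /= => ii jj; exact: yinj.
split => // k; have [i iN [-> ->]] := periodic_mod yn n0 k.
have yc : y i%:Z \in c by apply/mapP; exists i; rewrite // mem_iota add0n.
split => //; rewrite next_nth yc.
have sc : size c = n by rewrite size_map size_iota.
have ic : index (y i%:Z) c = i.
  have -> : y i%:Z = nth (y 0) c i by rewrite (nth_map 0%N) ?size_iota // nth_iota.
  by rewrite index_uniq // sc.
rewrite ic; case cE : c => [|u p]; first by rewrite cE in yc.
have uE : u = y 0.
  have : nth u c 0 = y 0 by rewrite (nth_map 0%N) ?size_iota // nth_iota.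
  by rewrite cE.
have sp : n = (size p).+1 by rewrite -sc cE.
have [ip|pi] := ltnP i (size p).
  have -> : nth u p i = nth u c i.+1 by rewrite cE.
  by rewrite (nth_map 0%N) ?size_iota ?sp // nth_iota ?sp.
rewrite nth_default // uE -(yn 0) add0r; congr (y _%:Z).
by apply/eqP; rewrite eqn_leq sp ltnS pi -sp iN.
Qed.

Lemma cycle_periodic (E : rel V) c : c != [::] -> uniq c -> cycle E c ->
  exists y : int -> V, [/\ bi_path E y, forall k, y (k + (size c)%:Z) = y k,
     forall i j : nat, (i < size c)%N -> (j < size c)%N -> y i%:Z = y j%:Z -> i = j &
     [seq y i%:Z | i <- iota 0 (size c)] = c].
Proof.
case: c => // u p _ uc ec; set c := u :: p; set n := size c.
have n0 : (0 < n)%N by [].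
have n0' : n%:Z != 0 by [].
pose y (k : int) := nth u c `|(k %% n%:Z)%Z|%N.
have yi i : (i < n)%N -> y i%:Z = nth u c i by move=> iN; rewrite /y modz_nat absz_nat modn_small.
have yn k : y (k + n%:Z) = y k by rewrite /y modzDr.
have yinj i j : (i < n)%N -> (j < n)%N -> y i%:Z = y j%:Z -> i = j.
  by move=> ii jj; rewrite !yi // => /eqP; rewrite nth_uniq // => /eqP.
have cE : [seq y i%:Z | i <- iota 0 n] = c.
  apply: (@eq_from_nth _ u); rewrite size_map size_iota // => i iN.
  by rewrite (nth_map 0%N) ?size_iota // nth_iota // yi.
exists y; split => // k.
have [_ /(_ k)] := periodic_next yn n0 yinj; rewrite cE => -[yc <-].
exact: next_cycle.
Qed.

Lemma cycle_weight_periodic (R : realType) (w : V -> V -> R) y n :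
  (forall k, y (k + n%:Z) = y k) -> (0 < n)%N ->
  (forall i j : nat, (i < n)%N -> (j < n)%N -> y i%:Z = y j%:Z -> i = j) ->
  cycle_weight w [seq y i%:Z | i <- iota 0 n] =
  \sum_(i < n) w (y (i : nat)%:Z) (y i.+1%:Z).
Proof.
move=> yn n0 yinj; have [uc yc] := periodic_next yn n0 yinj.
rewrite (cycle_weight_next _ uc) big_map.
rewrite (eq_bigr (fun j : nat => w (y j%:Z) (y j.+1%:Z))) => [|j _].
  by rewrite -[X in iota 0 X]subn0 -/(index_iota 0 n) big_mkord.
by rewrite (yc j%:Z).2 -PoszD addn1.
Qed.

End PeriodicPaths.

Section MaximizingSubshift.
Context {R : realType} {d : nat} {V : finType}.
Variables (emb : V -> symbol d) (E : rel V) (Phi : symbol d -> symbol d -> R).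
Hypothesis emb_inj : injective emb.
Local Notation S := (shift_space d).
Local Notation B := (borel_shift_space d).
Local Notation X := (edge_shift emb E).
Let w u v := Phi (emb u) (emb v).

Lemma measurable_edge_shift : measurable (X : set B).
Proof.
rewrite -[X]setCK; apply: measurableC; apply: measurable_open.
rewrite openC; apply: compact_closed; last exact: compact_edge_shift.
apply: hausdorff_product => k.
exact: discrete_hausdorff.
Qed.

Let w_bounded : exists C, forall x : S, X x -> `|Phi (x 0) (x 1)| <= C.
Proof.
exists (\sum_u \sum_v `|w u v|) => _ [y _ ->].
rewrite (bigD1 (y 0)) //= (bigD1 (y 1)) //= -addrA lerDl.
by apply: addr_ge0; apply: sumr_ge0 => // *; apply: sumr_ge0.
Qed.

Let mean_le m : (forall c, uniq c -> cycle E c -> cycle_weight w c <= m * (size c)%:R) ->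
  forall c, invariant_means X Phi c -> c <= m.
Proof.
move=> wm.
have [psi psiP] : exists psi : V -> R, forall u v, E u v -> (w u v - m) + psi u <= psi v.
  apply: (@subaction _ _ E (fun u v => w u v - m)) => c cu ce.
  have := wm c cu ce; rewrite (cycle_weight_next w cu).
  rewrite (cycle_weight_next (fun u v => w u v - m) cu) -cycle_weight_const.
  by rewrite (cycle_weight_next _ cu) sumrB subr_le0.
(* Symbols that code no vertex get the value 0, which makes [psi] a function of all symbols. *)
pose psi' s := if [pick u | emb u == s] is Some u then psi u else 0.
have psiE u : psi' (emb u) = psi u.
  rewrite /psi'; case: pickP => [v /eqP /emb_inj -> //|/(_ u)].
  by rewrite eqxx.
have [C CP] := w_bounded.
have psiC s : `|psi' s| <= `|C| + \sum_u `|psi u|.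
  rewrite /psi'; case: pickP => [v _|_].
    rewrite (bigD1 v) //= addrCA lerDl; apply: addr_ge0 => //.
    exact: sumr_ge0.
  by rewrite normr0 addr_ge0 // sumr_ge0.
apply: (@invariant_mean_le R d X Phi m (`|C| + \sum_u `|psi u|) psi') => //.
- exact: measurable_edge_shift.
- move=> _ [y yE ->]; rewrite /coded !psiE; have := psiP _ _ (yE 0).
  by rewrite add0r /w; lra.
- move=> x /CP /le_trans; apply; apply: le_trans (ler_norm _) _.
  by rewrite lerDl sumr_ge0.
Qed.

Lemma cycle_mean c : c != [::] -> uniq c -> cycle E c ->
  invariant_means X Phi (cycle_weight w c / (size c)%:R).
Proof.
move=> cN cu ce; have [C CP] := w_bounded.
have [y [yE yn yinj yc]] := cycle_periodic cN cu ce.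
have c0 : (0 < size c)%N by case: (c) cN.
have yk : iter (size c) (@left_shift d) (coded emb y) = coded emb y.
  by rewrite coded_shift; apply/funext => k; rewrite /coded yn.
have yX i : X (iter i (@left_shift d) (coded emb y)).
  by rewrite coded_shift; exists (fun k => y (k + i%:Z)) => //; exact: bi_path_shift.
have := periodic_mean measurable_edge_shift CP c0 yk yX.
congr (invariant_means _ _ (_ / _)).
by rewrite -[in RHS]yc (cycle_weight_periodic w yn c0 yinj).
Qed.

(** A subaction bounds every invariant mean by [m], and the uniform measure on a maximal cycle
    attains it. *)
Lemma max_mean_edge_shift m : maximal_cycle_mean E w m -> max_mean X Phi = m.
Proof.
move=> [[c [cN cu ce cw]] wm]; have s0 : ((size c)%:R : R) != 0.
  by rewrite pnatr_eq0 size_eq0.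
have mI : invariant_means X Phi m.
  by have := cycle_mean cN cu ce; rewrite cw mulfK.
apply/eqP; rewrite eq_le; apply/andP; split.
  by apply: ge_sup; [exists m|exact: mean_le].
by apply: ub_le_sup => //; exists m; exact: mean_le.
Qed.

(** Both sides ask that each step lie on a simple cycle of maximal mean: elementary periodic orbits
    are the simple cycles, and [max_mean] is the best of their means. *)
Lemma maximizing_subshiftE m : maximal_cycle_mean E w m ->
  maximizing_subshift X Phi = edge_shift emb (maximal_edge E w m).
Proof.
move=> mE; apply/seteqP; split => [x [[y yE ->] yP]|x].
  exists y => // k.
  have [z' [n [[[[z zE ->] [n0 zn _] zinj] +] [j [zj zj1]]]]] := yP k.
  rewrite (max_mean_edge_shift mE) => zw.
  have {}zn l : z (l + n%:Z) = z l.
    by move: zn; rewrite coded_shift => /(congr1 (fun f => f l)) /emb_inj.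
  have {}zinj i1 j1 : (i1 < n)%N -> (j1 < n)%N -> z i1%:Z = z j1%:Z -> i1 = j1.
    by move=> ii jj zz; apply: zinj => //; rewrite /coded zz.
  have [uc zc] := periodic_next zn n0 zinj; set c := [seq _ | _ <- _] in uc zc.
  apply/asboolP; exists c.
  rewrite -(emb_inj zj) -(emb_inj zj1); have [-> ->] := zc j; split => //.
  have sc : size c = n by rewrite size_map size_iota.
  split => //; first by rewrite -size_eq0 sc -lt0n.
    have : forall v, v \in c -> E v (next c v).
      move=> _ /mapP[i _ ->]; have [_ ->] := zc i%:Z; exact: zE.
    move=> cE; apply/(cycle_from_next uc) => v vc; exact: cE.
  rewrite sc -(divfK (_ : (n%:R : R) != 0) (cycle_weight w c)) ?pnatr_eq0 -?lt0n //.
  congr (_ * _); rewrite -zw; congr (_ / _).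
  exact: cycle_weight_periodic.
move=> [y yE ->]; split.
  by exists y => // k; exact: maximal_edgeW (yE k).
move=> k; have /asboolP[c [[cN cu ce cw] yc nc]] := yE k.
have [z [zE zn zinj zc]] := cycle_periodic cN cu ce.
have c0 : (0 < size c)%N by case: (c) cN.
have [_ znext] := periodic_next zn c0 zinj; rewrite /= zc in znext.
exists (coded emb z), (size c); split.
  split.
    split => //; first by exists z.
      split => //; first by rewrite coded_shift; apply/funext => l; rewrite /coded zn.
      move=> i /andP[i0 ic] /(congr1 (fun f => f 0)); rewrite coded_shift /coded => /emb_inj.
      by rewrite add0r => /(zinj i 0%N ic c0) i00; rewrite i00 in i0.
    by move=> i j ic jc /emb_inj; exact: zinj.
  rewrite (max_mean_edge_shift mE).
  apply: (mulIf (_ : ((size c)%:R : R) != 0)); first by rewrite pnatr_eq0 -lt0n.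
  rewrite divfK ?pnatr_eq0 -?lt0n // -cw -[in RHS]zc.
  by rewrite (cycle_weight_periodic w zn c0 zinj).
have /mapP[i _ yi] : y k \in [seq z i%:Z | i <- iota 0 (size c)] by rewrite zc.
exists i%:Z; rewrite /coded -yi; split => //.
by have [_ <-] := znext i%:Z; rewrite -yi nc.
Qed.

End MaximizingSubshift.

(** Reduces minima to maxima for the opposite potential, so that only maximal cycles are studied. *)
Lemma min_mean_opp (R : realType) (d : nat) (X : set (shift_space d))
    (Phi : symbol d -> symbol d -> R) :
  measurable (X : set (borel_shift_space d)) ->
  (exists C, forall x : shift_space d, X x -> `|Phi (x 0) (x 1)| <= C) ->
  min_mean X Phi = - max_mean X (fun s t => - Phi s t).
Proof.
move=> mX [C CP]; rewrite /min_mean /inf; congr (- sup _).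
have opp (F : symbol d -> symbol d -> R) c :
    (forall x : shift_space d, X x -> `|F (x 0) (x 1)| <= C) ->
    invariant_means X F c -> invariant_means X (fun s t => - F s t) (- c).
  move=> FC [mu muI ->]; exists mu => //.
  have := bounded_two_symbols_integrable mu mX FC => iF.
  have := RintegralZl (-1) mX iF; rewrite mulN1r => <-.
  by apply: eq_Rintegral => x _; rewrite mulN1r.
apply/seteqP; split => [_ [c cI <-]|c cI]; first exact: opp.
exists (- c); last by rewrite opprK.
have := opp (fun s t => - Phi s t) c _ cI.
rewrite (_ : (fun s t => - - Phi s t) = Phi); last first.
  by apply/funext => s; apply/funext => t; rewrite opprK.
by apply => x /CP; rewrite normrN.
Qed.

(** * Rauzy-Veech induction *)

Section Positions.
Context {d : nat}.
Implicit Types p : 'I_d.+1 -> nat.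

Lemma position_inj p : is_position p -> injective p.
Proof. by move=> [_ pinj _] a b ab; apply: pinj => //; rewrite in_setT. Qed.

Lemma position_bounds p a : is_position p -> (1 <= p a <= d.+1)%N.
Proof. by move=> [pf _ _]; exact: pf. Qed.

Lemma position_surj p k : is_position p -> (1 <= k <= d.+1)%N ->
  exists a, p a = k.
Proof. by move=> [_ _ ps] /ps[a _ <-]; exists a. Qed.

Lemma last_letterP p : is_position p -> p (last_letter p) = d.+1.
Proof.
move=> pp; rewrite /last_letter; case: pickP => [a /eqP //|no].
have [|a pa] := @position_surj p d.+1 pp; first by rewrite leqnn.
by have := no a; rewrite pa eqxx.
Qed.

Lemma last_letter_max p a : is_position p -> a != last_letter p ->
  (p a < p (last_letter p))%N.
Proof.
move=> pp aN; have /andP[_ pa] := position_bounds a pp; rewrite ltn_neqAle.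
rewrite {2}last_letterP // pa andbT.
by apply: contra aN => /eqP /(position_inj pp) ->.
Qed.

Lemma position_of_inj p : injective p -> (forall a, (1 <= p a <= d.+1)%N) ->
  is_position p.
Proof.
move=> pinj pb; split => [a _ /=|a b _ _|k /= kb]; [exact: pb|exact: pinj|].
pose q (a : 'I_d.+1) : 'I_d.+1 := inord (p a).-1.
have qinj : injective q.
  move=> a b /(congr1 (@nat_of_ord _)); have := pb a; have := pb b => ? ?.
  rewrite !inordK; try lia.
  by move=> ?; apply: pinj; lia.
have [q' _ qK] := injF_bij qinj.
have kd : (k.-1 < d.+1)%N by lia.
exists (q' (Ordinal kd)) => //.
have := congr1 (@nat_of_ord _) (qK (Ordinal kd)); have := pb (q' (Ordinal kd)).
move=> ?; rewrite /q inordK /=; lia.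
Qed.

Lemma move_after_position p x y : is_position p -> p y = d.+1 -> x != y ->
  is_position (move_after p x y).
Proof.
move=> pp py xy.
have pxy : (p x < p y)%N.
  rewrite py ltn_neqAle -py; have := position_bounds x pp; rewrite -py => /andP[_ ->].
  by rewrite andbT; apply: contra xy => /eqP /(position_inj pp) ->.
have plt c : c != y -> (p c <= d)%N.
  move=> cy; have := position_bounds c pp => /andP[_ pc].
  have : p c != p y by apply: contra cy => /eqP /(position_inj pp) ->.
  by rewrite py; lia.
apply: position_of_inj => [a b|a]; rewrite /move_after.
  case: eqVneq => [->|ay]; case: eqVneq => [->|by'] //=.
  - by case: ifP => //; lia.
  - by case: ifP => //; lia.
  - case: ifP; case: ifP => ? ? // E; apply: (position_inj pp); lia.
have := position_bounds a pp; have := position_bounds x pp => ? ?.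
case: eqVneq => [_|ay]; first by lia.
by have := plt _ ay; case: ifP; lia.
Qed.

Lemma position_le p q : is_position p -> is_position q ->
  (forall a b, (p a < p b)%N -> (q a < q b)%N) -> forall a, (p a <= q a)%N.
Proof.
move=> pp qp pq a; have [k] := ubnP (p a); elim: k a => // k IHk a pak.
have [pa1|pa1] := leqP (p a) 1.
  by apply: leq_trans pa1 _; have /andP[] := position_bounds a qp.
have [|b pb] := @position_surj p (p a).-1 pp.
  by have := position_bounds a pp; lia.
have := pq b a; have := IHk b; lia.
Qed.

Lemma position_eq p q : is_position p -> is_position q ->
  (forall a b, (p a < p b)%N -> (q a < q b)%N) -> p = q.
Proof.
move=> pp qp pq; apply/funext => a; apply/eqP; rewrite eqn_leq.
rewrite !position_le // => b c.
rewrite !ltnNge leq_eqVlt negb_or => /andP[qbc qbc']; apply: contra qbc => pbc.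
move: pbc; rewrite leq_eqVlt => /orP[/eqP /(position_inj pp) ->//|/pq cb].
by rewrite cb in qbc'.
Qed.

End Positions.

Section Exchanges.
Context {R : realType} {d : nat}.
Implicit Types (F G : giet R d) (a b c : 'I_d.+1) (x y : R).

Definition lft F a : R := inf (gitv F a).
Definition rgt F a : R := sup (gitv F a).

Lemma itv_endpoints (J : set R) (u v : R) : u < v -> J = `[u, v[%classic ->
  inf J = u /\ sup J = v.
Proof. by move=> uv ->; rewrite inf_itv ?sup_itv ?bnd_simp. Qed.

Section Facts.
Variable F : giet R d.
Hypothesis FX : is_exchange F.

Lemma gitvE a : gitv F a = `[lft F a, rgt F a[%classic.
Proof.
have [u [v [uv E]]] := exch_itv FX a.
by rewrite /lft /rgt; have [-> ->] := itv_endpoints uv E.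
Qed.

Lemma gitvP a x : gitv F a x <-> lft F a <= x < rgt F a.
Proof. by rewrite gitvE /= in_itv. Qed.

Lemma lft_rgt a : lft F a < rgt F a.
Proof.
have [u [v [uv E]]] := exch_itv FX a.
by rewrite /lft /rgt; have [-> ->] := itv_endpoints uv E.
Qed.

Lemma gitv_lft a : gitv F a (lft F a).
Proof. by apply/gitvP; rewrite lexx lft_rgt. Qed.

Lemma glength_gt0 : 0 < glength F.
Proof.
have [l l0 E] := exch_dom FX.
by rewrite /glength; have [_ ->] := itv_endpoints l0 E.
Qed.

Lemma gdomE : gdom F = `[0, glength F[%classic.
Proof.
have [l l0 E] := exch_dom FX.
by rewrite /glength; have [_ ->] := itv_endpoints l0 E.
Qed.

Lemma gdomP x : gdom F x <-> 0 <= x < glength F.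
Proof. by rewrite gdomE /= in_itv. Qed.

Lemma gitv_gdom a x : gitv F a x -> gdom F x.
Proof. by exists a. Qed.

Lemma gdom_gitv x : gdom F x -> exists a, gitv F a x.
Proof. by move=> [a _ ax]; exists a. Qed.

Lemma gitv_inj a b x : gitv F a x -> gitv F b x -> a = b.
Proof.
move=> ax bx; have [ab|ba|] := ltngtP (gtop F a) (gtop F b).
- by have := exch_order FX ab ax bx; rewrite ltxx.
- by have := exch_order FX ba bx ax; rewrite ltxx.
- exact: (position_inj (exch_top FX)).
Qed.

Lemma gmap_gdom x : gdom F x -> gdom F (gmap F x).
Proof. by have [FF _ _] := exch_bij FX; exact: FF. Qed.

Lemma gmap_inj x y : gdom F x -> gdom F y -> gmap F x = gmap F y -> x = y.
Proof. by have [_ Fi _] := exch_bij FX => Fx Fy; apply: Fi; apply/mem_set. Qed.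

Lemma gmap_surj y : gdom F y -> exists2 x, gdom F x & gmap F x = y.
Proof. by have [_ _ Fs] := exch_bij FX => /Fs. Qed.

Lemma iter_gmap_gdom k x : gdom F x -> gdom F (iter k (gmap F) x).
Proof. by move=> Fx; elim: k => //= k; exact: gmap_gdom. Qed.

Lemma gmap_le a x y : gitv F a x -> gitv F a y -> x <= y -> gmap F x <= gmap F y.
Proof.
move=> ax ay; rewrite le_eqVlt => /orP[/eqP ->//|xy].
by apply: ltW; exact: exch_incr ax ay xy.
Qed.

Lemma gmap_lt_inv a x y : gitv F a x -> gitv F a y -> gmap F x < gmap F y -> x < y.
Proof. by move=> ax ay; rewrite !ltNge; apply: contra; exact: (gmap_le ay ax). Qed.

Lemma last_top_max c : c != last_top F -> (gtop F c < gtop F (last_top F))%N.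
Proof. exact: last_letter_max (exch_top FX). Qed.

Lemma last_bot_max c : c != last_bot F -> (gbot F c < gbot F (last_bot F))%N.
Proof. exact: last_letter_max (exch_bot FX). Qed.

Lemma gitv_last_top x : gitv F (last_top F) x <-> gdom F x /\ lft F (last_top F) <= x.
Proof.
split => [ax|[/gdom_gitv[c cx] ax]].
  by split; [exists (last_top F)|have /gitvP/andP[] := ax].
have [<-//|/eqP/last_top_max ca] := pselect (c = last_top F).
by have := exch_order FX ca cx (gitv_lft _); rewrite ltNge ax.
Qed.

Lemma last_imageP y :
  last_image F y <-> gdom F y /\ gmap F (lft F (last_bot F)) <= y.
Proof.
split => [[x bx <-]|[/gmap_surj[x Fx <-] bx]].
  split; first by apply: gmap_gdom; exists (last_bot F).
  by have /gitvP/andP[lx _] := bx; exact: gmap_le (gitv_lft _) bx lx.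
have [c cx] := gdom_gitv Fx.
have [cb|/eqP/last_bot_max cb] := pselect (c = last_bot F).
  by rewrite cb in cx; exists x.
by have := exch_image_order FX cb cx (gitv_lft _); rewrite ltNge bx.
Qed.

Lemma lft_le_last_top c : lft F c <= lft F (last_top F).
Proof.
have [->//|/eqP/last_top_max ca] := pselect (c = last_top F).
by apply: ltW; exact: exch_order ca (gitv_lft _) (gitv_lft _).
Qed.

Lemma gmap_lft_le_last_bot c : gmap F (lft F c) <= gmap F (lft F (last_bot F)).
Proof.
have [->//|/eqP/last_bot_max cb] := pselect (c = last_bot F).
by apply: ltW; exact: exch_image_order cb (gitv_lft _) (gitv_lft _).
Qed.

Lemma gitv_first a : gtop F a = 1%N -> gitv F a 0.
Proof.
move=> a1; have [|c c0] := @gdom_gitv 0.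
  by apply/gdomP; rewrite lexx glength_gt0.
have [<-//|/eqP ca] := pselect (c = a).
have ac : (gtop F a < gtop F c)%N.
  have /andP[c1 _] := position_bounds c (exch_top FX).
  rewrite a1 ltn_neqAle c1 andbT -a1; apply: contra ca.
  by move=> /eqP /(position_inj (exch_top FX)) ->.
have := exch_order FX ac (gitv_lft a) c0.
have /gdomP/andP[] : gdom F (lft F a) by exists a => //; exact: gitv_lft.
by rewrite leNgt => /negP.
Qed.

End Facts.

Lemma first_returnE (f : R -> R) (J : set R) m x : (0 < m)%N ->
  J (iter m f x) -> (forall j, (0 < j < m)%N -> ~ J (iter j f x)) ->
  return_time f J x = m.
Proof.
move=> m0 Jm Jj; apply/eqP; rewrite eqn_leq; apply/andP; split.
  by apply: least_le.
have [r0 Jr] := @leastP (fun m => (0 < m)%N /\ J (iter m f x)) (ex_intro _ m (conj m0 Jm)).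
rewrite leqNgt; apply/negP => rm; apply: (Jj _ _ Jr).
by rewrite r0.
Qed.

(** The old letters met by the new interval [c] before it returns. A single letter needs two steps:
    the last one of the bottom row in top type, of the top row in bottom type. *)
Definition rv_word F c : seq 'I_d.+1 :=
  if c == (if top_type F then last_bot F else last_top F)
  then [:: last_bot F; last_top F] else [:: c].

(** Describes [G] as a first return of [F] by means of towers with itineraries [w]; this form,
    unlike the definition of [RV], composes. *)
Record induced_map F G (w : 'I_d.+1 -> seq 'I_d.+1) : Prop := {
  ind_nonempty : forall c, (0 < size (w c))%N;
  ind_letter : forall c x i, gitv G c x -> (i < size (w c))%N ->
    gitv F (nth c (w c) i) (iter i (gmap F) x);
  ind_avoid : forall c x i, gitv G c x -> (0 < i < size (w c))%N ->
    ~ gdom G (iter i (gmap F) x);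
  ind_map : forall c x, gitv G c x -> gmap G x = iter (size (w c)) (gmap F) x;
  ind_cover : forall y, gdom F y -> exists c x i,
    [/\ gitv G c x, (i < size (w c))%N & y = iter i (gmap F) x] }.

(** A meeting point of the partitions for the map and for its inverse, of the kind that Keane's
    condition excludes. *)
Definition common_endpoint F x : Prop :=
  [/\ 0 < x, exists b, lft F b = x & exists a, gmap F (lft F a) = x].

Section RauzyStep.
Variable F : giet R d.
Hypotheses (FX : is_exchange F) (FR : renormalizable F).
Local Notation a := (last_top F).
Local Notation b := (last_bot F).
Hypothesis ab : a != b.
Let ua := lft F a.
Let wb := gmap F (lft F b).

Let uawb : ua != wb.
Proof.
apply/negP => /eqP E; apply: FR; apply/seteqP; split => y.
  by move=> /(gitv_last_top FX) ?; apply/(last_imageP FX); rewrite -/wb -E.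
by move=> /(last_imageP FX) ?; apply/(gitv_last_top FX); rewrite -/ua E.
Qed.

Let wb_dom : gdom F wb.
Proof. by apply: (gmap_gdom FX); exists b => //; exact: gitv_lft. Qed.

Let ua_dom : gdom F ua.
Proof. by exists a => //; exact: gitv_lft. Qed.

Lemma top_typeE : top_type F = (lft F a < gmap F (lft F b)).
Proof.
rewrite /top_type; have [uw|wu] := ltP ua wb.
  apply/asboolP => y /(last_imageP FX)[yF wy]; apply/(gitv_last_top FX).
  by split => //; apply: ltW; exact: lt_le_trans wy.
apply/asboolP => sub; have /sub/(gitv_last_top FX)[_] : last_image F wb.
  by apply/(last_imageP FX).
by rewrite -/ua => uw; move: uawb; rewrite eq_le uw wu.
Qed.

Lemma RV_return c m x : (0 < m)%N -> gdom (RV F) (iter m (gmap F) x) ->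
  (forall j, (0 < j < m)%N -> ~ gdom (RV F) (iter j (gmap F) x)) ->
  gitv (RV F) c x -> gmap (RV F) x = iter m (gmap F) x.
Proof.
move=> m0 Jm Jj cx.
by rewrite [LHS]/(first_return _ _ _) /first_return (first_returnE m0 Jm Jj).
Qed.

(** * Top type: the image of the last bottom interval is removed *)

Section Top.
Hypothesis uw : ua < wb.

Let topT : top_type F. Proof. by rewrite top_typeE. Qed.

Let itvT c x : gitv (RV F) c x <-> gitv F c x /\ x < wb.
Proof.
rewrite /= /RV_itv topT; case: eqVneq => [->|ca].
  split => [[ax]|[ax xw]].
    move=> nx; split => //; rewrite ltNge; apply/negP => wx; apply: nx.
    by apply/(last_imageP FX); split => //; exists a.
  by split => // /(last_imageP FX)[_]; rewrite leNgt xw.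
split => [cx|[]//]; split => //; apply: lt_trans uw.
exact: (exch_order FX (last_top_max FX ca) cx (gitv_lft FX a)).
Qed.

Let domT x : gdom (RV F) x <-> gdom F x /\ x < wb.
Proof.
split=> [[c _ /itvT[cx xw]]|[[c _ cx] xw]]; first by split => //; exists c.
by exists c => //; apply/itvT.
Qed.

Let mapT c x : c != b -> gitv (RV F) c x -> gmap (RV F) x = gmap F x /\ gdom (RV F) (gmap F x).
Proof.
move=> cb cx; have /itvT[cx' xw] := cx.
have J : gdom (RV F) (gmap F x).
  apply/domT; split; first by apply: (gmap_gdom FX); exists c.
  exact: (exch_image_order FX (last_bot_max FX cb) cx' (gitv_lft FX b)).
split => //; apply: (@RV_return c 1) => // j; lia.
Qed.

Let mapTb x : gitv (RV F) b x -> [/\ gmap (RV F) x = gmap F (gmap F x),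
  gitv F a (gmap F x), wb <= gmap F x & gdom (RV F) (gmap F (gmap F x))].
Proof.
move=> bx; have /itvT[bx' xw] := bx.
have wF : wb <= gmap F x by apply: (gmap_le FX (gitv_lft FX b) bx'); have /(gitvP FX)/andP[] := bx'.
have Fx : gdom F (gmap F x) by apply: (gmap_gdom FX); exists b.
have aF : gitv F a (gmap F x).
  by apply/(gitv_last_top FX); split => //; apply: ltW; exact: lt_le_trans wF.
have J : gdom (RV F) (gmap F (gmap F x)).
  apply/domT; split; first exact: (gmap_gdom FX).
  exact: (exch_image_order FX (last_bot_max FX ab) aF (gitv_lft FX b)).
split => //; apply: (@RV_return b 2) => // j j2 /domT[_].
have -> : j = 1%N by lia.
by rewrite /= ltNge wF.
Qed.

Let lftT c : lft (RV F) c = lft F c /\ exists2 v, lft F c < v & gitv (RV F) c = `[lft F c, v[%classic.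
Proof.
have lw : lft F c < wb by apply: le_lt_trans uw; exact: lft_le_last_top.
pose v := Num.min (rgt F c) wb.
have lv : lft F c < v by rewrite lt_min lft_rgt.
have E : gitv (RV F) c = `[lft F c, v[%classic.
  apply/seteqP; split => x.
    by move=> /itvT[/(gitvP FX)/andP[lx xr] xw]; rewrite /= in_itv /= lx lt_min xr.
  rewrite /= in_itv /= lt_min => /and3P[lx xr xw]; apply/itvT; split => //.
  by apply/(gitvP FX); rewrite lx.
split; last by exists v.
by have [] := itv_endpoints lv E.
Qed.

Lemma RV_exchange_top : is_exchange (RV F).
Proof.
have botE c : gbot (RV F) c = move_after (gbot F) a b c by rewrite /= topT.
have topE : gtop (RV F) = gtop F by rewrite /= topT.
have pbot := last_letterP (exch_bot FX).
split.
- by rewrite topE; exact: exch_top.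
- rewrite /= topT; apply: move_after_position => //; exact: exch_bot.
- exists wb; first by apply: le_lt_trans uw; have /(gdomP FX)/andP[] := ua_dom.
  apply/seteqP; split => x.
    by move=> /domT[/(gdomP FX)/andP[x0 _] xw]; rewrite /= in_itv /= x0.
  rewrite /= in_itv /= => /andP[x0 xw]; apply/domT; split => //.
  apply/(gdomP FX); rewrite x0; apply: (lt_trans xw).
  by have /(gdomP FX)/andP[] := wb_dom.
- by move=> c; have [_ [v lv E]] := lftT c; exists (lft F c), v.
- move=> c e x y; rewrite topE => ce /itvT[cx _] /itvT[ey _].
  exact: exch_order ce cx ey.
- split.
  + move=> x [c _ cx]; have [cb|cb] := eqVneq c b.
      by rewrite cb in cx; have [-> _ _ J] := mapTb cx.
    by have [-> J] := mapT cb cx.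
  + move=> x y /set_mem[c _ cx] /set_mem[e _ ey].
    have xF : gdom F x by exists c => //; have /itvT[] := cx.
    have yF : gdom F y by exists e => //; have /itvT[] := ey.
    have [cb|cb] := eqVneq c b; have [eb|eb] := eqVneq e b.
    * rewrite cb in cx; rewrite eb in ey.
      have [-> ax _ _] := mapTb cx; have [-> ay _ _] := mapTb ey.
      move=> /(gmap_inj FX (gitv_gdom ax) (gitv_gdom ay)); exact: gmap_inj.
    * rewrite cb in cx; have [-> ax wx _] := mapTb cx; have [-> _] := mapT eb ey.
      move=> /(gmap_inj FX (gitv_gdom ax) yF) E.
      by have /itvT[_] := ey; rewrite -E ltNge wx.
    * rewrite eb in ey; have [-> ay wy _] := mapTb ey; have [-> _] := mapT cb cx.
      move=> /(gmap_inj FX xF (gitv_gdom ay)) E.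
      by have /itvT[_] := cx; rewrite E ltNge wy.
    * have [-> _] := mapT cb cx; have [-> _] := mapT eb ey; exact: gmap_inj.
  + move=> y /domT[yF yw]; have [x xF xy] := gmap_surj FX yF.
    have [xw|wx] := ltP x wb.
      have [c cx] := gdom_gitv xF.
      have cx' : gitv (RV F) c x by apply/itvT.
      have [cb|cb] := eqVneq c b.
        rewrite cb in cx; have : last_image F y by exists x.
        by move=> /(last_imageP FX)[_]; rewrite leNgt yw.
      by exists x; [exists c|have [->] := mapT cb cx'].
    have [z bz zx] : last_image F x by apply/(last_imageP FX).
    have bz' : gitv (RV F) b z.
      apply/itvT; split => //; apply: lt_trans uw.
      by apply: (exch_order FX (last_top_max FX _) bz (gitv_lft FX a)); rewrite eq_sym.
    by exists z; [exists b|have [-> _ _ _] := mapTb bz'; rewrite zx].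
- move=> c x y cx cy xy; have /itvT[cx' _] := cx; have /itvT[cy' _] := cy.
  have [cb|cb] := eqVneq c b.
    rewrite cb in cx cy cx' cy'.
    have [-> ax _ _] := mapTb cx; have [-> ay _ _] := mapTb cy.
    by apply: (exch_incr FX ax ay); exact: (exch_incr FX cx' cy' xy).
  have [-> _] := mapT cb cx; have [-> _] := mapT cb cy; exact: (exch_incr FX cx' cy' xy).
- move=> c e x y; rewrite !botE /move_after => ce cx ey.
  have /itvT[cx' xw] := cx; have /itvT[ey' yw] := ey.
  move: ce; have [cb|cb] := eqVneq c b; have [eb|eb] := eqVneq e b.
  + by rewrite ltnn.
  + case: ifP => ee; rewrite ?ltnS => ae; first by lia.
    rewrite cb in cx; have [-> ax _ _] := mapTb cx; have [-> _] := mapT eb ey.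
    by apply: (exch_image_order FX _ ax ey'); lia.
  + rewrite eb in ey; have [-> ay wy _] := mapTb ey; have [-> _] := mapT cb cx.
    case: ifP => ca; rewrite ltnS => ca'; last by lia.
    have [ca0|ca0] := eqVneq c a.
      rewrite ca0 in cx'; apply: (exch_incr FX cx' ay); exact: lt_le_trans wy.
    apply: (exch_image_order FX _ cx' ay); rewrite ltn_neqAle ca andbT.
    by apply: contra ca0 => /eqP /(position_inj (exch_bot FX)) ->.
  + have [-> _] := mapT cb cx; have [-> _] := mapT eb ey => ce.
    apply: (exch_image_order FX _ cx' ey').
    by move: ce; case: ifP; case: ifP => ? ?; lia.
Qed.

Lemma RV_induced_top : induced_map F (RV F) (rv_word F).
Proof.
have wE c : rv_word F c = if c == b then [:: b; a] else [:: c] by rewrite /rv_word topT.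
split.
- by move=> c; rewrite wE; case: ifP.
- move=> c x i cx; rewrite wE; have /itvT[cx' _] := cx.
  case: eqVneq => [cb|cb] /=; last by case: i.
  rewrite cb in cx cx' *; have [_ ax _ _] := mapTb cx.
  by case: i => [|[|]].
- move=> c x i cx; rewrite wE; case: eqVneq => [cb|cb] /=; last by lia.
  rewrite cb in cx; have [_ _ wx _] := mapTb cx.
  move=> i2 /domT[_]; have -> : i = 1%N by lia.
  by rewrite /= ltNge wx.
- move=> c x cx; rewrite wE; case: eqVneq => [cb|cb].
    by rewrite cb in cx; have [E _ _ _] := mapTb cx.
  by have [E _] := mapT cb cx.
- move=> y yF; have [yw|wy] := ltP y wb.
    have [c cy] := gdom_gitv yF; exists c, y, 0%N; split => //; first exact/itvT.
    by rewrite wE; case: ifP.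
  have [z bz zx] : last_image F y by apply/(last_imageP FX).
  exists b, z, 1%N; split => //; last by rewrite wE eqxx.
  apply/itvT; split => //; apply: lt_trans uw.
  by apply: (exch_order FX (last_top_max FX _) bz (gitv_lft FX a)); rewrite eq_sym.
Qed.

Lemma RV_length_top : glength (RV F) < glength F.
Proof.
have := RV_exchange_top => GX; have /(gdomP FX)/andP[w0 wl] := wb_dom.
apply: le_lt_trans wl; rewrite leNgt; apply/negP => wlG.
have /(gdomP GX)/domT[_] : 0 <= wb < glength (RV F) by rewrite w0.
by rewrite ltxx.
Qed.

(** Being a left endpoint of [F], the point is at most that of the last top letter, hence below the
    cut; left endpoints do not move in top type. *)
Lemma RV_common_endpoint_top x : common_endpoint F x ->
  common_endpoint (RV F) x /\ x < glength (RV F).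
Proof.
move=> [x0 [e ex] [c cx]].
have xw : x < wb by rewrite -ex; apply: le_lt_trans uw; exact: lft_le_last_top.
have xF : gdom F x by rewrite -ex; exists e => //; exact: gitv_lft.
split; last by have /domT/(gdomP RV_exchange_top)/andP[] : gdom F x /\ x < wb by [].
split => //; first by exists e; have [-> _] := lftT e.
exists c; have [-> [v lv E]] := lftT c.
have cb : c != b by apply/eqP => cb; move: xw; rewrite -cx cb ltxx.
have [|-> _] := @mapT c (lft F c) cb; last by [].
by rewrite E /= in_itv /= lexx.
Qed.

End Top.

(** * Bottom type: the last top interval is removed *)

Section Bottom.
Hypothesis wu : wb < ua.
Variable z : R.
Hypotheses (bz : gitv F b z) (Fz : gmap F z = ua).

Let topF : top_type F = false.
Proof. by rewrite top_typeE ltNge (ltW wu). Qed.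

Let ba : b != a. Proof. by rewrite eq_sym. Qed.

Let b_ltP x : gitv F b x -> (gmap F x < ua) = (x < z).
Proof.
move=> bx; apply/idP/idP; first by rewrite -Fz; exact: (gmap_lt_inv FX bx bz).
by rewrite -Fz; exact: (exch_incr FX bx bz).
Qed.

Let preP x : last_preimage F x <-> gitv F b x /\ z <= x.
Proof.
split => [[xF /= ax]|[bx zx]]; last first.
  split; [by exists b|apply/(gitv_last_top FX); split].
    by apply: (gmap_gdom FX); exists b.
  by rewrite leNgt b_ltP // -leNgt.
have ux : ua <= gmap F x by have /(gitv_last_top FX)[] := ax.
have [y bY yx] : last_image F (gmap F x).
  apply/(last_imageP FX); split; first exact: gmap_gdom.
  by apply: ltW; exact: lt_le_trans ux.
have bx : gitv F b x by rewrite -(gmap_inj FX (gitv_gdom bY) xF yx).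
by split => //; rewrite leNgt -b_ltP // -leNgt.
Qed.

Let itvB c x : gitv (RV F) c x <->
  if c == b then gitv F b x /\ x < z
  else if c == a then gitv F b x /\ z <= x else gitv F c x.
Proof.
rewrite /= /RV_itv topF; case: eqVneq => [->|cb].
  split => [[bx nx]|[bx xz]]; split => //.
    by rewrite ltNge; apply/negP => zx; apply: nx; apply/preP.
  by move=> /preP[_]; rewrite leNgt xz.
by case: eqVneq => [_|//]; exact: preP.
Qed.

Let lt_ua c x : c != a -> gitv F c x -> x < ua.
Proof. by move=> ca cx; exact: (exch_order FX (last_top_max FX ca) cx (gitv_lft FX a)). Qed.

Let domB x : gdom (RV F) x <-> gdom F x /\ x < ua.
Proof.
split=> [[c _ /itvB]|[/gdom_gitv[c cx] xu]].
  case: eqVneq => [_|cb]; first by move=> [bx _]; split; [exists b|exact: lt_ua bx].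
  case: eqVneq => [_|ca]; first by move=> [bx _]; split; [exists b|exact: lt_ua bx].
  by move=> cx; split; [exists c|exact: lt_ua cx].
have ca : c != a.
  by apply/eqP => ca; rewrite ca in cx; have /(gitv_last_top FX)[_] := cx; rewrite leNgt xu.
have [cb|cb] := eqVneq c b; last by exists c => //; apply/itvB; rewrite (negbTE cb) (negbTE ca).
rewrite cb in cx; have [xz|zx] := ltP x z.
  by exists b => //; apply/itvB; rewrite eqxx.
by exists a => //; apply/itvB; rewrite (negbTE ab) eqxx.
Qed.

Let itv_dom c x : gitv (RV F) c x -> gdom F x.
Proof. by move=> cx; have /domB[] : gdom (RV F) x by exists c. Qed.

Let mapB c x : c != a -> gitv (RV F) c x ->
  [/\ gmap (RV F) x = gmap F x, gitv F c x & gdom (RV F) (gmap F x)].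
Proof.
move=> ca cx; have cx' : gitv F c x.
  by move/itvB: cx; case: eqVneq => [-> []//|_]; rewrite (negbTE ca).
have J : gdom (RV F) (gmap F x).
  apply/domB; split; first by apply: (gmap_gdom FX); exists c.
  have [cb|cb] := eqVneq c b.
    by move/itvB: cx; rewrite cb eqxx => -[bx xz]; rewrite b_ltP.
  apply: lt_trans wu.
  exact: (exch_image_order FX (last_bot_max FX cb) cx' (gitv_lft FX b)).
split => //; apply: (@RV_return c 1) => // j; lia.
Qed.

Let mapBa x : gitv (RV F) a x -> [/\ gmap (RV F) x = gmap F (gmap F x),
  gitv F b x, z <= x, gitv F a (gmap F x) & gdom (RV F) (gmap F (gmap F x))].
Proof.
move=> /[dup] ax /itvB; rewrite (negbTE ab) eqxx => -[bx zx].
have /preP[xF aF] : gitv F b x /\ z <= x by [].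
have J : gdom (RV F) (gmap F (gmap F x)).
  apply/domB; split; first by apply: (gmap_gdom FX); exists a.
  apply: lt_trans wu.
  exact: (exch_image_order FX (last_bot_max FX ab) aF (gitv_lft FX b)).
split => //; apply: (@RV_return a 2) => // j j2 /domB[_].
have -> : j = 1%N by lia.
by rewrite /= b_ltP // ltNge zx.
Qed.

Let lftB c : c != a ->
  lft (RV F) c = lft F c /\ exists2 v, lft F c < v & gitv (RV F) c = `[lft F c, v[%classic.
Proof.
move=> ca; suff [v lv E] : exists2 v, lft F c < v & gitv (RV F) c = `[lft F c, v[%classic.
  by have [E1 _] := itv_endpoints lv E; split; [exact: E1|exists v].
have [cb|cb] := eqVneq c b.
  have lz : lft F b < z by rewrite -b_ltP //; exact: gitv_lft.
  exists z; first by rewrite cb.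
  apply/seteqP; split => x; rewrite cb.
    by move=> /itvB; rewrite eqxx => -[/(gitvP FX)/andP[lx _] xz]; rewrite /= in_itv /= lx.
  rewrite /= in_itv /= => /andP[lx xz]; apply/itvB; rewrite eqxx; split => //.
  apply/(gitvP FX); rewrite lx; apply: (lt_trans xz).
  by have /(gitvP FX)/andP[] := bz.
exists (rgt F c); first exact: lft_rgt.
rewrite -gitvE //; apply/seteqP; split => x; first by move=> /itvB; rewrite (negbTE cb) (negbTE ca).
by move=> cx; apply/itvB; rewrite (negbTE cb) (negbTE ca).
Qed.

Let lftBa : lft (RV F) a = z /\ gitv (RV F) a = `[z, rgt F b[%classic.
Proof.
have /(gitvP FX)/andP[lz zr] := bz.
have E : gitv (RV F) a = `[z, rgt F b[%classic.
  apply/seteqP; split => x.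
    move=> /itvB; rewrite (negbTE ab) eqxx => -[/(gitvP FX)/andP[_ xr] zx].
    by rewrite /= in_itv /= zx.
  rewrite /= in_itv /= => /andP[zx xr]; apply/itvB; rewrite (negbTE ab) eqxx.
  by split => //; apply/(gitvP FX); rewrite (le_trans lz zx).
by have [] := itv_endpoints zr E.
Qed.

Lemma RV_exchange_bottom : is_exchange (RV F).
Proof.
have topE c : gtop (RV F) c = move_after (gtop F) b a c by rewrite /= topF.
have botE : gbot (RV F) = gbot F by rewrite /= topF.
have ptop := last_letterP (exch_top FX).
split.
- rewrite /= topF; apply: move_after_position => //; exact: exch_top.
- by rewrite botE; exact: exch_bot.
- exists ua; first by apply: le_lt_trans wu; have /(gdomP FX)/andP[] := wb_dom.
  apply/seteqP; split => x.
    by move=> /domB[/(gdomP FX)/andP[x0 _] xw]; rewrite /= in_itv /= x0.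
  rewrite /= in_itv /= => /andP[x0 xu]; apply/domB; split => //.
  apply/(gdomP FX); rewrite x0; apply: (lt_trans xu).
  by have /(gdomP FX)/andP[] := ua_dom.
- move=> c; have [->|ca] := eqVneq c a.
    by exists z, (rgt F b); have [_ ->] := lftBa; have /(gitvP FX)/andP[] := bz.
  by have [_ [v lv E]] := lftB ca; exists (lft F c), v.
- move=> c e x y; rewrite !topE /move_after.
  have [ca|ca] := eqVneq c a; have [ea|ea] := eqVneq e a.
  + by rewrite ltnn.
  + case: ifP => eb; rewrite ?ltnS => be cx ey; first by lia.
    rewrite ca in cx; have [_ bx _ _ _] := mapBa cx; have [_ ey' _] := mapB ea ey.
    by apply: (exch_order FX _ bx ey'); lia.
  + case: ifP => cb; rewrite ltnS => cb' cx ey; last by lia.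
    rewrite ea in ey; have [_ bY zy _ _] := mapBa ey; have [_ cx' _] := mapB ca cx.
    have [cb0|cb0] := eqVneq c b.
      by move/itvB: cx; rewrite cb0 eqxx => -[_ xz]; exact: lt_le_trans zy.
    apply: (exch_order FX _ cx' bY); rewrite ltn_neqAle cb andbT.
    by apply: contra cb0 => /eqP /(position_inj (exch_top FX)) ->.
  + move=> ce cx ey; have [_ cx' _] := mapB ca cx; have [_ ey' _] := mapB ea ey.
    apply: (exch_order FX _ cx' ey').
    by move: ce; case: ifP; case: ifP => ? ?; lia.
- split.
  + move=> x [c _ cx]; have [ca|ca] := eqVneq c a.
      by rewrite ca in cx; have [-> _ _ _ J] := mapBa cx.
    by have [-> _ J] := mapB ca cx.
  + move=> x y /set_mem[c _ cx] /set_mem[e _ ey].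
    have xF := itv_dom cx; have yF := itv_dom ey.
    have [ca|ca] := eqVneq c a; have [ea|ea] := eqVneq e a.
    * rewrite ca in cx; rewrite ea in ey.
      have [-> _ _ ax _] := mapBa cx; have [-> _ _ ay _] := mapBa ey.
      move=> /(gmap_inj FX (gitv_gdom ax) (gitv_gdom ay)); exact: gmap_inj.
    * rewrite ca in cx; have [-> _ _ ax _] := mapBa cx; have [-> ey' _] := mapB ea ey.
      move=> /(gmap_inj FX (gitv_gdom ax) yF) E.
      by rewrite E in ax; have := gitv_inj FX ax ey' => ae; rewrite ae eqxx in ea.
    * rewrite ea in ey; have [-> _ _ ay _] := mapBa ey; have [-> cx' _] := mapB ca cx.
      move=> /(gmap_inj FX xF (gitv_gdom ay)) E.
      by rewrite -E in ay; have := gitv_inj FX ay cx' => ac; rewrite ac eqxx in ca.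
    * have [-> _ _] := mapB ca cx; have [-> _ _] := mapB ea ey; exact: gmap_inj.
  + move=> y /domB[yF yu]; have [x xF xy] := gmap_surj FX yF.
    have [xu|ux] := ltP x ua.
      have [c _ cx] : gdom (RV F) x by apply/domB.
      have [ca|ca] := eqVneq c a.
        rewrite ca in cx; have [_ _ _ ax _] := mapBa cx.
        by have /(gitv_last_top FX)[_] := ax; rewrite xy leNgt yu.
      by exists x; [exists c|have [->] := mapB ca cx].
    have [t bt tx] : last_image F x.
      by apply/(last_imageP FX); split => //; apply: ltW; exact: lt_le_trans ux.
    have at' : gitv (RV F) a t.
      apply/itvB; rewrite (negbTE ab) eqxx; split => //.
      by rewrite leNgt -b_ltP // tx -leNgt.
    by exists t; [exists a|have [-> _ _ _ _] := mapBa at'; rewrite tx].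
- move=> c x y cx cy xy; have [ca|ca] := eqVneq c a.
    rewrite ca in cx cy; have [-> bx _ ax _] := mapBa cx; have [-> bY _ ay _] := mapBa cy.
    by apply: (exch_incr FX ax ay); exact: (exch_incr FX bx bY xy).
  have [-> cx' _] := mapB ca cx; have [-> cy' _] := mapB ca cy; exact: (exch_incr FX cx' cy' xy).
- move=> c e x y; rewrite botE => ce cx ey.
  have [ca|ca] := eqVneq c a; have [ea|ea] := eqVneq e a.
  + by move: ce; rewrite ca ea ltnn.
  + rewrite ca in cx ce; have [-> _ _ ax _] := mapBa cx; have [-> ey' _] := mapB ea ey.
    exact: (exch_image_order FX ce ax ey').
  + rewrite ea in ey ce; have [-> _ _ ay _] := mapBa ey; have [-> cx' _] := mapB ca cx.
    exact: (exch_image_order FX ce cx' ay).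
  + have [-> cx' _] := mapB ca cx; have [-> ey' _] := mapB ea ey.
    exact: (exch_image_order FX ce cx' ey').
Qed.

Lemma RV_induced_bottom : induced_map F (RV F) (rv_word F).
Proof.
have wE c : rv_word F c = if c == a then [:: b; a] else [:: c] by rewrite /rv_word topF.
split.
- by move=> c; rewrite wE; case: ifP.
- move=> c x i cx; rewrite wE; case: eqVneq => [ca|ca] /=.
    rewrite ca in cx *; have [_ bx _ ax _] := mapBa cx.
    by case: i => [|[|]].
  by have [_ cx' _] := mapB ca cx; case: i.
- move=> c x i cx; rewrite wE; case: eqVneq => [ca|ca] /=; last by lia.
  rewrite ca in cx; have [_ _ _ ax _] := mapBa cx.
  move=> i2 /domB[_]; have -> : i = 1%N by lia.
  by have /(gitv_last_top FX)[_ ux] := ax; rewrite /= ltNge ux.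
- move=> c x cx; rewrite wE; case: eqVneq => [ca|ca].
    by rewrite ca in cx; have [E _ _ _ _] := mapBa cx.
  by have [E _ _] := mapB ca cx.
- move=> y yF; have [yu|uy] := ltP y ua.
    have [c _ cy] : gdom (RV F) y by apply/domB.
    by exists c, y, 0%N; split => //; rewrite wE; case: ifP.
  have [t bt ty] : last_image F y.
    by apply/(last_imageP FX); split => //; apply: ltW; exact: lt_le_trans uy.
  exists a, t, 1%N; split => //; last by rewrite wE eqxx.
  apply/itvB; rewrite (negbTE ab) eqxx; split => //.
  by rewrite leNgt -b_ltP // ty -leNgt.
Qed.

Lemma RV_length_bottom : glength (RV F) < glength F.
Proof.
have := RV_exchange_bottom => GX; have /(gdomP FX)/andP[u0 ul] := ua_dom.
apply: le_lt_trans ul; rewrite leNgt; apply/negP => ulG.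
have /(gdomP GX)/domB[_] : 0 <= ua < glength (RV F) by rewrite u0.
by rewrite ltxx.
Qed.

(** Here the point is below the cut as the image of a left endpoint. If that endpoint belongs to the
    last top letter, the new left endpoint [z] reaches the same image in two steps. *)
Lemma RV_common_endpoint_bottom x : common_endpoint F x ->
  common_endpoint (RV F) x /\ x < glength (RV F).
Proof.
move=> [x0 [e ex] [c cx]].
have xu : x < ua by rewrite -cx; apply: le_lt_trans wu; exact: gmap_lft_le_last_bot.
have xF : gdom F x by rewrite -ex; exists e => //; exact: gitv_lft.
split; last by have /domB/(gdomP RV_exchange_bottom)/andP[] : gdom F x /\ x < ua by [].
have ea : e != a by apply/eqP => ea; move: xu; rewrite -ex ea ltxx.
split => //; first by exists e; have [-> _] := lftB ea.
exists c; have [ca|ca] := eqVneq c a.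
  rewrite ca; have [-> E] := lftBa.
  have az : gitv (RV F) a z.
    by rewrite E /= in_itv /= lexx; have /(gitvP FX)/andP[] := bz.
  by have [-> _ _ _ _] := mapBa az; rewrite Fz -cx ca.
have [-> [v lv E]] := lftB ca.
have [|-> _ _] := @mapB c (lft F c) ca; last by [].
by rewrite E /= in_itv /= lexx.
Qed.

End Bottom.

Let bottom_point : wb < ua -> exists2 z, gitv F b z & gmap F z = ua.
Proof.
move=> wu; have [z bz zu] : last_image F ua.
  by apply/(last_imageP FX); split => //; exact: ltW.
by exists z.
Qed.

Lemma RV_step : [/\ is_exchange (RV F), induced_map F (RV F) (rv_word F),
  glength (RV F) < glength F &
  forall x, common_endpoint F x -> common_endpoint (RV F) x /\ x < glength (RV F)].
Proof.
move: uawb; rewrite neq_lt => /orP[uw|wu].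
  split; [exact: RV_exchange_top|exact: RV_induced_top|exact: RV_length_top|].
  by move=> x; exact: RV_common_endpoint_top.
have [z bz Fz] := bottom_point wu.
split; [exact: (RV_exchange_bottom wu bz Fz)|exact: (RV_induced_bottom wu bz Fz)|
  exact: (RV_length_bottom wu bz Fz)|].
by move=> x; exact: (RV_common_endpoint_bottom wu bz Fz).
Qed.

End RauzyStep.
End Exchanges.

(** * Composition of induced maps *)

Section InducedComposition.
Context {R : realType} {d : nat}.
Implicit Types (F G H : giet R d) (w : 'I_d.+1 -> seq 'I_d.+1) (s : seq 'I_d.+1).

Section Itinerary.
Variables (F G : giet R d) (w : 'I_d.+1 -> seq 'I_d.+1).
Hypothesis FG : induced_map F G w.

Definition follows G s x : Prop :=
  forall j c, (j < size s)%N -> gitv G (nth c s j) (iter j (gmap G) x).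

Lemma follows_cons G' c s x : follows G' (c :: s) x ->
  gitv G' c x /\ follows G' s (gmap G' x).
Proof.
move=> fx; split; first exact: (fx 0%N c).
by move=> j e js; rewrite -iterSr; exact: (fx j.+1 e).
Qed.

Let W s := flatten [seq w c | c <- s].

Lemma follows_iter s x : follows G s x ->
  iter (size (W s)) (gmap F) x = iter (size s) (gmap G) x.
Proof.
elim: s x => [//|c s IHs] x /follows_cons[cx fx].
by rewrite /W /= size_cat addnC iterD -(ind_map FG cx) (IHs _ fx) -iterSr.
Qed.

Lemma follows_expand s x : follows G s x -> follows F (W s) x.
Proof.
elim: s x => [//|c s IHs] x /follows_cons[cx fx] j e.
rewrite /W /= size_cat nth_cat => js; case: ltnP => [jc|cj].
  by rewrite (set_nth_default c) //; exact: (ind_letter FG).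
rewrite -{2}(subnK cj) iterD -(ind_map FG cx); apply: IHs => //.
by rewrite ltn_subLR.
Qed.

Lemma follows_position s x i : follows G s x -> (i < size (W s))%N ->
  exists j k c, [/\ (j < size s)%N, gitv G c (iter j (gmap G) x),
    (k < size (w c))%N, iter i (gmap F) x = iter k (gmap F) (iter j (gmap G) x) &
    (0 < i)%N -> (0 < j)%N || (0 < k)%N].
Proof.
elim: s x i => [//|c s IHs] x i /follows_cons[cx fx].
rewrite /W /= size_cat => ic; have [ic'|ci] := ltnP i (size (w c)).
  by exists 0%N, i, c; split => //= ->.
have [|j [k [e [js ex ke ixe _]]]] := IHs _ (i - size (w c))%N fx.
  by rewrite ltn_subLR.
exists j.+1, k, e; split => //; first by rewrite iterSr.
by rewrite -{1}(subnK ci) iterD -(ind_map FG cx) ixe -iterSr.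
Qed.

Lemma follows_position_inv s x j k c0 : follows G s x -> (j < size s)%N ->
  (k < size (w (nth c0 s j)))%N ->
  exists2 i, (i < size (W s))%N &
    iter i (gmap F) x = iter k (gmap F) (iter j (gmap G) x).
Proof.
elim: s x j => [//|c s IHs] x [|j] /follows_cons[cx fx] /= js kc.
  by exists k; rewrite // /W /= size_cat ltn_addr.
have [i iW E] := IHs _ _ fx js kc; exists (i + size (w c))%N.
  by rewrite /W /= size_cat addnC ltn_add2l.
by rewrite iterD -(ind_map FG cx) E -iterSr.
Qed.

Lemma ind_gdom x : gdom G x -> gdom F x.
Proof.
move=> [c _ cx]; exists (nth c (w c) 0) => //.
exact: (ind_letter FG cx (ind_nonempty FG c)).
Qed.

Lemma ind_follows c x : gitv G c x -> follows F (w c) x.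
Proof. by move=> cx j e jc; rewrite (set_nth_default c) //; exact: (ind_letter FG). Qed.

End Itinerary.

Lemma induced_refl F : induced_map F F (fun c => [:: c]).
Proof.
split => //; [by move=> c x [|[]]|by move=> c x i _ /=; lia|].
by move=> y [c _ cy]; exists c, y, 0%N.
Qed.

Lemma induced_comp F G H w w' : is_exchange G ->
  induced_map F G w -> induced_map G H w' ->
  induced_map F H (fun c => flatten [seq w e | e <- w' c]).
Proof.
move=> GX FG GH; split.
- move=> c; have := ind_nonempty GH c; case: (w' c) => //= e s _.
  by rewrite size_cat addn_gt0 (ind_nonempty FG).
- by move=> c x i cx iW; exact: (follows_expand FG (ind_follows GH cx)).
- move=> c x i cx /andP[i0 iW].
  have [j [k [e [js ex ke -> jk]]]] := follows_position FG (ind_follows GH cx) iW.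
  (* At the foot of a tower of [F], avoidance comes from the map [G]; strictly inside a tower the
     point is not even in the domain of [G]. *)
  case: k ke jk => [|k] ke jk.
    have {}jk : (0 < j)%N by have := jk i0; rewrite orbF.
    by apply: (ind_avoid GH cx); rewrite jk.
  by move=> /(ind_gdom GH); apply: (ind_avoid FG ex).
- move=> c x cx; rewrite (ind_map GH cx).
  by rewrite (follows_iter FG (ind_follows GH cx)).
- move=> y /(ind_cover FG)[c [x [i [cx ic ->]]]].
  have /(ind_cover GH)[e [t [j [et je xE]]]] : gdom G x by exists c.
  have fG := ind_follows GH et.
  have cE : nth e (w' e) j = c.
    by apply: (gitv_inj GX _ cx); rewrite xE; exact: (ind_letter GH).
  have [|k kW E] := @follows_position_inv _ _ _ FG (w' e) t j i e fG je.
    by rewrite cE.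
  by exists e, t, k; split => //; rewrite E xE.
Qed.

End InducedComposition.

(** * Exchanges whose branches are translations *)

Section Translations.
Context {R : realType} {d : nat}.
Implicit Types (F G : giet R d).

Definition translation_branches F : Prop :=
  forall c, exists delta, forall x, gitv F c x -> gmap F x = x + delta.

Lemma iet_translation F : is_iet F -> is_exchange F /\ translation_branches F.
Proof.
move=> [FX Faff]; split => // c; have [t ct] := Faff c; exists t => x /ct ->.
by rewrite mxE expR0 mul1r.
Qed.

Lemma translation_iter F w c : translation_branches F ->
  exists delta, forall x, (forall i, (i < size w)%N ->
    gitv F (nth c w i) (iter i (gmap F) x)) -> iter (size w) (gmap F) x = x + delta.
Proof.
move=> FT; elim/last_ind: w => [|w e [D IHw]].
  by exists 0 => x _; rewrite addr0.
have [t et] := FT e; exists (D + t) => x xw.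
rewrite size_rcons /= IHw; last first.
  move=> i iw; have := xw i; rewrite size_rcons nth_rcons iw; apply.
  exact: leqW.
rewrite addrA; apply: et; rewrite -IHw; last first.
  move=> i iw; have := xw i; rewrite size_rcons nth_rcons iw; apply.
  exact: leqW.
by have := xw (size w); rewrite size_rcons nth_rcons ltnn eqxx; apply.
Qed.

Lemma translation_induced F G w : translation_branches F -> induced_map F G w ->
  translation_branches G.
Proof.
move=> FT FG c; have [D DP] := @translation_iter F (w c) c FT.
exists D => x cx; rewrite (ind_map FG cx); apply: DP => i iw.
exact: (ind_letter FG).
Qed.

(** If one letter were last in both rows, its interval and the image would share their right end, so
    the translation would be trivial and the two would coincide, against renormalizability. *)
Lemma translation_last_neq F : is_exchange F -> translation_branches F ->
  renormalizable F -> last_top F != last_bot F.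
Proof.
move=> FX FT FR; apply/eqP => ab.
have [t at'] := FT (last_top F); set a := last_top F in ab at'.
have aF := gitv_lft FX a.
have /(gdomP FX)/andP[u0 ul] : gdom F (lft F a) by exists a.
have FaE : gmap F (lft F a) = lft F a + t by rewrite at'.
have t0 : t = 0.
  apply/eqP; rewrite eq_le; apply/andP; split; rewrite leNgt; apply/negP => tlt.
    pose x := Num.max (lft F a) (glength F - t).
    have ax : gitv F a x.
      apply/(gitv_last_top FX); split; last by rewrite le_max lexx.
      apply/(gdomP FX); rewrite le_max u0 /= gt_max ul; lra.
    have : gdom F (gmap F x) by apply: (gmap_gdom FX); exists a.
    move=> /(gdomP FX)/andP[_]; rewrite at' //.
    have : glength F - t <= x by rewrite le_max lexx orbT.
    lra.
  pose y := Num.max (gmap F (lft F a)) (glength F + t).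
  have [x ax xy] : last_image F y.
    apply/(last_imageP FX); rewrite -ab; split; last by rewrite le_max lexx.
    have /(gdomP FX)/andP[w0 wl] : gdom F (gmap F (lft F a)).
      by apply: (gmap_gdom FX); exists a.
    by apply/(gdomP FX); rewrite le_max w0 /= gt_max wl; lra.
  rewrite -ab in ax; have /(gdomP FX)/andP[_ xl] : gdom F x by exists a.
  have : glength F + t <= y by rewrite le_max lexx orbT.
  by rewrite -xy at' //; lra.
apply: FR; apply/seteqP; split => y.
  move=> /(gitv_last_top FX)[yF uy]; apply/(last_imageP FX); split => //.
  by rewrite -ab FaE t0 addr0.
move=> /(last_imageP FX)[yF uy]; apply/(gitv_last_top FX); split => //.
by move: uy; rewrite -ab FaE t0 addr0.
Qed.

End Translations.

(** * Iterated induction and linear rescaling *)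

Section IteratedInduction.
Context {R : realType} {d : nat}.
Implicit Types (F G : giet R d).

Fixpoint rv_words F k : 'I_d.+1 -> seq 'I_d.+1 :=
  if k is k'.+1 then
    fun c => flatten [seq rv_words F k' e | e <- rv_word (iter k' RV F) c]
  else fun c => [:: c].

Lemma iter_RV F k : is_exchange F ->
  (forall j, (j < k)%N -> renormalizable (iter j RV F)) ->
  (forall j, (j < k)%N -> last_top (iter j RV F) != last_bot (iter j RV F)) ->
  [/\ is_exchange (iter k RV F), induced_map F (iter k RV F) (rv_words F k),
      (0 < k)%N -> glength (iter k RV F) < glength F &
      forall x, common_endpoint F x ->
        common_endpoint (iter k RV F) x /\ x < glength (iter k RV F)].
Proof.
move=> FX; elim: k => [_ _|k IHk FR ab].
  split => //; first exact: induced_refl.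
  move=> x [x0 [b bx] [a ax]]; split => //; last first.
    have /(gdomP FX)/andP[] // : gdom F x by rewrite -bx; exists b => //; exact: gitv_lft.
  by split => //; [exists b|exists a].
have [||GX FG Gl Gc] := IHk.
- by move=> j jk; apply: FR; exact: leqW.
- by move=> j jk; apply: ab; exact: leqW.
have [HX GH Hl Hc] := RV_step GX (FR k (ltnSn k)) (ab k (ltnSn k)).
split; [exact: HX|exact: (induced_comp GX FG GH)| |].
  move=> _ /=; case: (k) Gl Hl => [//|k'] /(_ isT) Gl Hl; exact: lt_trans Gl.
by move=> x /Gc[/Hc].
Qed.

Lemma translation_iter_RV F k : is_exchange F -> translation_branches F ->
  (forall j, (j < k)%N -> renormalizable (iter j RV F)) ->
  forall j, (j < k)%N -> last_top (iter j RV F) != last_bot (iter j RV F).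
Proof.
move=> FX FT FR j; have [m] := ubnP j; elim: m j => // m IHm j jm jk.
have [||GX FG _ _] := @iter_RV F j FX.
- by move=> i ij; apply: FR; exact: ltn_trans jk.
- by move=> i ij; apply: IHm; lia.
by apply: translation_last_neq => //; [exact: translation_induced FG|exact: FR].
Qed.

(** Itineraries are computed from the permutations and the types alone, so an affine map with the
    rotation number of [T] shares those of [T]. *)
Lemma rv_words_eq F G : gtop F = gtop G ->
  (forall k, let Fk := iter k RV F in let Gk := iter k RV G in
    [/\ gtop Fk = gtop Gk, gbot Fk = gbot Gk & top_type Fk = top_type Gk]) ->
  forall k, rv_words F k = rv_words G k.
Proof.
move=> _ FG; elim=> [//|k IHk] /=; rewrite IHk.
have [Et Eb Ett] := FG k.
by apply/funext => c; rewrite /rv_word /last_top /last_bot Et Eb Ett.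
Qed.

Definition scaled (r : R) F G : Prop :=
  [/\ gtop F = gtop G, gbot F = gbot G,
      forall c x, gitv F c x <-> gitv G c (r * x) &
      forall x, gdom F x -> r * gmap F x = gmap G (r * x)].

Lemma scaled_gdom r F G x : scaled r F G -> gdom F x <-> gdom G (r * x).
Proof.
move=> [_ _ FG _]; split => [[c _ cx]|[c _ cx]]; exists c => //; exact/FG.
Qed.

Lemma scaled_iter r F G k x : is_exchange F -> scaled r F G -> gdom F x ->
  r * iter k (gmap F) x = iter k (gmap G) (r * x).
Proof.
move=> FX FG xF; elim: k => //= k <-; have [_ _ _ ->] := FG => //.
exact: iter_gmap_gdom.
Qed.

(** Types and return times are defined by inclusion and membership, which a linear rescaling
    respects. This lets the self-similarity be iterated. *)
Lemma scaled_RV r F G : 0 < r -> is_exchange F -> scaled r F G ->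
  scaled r (RV F) (RV G).
Proof.
move=> r0 FX FG; have [Et Eb Eitv Emap] := FG.
have Elt : last_top F = last_top G by rewrite /last_top Et.
have Elb : last_bot F = last_bot G by rewrite /last_bot Eb.
have rK x : r * (x / r) = x by rewrite mulrC divfK // gt_eqF.
have Eim y : last_image F y <-> last_image G (r * y).
  split => [[x bx <-]|[t bt ty]].
    exists (r * x); first by rewrite -Elb; apply/Eitv.
    by rewrite -Emap //; exists (last_bot F).
  have bx : gitv F (last_bot F) (t / r) by apply/Eitv; rewrite rK Elb.
  exists (t / r) => //; apply: (mulfI (lt0r_neq0 r0)).
  by rewrite Emap ?rK //; exists (last_bot F).
have Epre x : last_preimage F x <-> last_preimage G (r * x).
  split => [[xF /= ax]|[xG /= ax]].
    split; first by apply/(scaled_gdom _ FG).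
    by rewrite /= -Emap // -Elt; apply/Eitv.
  have xF : gdom F x by apply/(scaled_gdom _ FG).
  by split => //=; apply/Eitv; rewrite Emap // Elt.
have Ety : top_type F = top_type G.
  rewrite /top_type; apply/asboolP/asboolP => sub y.
    rewrite -(rK y) => /Eim /sub; rewrite -Elt; exact: (Eitv _ _).1.
  by move=> /Eim /sub; rewrite -Elt => /Eitv.
have ERV c x : RV_itv F c x <-> RV_itv G c (r * x).
  rewrite /RV_itv Ety Elt Elb; case: ifP => _; case: ifP => _.
  - by split => [[/Eitv cx nx]|[/Eitv cx nx]]; split => //; apply: contra_not nx => /Eim.
  - exact: Eitv.
  - by split => [[/Eitv cx nx]|[/Eitv cx nx]]; split => //; apply: contra_not nx => /Epre.
  - by case: ifP => _; [exact: Epre|exact: Eitv].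
have Esub c x : RV_itv F c x -> gdom F x.
  rewrite /RV_itv; case: ifP => _; case: ifP => _.
  - by move=> [cx _]; exists c.
  - by move=> cx; exists c.
  - by move=> [cx _]; exists c.
  - by case: ifP => _; [move=> []|move=> cx; exists c].
split => [||c x|x].
- by rewrite /= Ety Et Elt Elb.
- by rewrite /= Ety Eb Elt Elb.
- exact: ERV.
- move=> [c _ cx]; have xF := Esub _ _ cx.
  rewrite /= /first_return (scaled_iter _ FX FG xF); congr (iter _ _ _).
  rewrite /return_time; congr least; apply/funext => m; apply/propext; split.
    move=> [m0 [e _ ex]]; split => //; exists e => //; rewrite -(scaled_iter _ FX FG xF).
    exact/ERV.
  move=> [m0 [e _ ex]]; split => //; exists e => //; apply/ERV.
  by rewrite (scaled_iter _ FX FG xF).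
Qed.

End IteratedInduction.

(** * Structure of a self-similar interval exchange *)

Lemma small_geometric (R : realType) (C q eps : R) : 1 < q -> 0 < eps ->
  exists j : nat, C / q ^+ j < eps.
Proof.
move=> q1 eps0; have q0 : 0 < q by exact: lt_trans q1.
have /cvgrPdist_lt/(_ eps eps0)[N _ NP] : C * q^-1 ^+ j @[j --> \oo] --> (C * 0 : R).
  apply: cvgM; first exact: cvg_cst.
  by apply: cvg_expr; rewrite ger0_norm ?invr_ge0 ?(ltW q0) // invf_lt1.
exists N; have := NP N (leqnn N); rewrite mulr0 sub0r normrN exprVn.
exact: le_lt_trans (ler_norm _).
Qed.

Section SelfSimilar.
Context {R : realType} {d : nat}.
Variables (T : giet R d) (n : nat).
Hypotheses (TX : is_exchange T) (TT : translation_branches T) (SS : self_similar T n).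
Local Notation Tn := (iter n RV T).
Local Notation letter := ('I_d.+1).
Implicit Types (a b c : letter) (x y z : R).

Definition dilation : R := locked (glength T / glength Tn).
Local Notation rho := dilation.

Definition delta a : R := gmap T (lft T a) - lft T a.

(** Floor [i] of the tower over [a] is the letter [a] contracted by [rho] and translated by this
    amount. *)
Definition floor_shift a i : R := \sum_(k < i) delta (floor_letter T n a k).

Let TnE : [/\ is_exchange Tn, induced_map T Tn (rv_words T n), glength Tn < glength T &
  forall x, common_endpoint T x -> common_endpoint Tn x /\ x < glength Tn].
Proof.
have [n0 TR _ _] := SS.
have [? ? Tl ?] := iter_RV TX TR (translation_iter_RV TX TT TR).
by split => //; exact: Tl.
Qed.

Let TnX : is_exchange Tn. Proof. by case: TnE. Qed.
Let TTn : induced_map T Tn (rv_words T n). Proof. by case: TnE. Qed.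

Lemma dilation_gt1 : 1 < rho.
Proof.
by have [_ _ l _] := TnE; rewrite /dilation -lock ltr_pdivlMr ?mul1r // glength_gt0.
Qed.

Lemma dilation_gt0 : 0 < rho. Proof. exact: lt_trans dilation_gt1. Qed.
Local Notation rho0 := dilation_gt0.

Let rhoK x : rho * (x / rho) = x. Proof. by rewrite mulrC divfK // gt_eqF // rho0. Qed.

Lemma gitv_Tn a x : gitv Tn a x <-> gitv T a (rho * x).
Proof. by rewrite /dilation -lock; have [_ _ -> _] := SS. Qed.

Lemma gmap_Tn x : gdom Tn x -> rho * gmap Tn x = gmap T (rho * x).
Proof. by rewrite /dilation -lock; have [_ _ _] := SS; exact. Qed.

Let gitv_div a z : gitv T a z -> gitv Tn a (z / rho).
Proof. by move=> az; apply/gitv_Tn; rewrite rhoK. Qed.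

Lemma lft_Tn a : lft Tn a = lft T a / rho.
Proof.
have E : gitv Tn a = `[lft T a / rho, rgt T a / rho[%classic.
  apply/seteqP; split => x.
    move=> /gitv_Tn/(gitvP TX)/andP[l r].
    by rewrite /= in_itv /= ler_pdivrMr ?ltr_pdivlMr ?rho0 // (mulrC x) l r.
  rewrite /= in_itv /= ler_pdivrMr ?ltr_pdivlMr ?rho0 // => /andP[l r].
  by apply/gitv_Tn/(gitvP TX); rewrite (mulrC rho) l r.
have [|E1 _] := itv_endpoints _ E; last exact: E1.
by rewrite ltr_pM2r ?invr_gt0 ?rho0 // lft_rgt.
Qed.

Lemma heightE a : height T n a = size (rv_words T n a).
Proof.
have aL : gitv Tn a (lft Tn a) by exact: gitv_lft.
apply: first_returnE; first exact: ind_nonempty TTn a.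
- by rewrite -(ind_map TTn aL); apply: (gmap_gdom TnX); exists a.
- by move=> j jh; exact: (ind_avoid TTn aL jh).
Qed.

Lemma height_gt0 a : (0 < height T n a)%N.
Proof. by rewrite heightE; exact: ind_nonempty TTn a. Qed.

Lemma floor_letterE a i : (i < height T n a)%N ->
  floor_letter T n a i = nth a (rv_words T n a) i.
Proof.
rewrite heightE => ia; rewrite /floor_letter; case: pickP => [b /asboolP bP|no] /=.
  have aL : gitv Tn a (lft Tn a) by exact: gitv_lft.
  apply: (gitv_inj TX (x := iter i (gmap T) (lft Tn a))).
    by apply: bP; exists (lft Tn a).
  exact: (ind_letter TTn aL ia).
have /asboolP[] := no (nth a (rv_words T n a) i).
by move=> _ [x ax <-]; exact: (ind_letter TTn ax ia).
Qed.

Lemma gmap_delta a x : gitv T a x -> gmap T x = x + delta a.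
Proof.
have [t tP] := TT a => ax; rewrite /delta !tP //; last exact: gitv_lft.
ring.
Qed.

Let iter_letter a z i : gitv T a z -> (i < height T n a)%N ->
  gitv T (floor_letter T n a i) (iter i (gmap T) (z / rho)).
Proof.
move=> az ia; rewrite floor_letterE //; rewrite heightE in ia.
exact: (ind_letter TTn (gitv_div az) ia).
Qed.

Lemma iter_floor a z i : gitv T a z -> (i <= height T n a)%N ->
  iter i (gmap T) (z / rho) = z / rho + floor_shift a i.
Proof.
move=> az; elim: i => [|i IHi] ia; first by rewrite /floor_shift big_ord0 addr0.
rewrite /= (gmap_delta (iter_letter az ia)) IHi; last exact: ltnW.
by rewrite /floor_shift [in RHS]big_ord_recr /= [RHS]addrA.
Qed.

Lemma floor_mem a z i : gitv T a z -> (i < height T n a)%N ->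
  gitv T (floor_letter T n a i) (z / rho + floor_shift a i).
Proof. by move=> az ia; rewrite -iter_floor //; [exact: iter_letter|exact: ltnW]. Qed.

Lemma iter_height a z : gitv T a z ->
  iter (height T n a) (gmap T) (z / rho) = gmap T z / rho.
Proof.
move=> az; rewrite heightE -(ind_map TTn (gitv_div az)).
apply: (mulfI (lt0r_neq0 rho0)); rewrite gmap_Tn ?rhoK //.
by exists a => //; exact: gitv_div.
Qed.

Lemma floor_shift_height a : floor_shift a (height T n a) = delta a / rho.
Proof.
have az := gitv_lft TX a.
have := iter_floor az (leqnn _); rewrite (iter_height az) (gmap_delta az).
by rewrite mulrDl => /addrI.
Qed.

Lemma floor_cover b y : gitv T b y -> exists a z i,
  [/\ gitv T a z, (i < height T n a)%N, floor_letter T n a i = b &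
      y = z / rho + floor_shift a i].
Proof.
move=> bY; have /(ind_cover TTn)[a [x [i [ax ia yE]]]] : gdom T y by exists b.
have ax' := ax; rewrite -heightE in ia; move/gitv_Tn: ax => ax.
have xE : x = rho * x / rho by rewrite mulrAC divff ?mul1r // gt_eqF // rho0.
have {}yE : y = rho * x / rho + floor_shift a i.
  by rewrite -iter_floor // ?(ltnW ia) // -xE.
exists a, (rho * x), i; split => //.
by apply: (gitv_inj TX (floor_mem ax ia)); rewrite -yE.
Qed.

Lemma floor_disjoint a a' z z' i i' : gitv T a z -> gitv T a' z' ->
  (i < height T n a)%N -> (i' < height T n a')%N ->
  z / rho + floor_shift a i = z' / rho + floor_shift a' i' -> a = a' /\ i = i'.
Proof.
wlog ii' : a a' z z' i i' / (i <= i')%N.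
  move=> wl az az' ia ia' E; have [ii'|/ltnW ii'] := leqP i i'.
    exact: wl ii' az az' ia ia' E.
  by have [] := wl _ _ _ _ _ _ ii' az' az ia' ia (esym E).
move=> az az' ia ia'; rewrite -!iter_floor ?(ltnW ia) ?(ltnW ia') // => E.
have zF : gdom T (z / rho).
  by apply: (ind_gdom TTn); exists a => //; exact: gitv_div.
have zF' : gdom T (z' / rho).
  by apply: (ind_gdom TTn); exists a' => //; exact: gitv_div.
(* Injectivity cancels the first [i] iterates; a positive difference would then be a return before
   the height. *)
have {}E : z / rho = iter (i' - i) (gmap T) (z' / rho).
  move: E; rewrite -{1}(subnKC ii') iterD.
  have := iter_gmap_gdom TX (i' - i) zF'; move: (iter _ _ _) => t tF.
  elim: i {ii' ia ia'} => //= i IHi /(gmap_inj TX (iter_gmap_gdom TX _ zF)).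
  by move=> /(_ (iter_gmap_gdom TX _ tF)).
have ieq : i = i'.
  apply/eqP; rewrite eqn_leq ii' leqNgt; apply/negP => lt_ii'.
  apply: (ind_avoid TTn (gitv_div az') (i := (i' - i)%N)).
    by rewrite subn_gt0 lt_ii' -heightE; lia.
  by rewrite -E; exists a => //; exact: gitv_div.
split => //; move: E; rewrite ieq subnn /= => E.
by apply: (gitv_inj TnX (gitv_div az)); rewrite E; exact: gitv_div.
Qed.

(** Self-similarity compares intervals and maps only; the positions are recovered from the order of
    the intervals and of their images. *)
Lemma position_T_unique : gtop Tn = gtop T /\ gbot Tn = gbot T.
Proof.
split.
  apply: position_eq; [exact: exch_top|exact: exch_top|] => a b ab.
  have aL := gitv_lft TX a; have bL := gitv_lft TX b.
  have := exch_order TnX ab (gitv_div aL) (gitv_div bL).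
  rewrite ltr_pM2r ?invr_gt0 ?rho0 // => lt_ab.
  rewrite ltnNge; apply/negP; rewrite leq_eqVlt => /orP[/eqP|ba].
    by move=> /(position_inj (exch_top TX)) E; rewrite E ltxx in lt_ab.
  by have := exch_order TX ba bL aL; rewrite ltNge (ltW lt_ab).
apply: position_eq; [exact: exch_bot|exact: exch_bot|] => a b ab.
have aL := gitv_lft TX a; have bL := gitv_lft TX b.
have := exch_image_order TnX ab (gitv_div aL) (gitv_div bL).
rewrite -(ltr_pM2l rho0) !gmap_Tn ?rhoK //; last 2 first.
- by exists b => //; exact: gitv_div.
- by exists a => //; exact: gitv_div.
move=> lt_ab; rewrite ltnNge; apply/negP; rewrite leq_eqVlt => /orP[/eqP|ba].
  by move=> /(position_inj (exch_bot TX)) E; rewrite E ltxx in lt_ab.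
by have := exch_image_order TX ba bL aL; rewrite ltNge (ltW lt_ab).
Qed.

Lemma scaled_Tn : scaled rho Tn T.
Proof.
have [? ?] := position_T_unique.
by split => // [a x|x xF]; [exact: gitv_Tn|exact: gmap_Tn].
Qed.

Lemma scaled_iter_Tn j : infinitely_renormalizable T ->
  scaled (rho ^+ j) (iter (j * n) RV T) T.
Proof.
move=> TR; elim: j => [|j IHj].
  by rewrite expr0 mul0n /=; split => // [c x|x]; rewrite !mul1r.
have FX i : is_exchange (iter i RV T).
  have [] // := @iter_RV R d T i TX (fun j _ => TR j).
  by apply: translation_iter_RV.
have S m : scaled (rho ^+ j) (iter m RV (iter (j * n) RV T)) (iter m RV T).
  elim: m => [//|m IHm] /=; apply: scaled_RV => //; first by rewrite exprn_gt0 // rho0.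
  by rewrite -iterD.
have S1 := S n.
rewrite mulSn iterD.
have [Et Eb Ei Em] := S1; have [Et' Eb' Ei' Em'] := scaled_Tn.
split => [||c x|x xF].
- by rewrite Et Et'.
- by rewrite Eb Eb'.
- by rewrite exprS -mulrA; split => [/Ei/Ei'|/Ei'/Ei].
- rewrite exprS -!mulrA Em // Em' //; exact/(scaled_gdom _ S1).
Qed.

Lemma height_split a : (0 < height T n a)%N /\
  forall b, (0 < (selfsim_matrix T n) a b) ->
    exists2 i, (i < height T n a)%N & floor_letter T n a i = b.
Proof.
split; first exact: height_gt0.
move=> b; rewrite mxE ltr0n card_gt0 => /set0Pn[i]; rewrite inE => /eqP ib.
by exists i.
Qed.

(** * The orbit of zero *)

Section Orbit.
Hypothesis prim : primitive_mx (selfsim_matrix T n).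

(** Primitivity as reachability: every letter is found by passing repeatedly from a letter to one
    met by its tower. *)
Lemma selfsim_reach (P : letter -> Prop) a b :
  (forall c i, P c -> (i < height T n c)%N -> P (floor_letter T n c i)) ->
  P a -> P b.
Proof.
move=> Pstep; have [p _ pM] := prim; have := pM a b.
have M0 k e f : 0 <= (selfsim_matrix T n ^+ k) e f.
  elim: k e f => [|k IHk] e f; first by rewrite expr0 mxE ler0n.
  by rewrite exprS mxE; apply: sumr_ge0 => g _; rewrite mulr_ge0 // mxE ler0n.
elim: p a {pM} => [|p IHp] a.
  by rewrite expr0 mxE; case: eqVneq => [->//|_]; rewrite ltxx.
rewrite exprS mxE => s0 Pa.
have [c] : exists c, 0 < selfsim_matrix T n a c * (selfsim_matrix T n ^+ p) c b.
  apply: contrapT => noc; move: s0; rewrite ltNge => /negP; apply.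
  apply: sumr_le0 => c _; rewrite leNgt; apply/negP => c0; apply: noc.
  by exists c.
have : 0 <= selfsim_matrix T n a c by rewrite mxE ler0n.
rewrite le_eqVlt => /orP[/eqP <-|ac]; first by rewrite mul0r ltxx.
rewrite pmulr_rgt0 // => /IHp; apply.
by have [_ /(_ c ac)[i ia <-]] := height_split a; exact: Pstep.
Qed.

Definition zero_orbit x : Prop := exists k, x = iter k (gmap T) 0.

Let zeroF : gdom T 0.
Proof. by apply/(gdomP TX); rewrite lexx glength_gt0. Qed.

(** Rescaling fixes 0, so contracting an orbit point gives a point of the orbit of 0 under the
    induced map, which is part of its orbit under [T]. *)
Lemma zero_orbit_floor a x i : gitv T a x -> zero_orbit x ->
  (i < height T n a)%N -> zero_orbit (x / rho + floor_shift a i).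
Proof.
move=> ax [k xk] ia; rewrite -iter_floor ?(ltnW ia) //.
suff [m ->] : zero_orbit (x / rho) by exists (i + m)%N; rewrite iterD.
have zn : gdom Tn 0 by apply/(gdomP TnX); rewrite lexx glength_gt0.
have -> : x / rho = iter k (gmap Tn) 0.
  apply: (mulfI (lt0r_neq0 rho0)).
  by rewrite rhoK (scaled_iter k TnX scaled_Tn zn) mulr0.
elim: k {xk} => [|k [m IHk]]; first by exists 0%N.
have [c ck] := gdom_gitv (iter_gmap_gdom TnX k zn).
rewrite /= (ind_map TTn ck) IHk.
by exists (size (rv_words T n c) + m)%N; rewrite iterD.
Qed.

Lemma zero_orbit_dense b x eps : gitv T b x -> 0 < eps ->
  exists y, [/\ gitv T b y, zero_orbit y & `|x - y| < eps].
Proof.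
move=> bx eps0; have [j jP] := small_geometric (glength T) dilation_gt1 eps0.
(* Each contraction gains a factor [rho]. At level 0 any orbit point of the letter will do, and
   primitivity provides one. *)
suff [y [bY Oy xy]] : exists y, [/\ gitv T b y, zero_orbit y & `|x - y| <= glength T / rho ^+ j].
  by exists y; split => //; exact: le_lt_trans jP.
elim: j b x bx {jP} => [|j IHj] b x bx.
  have [y bY Oy] : exists2 y, gitv T b y & zero_orbit y.
    have [a a0] := gdom_gitv zeroF.
    apply: (@selfsim_reach (fun b => exists2 y, gitv T b y & zero_orbit y) a).
      move=> c i [y cy Oy] ic; exists (y / rho + floor_shift c i); first exact: floor_mem.
      exact: zero_orbit_floor.
    by exists 0 => //; exists 0%N.
  exists y; split => //; rewrite expr0 divr1.
  have /(gdomP TX)/andP[x0 xl] : gdom T x by exists b.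
  have /(gdomP TX)/andP[y0 yl] : gdom T y by exists b.
  by rewrite ler_norml; lra.
have [a [z [i [az ia <- ->]]]] := floor_cover bx.
have [y [ay Oy zy]] := IHj _ _ az.
exists (y / rho + floor_shift a i); split; [exact: floor_mem|exact: zero_orbit_floor|].
rewrite opprD addrACA subrr addr0 -mulrBl normrM normfV (gtr0_norm rho0).
by rewrite exprSr invfM [leRHS]mulrA ler_pM2r ?invr_gt0 ?rho0.
Qed.

(** A return to 0 would make the orbit finite, against its density. *)
Lemma zero_orbit_gt0 i : (0 < i)%N -> 0 < iter i (gmap T) 0.
Proof.
move=> i0; have nn k : 0 <= iter k (gmap T) 0.
  by have /(gdomP TX)/andP[] := iter_gmap_gdom TX k zeroF.
rewrite lt0r nn andbT; apply/eqP => Ti.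
have per k : exists2 j : 'I_i, true & iter k (gmap T) 0 = iter j (gmap T) 0.
  elim: k => [|k [j _ IHk]]; first by exists (Ordinal i0).
  have [ji|] := ltnP j.+1 i; first by exists (Ordinal ji); rewrite //= IHk.
  move=> ij; exists (Ordinal i0) => //=; rewrite IHk -/(iter j.+1 _ _).
  by rewrite (_ : j.+1 = i) //; have := ltn_ord j; lia.
have [s s0 sP] := min_positive_value (fun j : 'I_i => iter j (gmap T) 0).
have l0 := glength_gt0 TX.
(* No orbit point lies within [x] of [x]: 0 is at distance [x], and the others are at least
   [2 * x]. *)
pose x := Num.min s (glength T) / 2.
have x0 : 0 < x by rewrite divr_gt0 // lt_min s0.
have xs : 2 * x <= s by rewrite mulrC divfK // ge_min lexx.
have xl : 2 * x <= glength T by rewrite mulrC divfK // ge_min lexx orbT.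
have /gdom_gitv[b bx] : gdom T x by apply/(gdomP TX); lra.
have [y [_ [k ->]]] := zero_orbit_dense bx x0.
have [j _ ->] := per k; have := nn j; rewrite le_eqVlt => /orP[/eqP <-|/sP].
  by rewrite subr0 gtr0_norm // ltxx.
by rewrite /= => sj; rewrite distrC ger0_norm ?subr_ge0; lra.
Qed.

(** The iterates of 0 up to time [m] stay above a positive [s], so a domain shorter than [s] is
    entered again only after time [m]. *)
Lemma return_words_unbounded m : infinitely_renormalizable T ->
  exists k, forall a, gtop (iter k RV T) a = 1%N -> (m < size (rv_words T k a))%N.
Proof.
move=> TR.
have [s s0 sP] := min_positive_value (fun j : 'I_m.+1 => iter j (gmap T) 0).
have [j jP] := small_geometric (glength T) dilation_gt1 s0.
exists (j * n)%N => a a1; rewrite ltnNge; apply/negP => am.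
have [FX TF _ _] := @iter_RV R d T (j * n) TX (fun j _ => TR j)
  (translation_iter_RV TX TT (fun j _ => TR j)).
have a0 := gitv_first FX a1.
have : gdom (iter (j * n) RV T) (gmap (iter (j * n) RV T) 0).
  by apply: (gmap_gdom FX); exists a.
rewrite (ind_map TF a0) => /(scaled_gdom _ (scaled_iter_Tn j TR))/(gdomP TX)/andP[_].
have w0 := ind_nonempty TF a.
set r := size _ in w0 am *.
have := sP (Ordinal (am : (r < m.+1)%N)) (zero_orbit_gt0 w0).
rewrite /= => sr; rewrite mulrC -ltr_pdivlMr ?exprn_gt0 ?rho0 // => /(le_lt_trans sr).
by move=> /lt_trans /(_ jP); rewrite ltxx.
Qed.

End Orbit.

(** Such a point survives [n] steps of induction, and rescaling then multiplies it by [rho];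
    repeated, this leaves the domain. *)
Lemma no_common_endpoint x : ~ common_endpoint T x.
Proof.
move=> Cx.
have step y : common_endpoint T y -> common_endpoint T (rho * y).
  have [_ _ _ TC] := TnE => /TC[[y0 [b bY] [a ay]] _].
  split; first by rewrite mulr_gt0 // rho0.
    by exists b; rewrite -bY lft_Tn rhoK.
  exists a; rewrite -ay gmap_Tn ?lft_Tn ?rhoK //.
  by exists a => //; rewrite -lft_Tn; exact: gitv_lft.
have Cj j : common_endpoint T (rho ^+ j * x).
  elim: j => [|j IHj]; first by rewrite mul1r.
  by rewrite exprS -mulrA; exact: step.
have [x0 _ _] := Cx.
have [j jP] := small_geometric (glength T) dilation_gt1 x0.
have [_ [b bx] _] := Cj j.
have /(gdomP TX)/andP[_] : gdom T (lft T b) by exists b => //; exact: gitv_lft.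
by rewrite bx mulrC -ltr_pdivlMr ?exprn_gt0 ?rho0 // => /lt_trans/(_ jP); rewrite ltxx.
Qed.

(** * Rigidity of potentials cohomologous to a constant *)

Section Coboundary.
Variables (omega cc : letter -> R) (kappa : R).
Hypothesis coh : forall a i, (i < height T n a)%N ->
  \sum_(k < i) omega (floor_letter T n a k) = kappa + cc a - cc (floor_letter T n a i).
Hypothesis inv : forall a,
  \sum_(k < height T n a) omega (floor_letter T n a k) = omega a.

(** The letter containing 0 also contains floor 0 of its own tower, where the sum is empty and [cc]
    cancels. *)
Let kappa0 : kappa = 0.
Proof.
have [|a a1] := @position_surj d (gtop T) 1 (exch_top TX); first by lia.
have a0 := gitv_first TX a1; have := coh (height_gt0 a).
have -> : floor_letter T n a 0 = a.
  apply: (gitv_inj TX (x := 0) _ a0).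
  by have := floor_mem a0 (height_gt0 a); rewrite /floor_shift big_ord0 mul0r addr0.
by rewrite big_ord0 addrK.
Qed.

(** Inside a tower this is the difference of two consecutive instances of [coh]. At the top, [inv]
    moves the relation to the point [z], whose image is [rho] times that of [x]; as the image is
    positive, this can happen only finitely often. *)
Let letter_jump x b b' : gitv T b x -> gitv T b' (gmap T x) -> 0 < gmap T x ->
  omega b - cc b + cc b' = 0.
Proof.
move=> bx bx' Tx0; have [j jP] := small_geometric (glength T) dilation_gt1 Tx0.
elim: j x b b' bx bx' {Tx0} jP => [|j IHj] x b b' bx bx' jP.
  have /(gdomP TX)/andP[_] : gdom T (gmap T x) by exists b'.
  by rewrite expr0 divr1 in jP; move=> /lt_trans/(_ jP); rewrite ltxx.
have [a [z [i [az ia ab xE]]]] := floor_cover bx.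
have TxE : gmap T x = iter i.+1 (gmap T) (z / rho) by rewrite xE -iter_floor // ltnW.
have [ia1|ai] := ltnP i.+1 (height T n a).
  have b'E : floor_letter T n a i.+1 = b'.
    apply: (gitv_inj TX _ bx'); rewrite TxE; exact: iter_letter.
  have := coh ia1; rewrite big_ord_recr /= (coh ia) ab b'E; lra.
have hE : height T n a = i.+1 by apply/eqP; rewrite eqn_leq ai ia.
have := inv a; rewrite hE big_ord_recr /= (coh ia) ab kappa0 => oa.
have {}TxE : gmap T x = gmap T z / rho by rewrite TxE -hE iter_height.
have [a' za'] : exists a', gitv T a' (gmap T z).
  by apply: gdom_gitv; apply: (gmap_gdom TX); exists a.
have b'E : floor_letter T n a' 0 = b'.
  apply: (gitv_inj TX _ bx'); have := floor_mem za' (height_gt0 a').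
  by rewrite /floor_shift big_ord0 addr0 -TxE.
have := coh (height_gt0 a'); rewrite big_ord0 kappa0 b'E => ca'.
have := IHj _ _ _ az za'; rewrite TxE in jP.
have -> : glength T / rho ^+ j < gmap T z.
  move: jP; rewrite exprSr invfM mulrA ltr_pM2r // invr_gt0 rho0 //.
by move=> /(_ isT); lra.
Qed.

(** When the image is 0, move slightly to the right without changing letters. *)
Let letter_jump0 x b b' : gitv T b x -> gitv T b' (gmap T x) ->
  omega b - cc b + cc b' = 0.
Proof.
move=> bx bx'.
have : 0 <= gmap T x by have /(gdomP TX)/andP[] : gdom T (gmap T x) by exists b'.
rewrite le_eqVlt => /orP[/eqP Tx0|]; last exact: letter_jump.
have /(gitvP TX)/andP[bl br] := bx; have /(gitvP TX)/andP[bl' br'] := bx'.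
pose e := Num.min (rgt T b - x) (rgt T b' - gmap T x) / 2.
have e0 : 0 < e by rewrite divr_gt0 // lt_min !subr_gt0 br br'.
have e1 : 2 * e <= rgt T b - x by rewrite mulrC divfK // ge_min lexx.
have e2 : 2 * e <= rgt T b' - gmap T x by rewrite mulrC divfK // ge_min lexx orbT.
have bxe : gitv T b (x + e) by apply/(gitvP TX); lra.
have TE : gmap T (x + e) = gmap T x + e by rewrite (gmap_delta bxe) (gmap_delta bx); ring.
apply: (letter_jump bxe); rewrite TE; last by rewrite -Tx0 add0r.
by apply/(gitvP TX); lra.
Qed.

(** Let [b] be the leftmost letter where [cc] changes and [y] the preimage of its left endpoint. If
    [y] is inside its interval, its left neighbours are mapped to letters before [b], and
    [letter_jump0] applied on both sides shows that [cc] does not change. If [y] is a left endpoint,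
    [lft T b] is a common endpoint. Once [cc] is constant, [letter_jump0] reads [omega a = 0]. *)
Lemma coboundary_trivial a : omega a = 0.
Proof.
have [|a1 a11] := @position_surj d (gtop T) 1 (exch_top TX); first by lia.
have cconst b : cc b = cc a1.
  apply: contrapT => /eqP cb.
  case: (@arg_minnP _ b (fun b => cc b != cc a1) (gtop T) cb) => {cb}b cb bmin.
  have low e : (gtop T e < gtop T b)%N -> cc e = cc a1.
    by move=> eb; apply/eqP; apply: contraTT eb => /bmin; rewrite -leqNgt.
  have bL := gitv_lft TX b.
  have bF : gdom T (lft T b) by exists b.
  have lowx y e : gitv T e y -> y < lft T b -> cc e = cc a1.
    move=> ey yb; apply: low; rewrite ltnNge; apply/negP.
    rewrite leq_eqVlt => /orP[/eqP/(position_inj (exch_top TX)) E|be].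
      by have /(gitvP TX)/andP[] := ey; rewrite -E leNgt yb.
    by have := exch_order TX be bL ey; rewrite ltNge (ltW yb).
  have [y yF yE] := gmap_surj TX bF; have [al ay] := gdom_gitv yF.
  have jy : omega al - cc al + cc b = 0 by apply: (letter_jump0 ay); rewrite yE.
  have /(gitvP TX)/andP[yl yr] := ay.
  have [yl'|ly] := ltP (lft T al) y.
    have b0 : 0 < lft T b.
      rewrite lt0r; have /(gdomP TX)/andP[-> _] := bF; rewrite andbT.
      apply: contra cb => /eqP b0; apply/eqP; congr cc.
      by apply: (gitv_inj TX bL); rewrite b0; exact: gitv_first.
    pose e := Num.min (y - lft T al) (lft T b) / 2.
    have e0 : 0 < e by rewrite divr_gt0 // lt_min subr_gt0 yl' b0.
    have e1 : 2 * e <= y - lft T al by rewrite mulrC divfK // ge_min lexx.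
    have e2 : 2 * e <= lft T b by rewrite mulrC divfK // ge_min lexx orbT.
    have aye : gitv T al (y - e) by apply/(gitvP TX); lra.
    have TE : gmap T (y - e) = lft T b - e by rewrite -yE (gmap_delta aye) (gmap_delta ay); ring.
    have /gdom_gitv[b' bb'] : gdom T (gmap T (y - e)) by apply: (gmap_gdom TX); exists al.
    have := letter_jump0 aye bb'; rewrite (lowx _ _ bb') ?TE; last by lra.
    by move: cb => /eqP; lra.
  have yE' : y = lft T al by apply/eqP; rewrite eq_le yl ly.
  apply: (@no_common_endpoint (lft T b)); split; last first.
  - by exists al; rewrite -yE'.
  - by exists b.
  rewrite lt0r; have /(gdomP TX)/andP[-> _] := bF; rewrite andbT.
  apply: contra cb => /eqP b0; apply/eqP; congr cc.
  by apply: (gitv_inj TX bL); rewrite b0; exact: gitv_first.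
have aL := gitv_lft TX a.
have [b bT] : exists b, gitv T b (gmap T (lft T a)).
  by apply: gdom_gitv; apply: (gmap_gdom TX); exists a.
by have := letter_jump0 aL bT; rewrite !cconst subrK.
Qed.

End Coboundary.

End SelfSimilar.

(** * Conformal functions *)

(** Induction on the number of tiles, removing the leftmost one. *)
Lemma interval_partition_sum (R : realType) (I : finType) (F : R -> R)
    (lo hi : I -> R) (P : {set I}) (a b : R) :
  a <= b -> (forall i, i \in P -> lo i < hi i) ->
  (forall x, a <= x < b <-> exists2 i, i \in P & lo i <= x < hi i) ->
  (forall i j x, i \in P -> j \in P -> lo i <= x < hi i -> lo j <= x < hi j -> i = j) ->
  F b - F a = \sum_(i in P) (F (hi i) - F (lo i)).
Proof.
have [k] := ubnP #|P|; elim: k P a => // k IHk P a Pk ab lohi cover disj.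
move: ab; rewrite le_eqVlt => /orP[/eqP ab|ab].
  rewrite ab subrr big1 // => i iP; exfalso.
  have : a <= lo i < b by apply/cover; exists i; rewrite // lexx lohi.
  by rewrite ab => /andP[bl /(le_lt_trans bl)]; rewrite ltxx.
have [i iP /andP[lia ahi]] : exists2 i, i \in P & lo i <= a < hi i.
  by apply/cover; rewrite lexx.
have loi : lo i = a.
  apply/eqP; rewrite eq_le lia /=.
  by have /andP[] : a <= lo i < b by apply/cover; exists i; rewrite // lexx lohi.
have hib : hi i <= b.
  rewrite leNgt; apply/negP => bhi.
  have : a <= b < b by apply/cover; exists i => //; rewrite loi (ltW ab).
  by rewrite ltxx andbF.
rewrite (big_setD1 i) //= loi -(IHk (P :\ i)%SET (hi i)) //; first ring.
- by rewrite (leq_trans _ (Pk : (#|P| <= k)%N)) // [in ltnRHS](cardsD1 i) iP.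
- by move=> j /setD1P[_]; exact: lohi.
- move=> x; split => [/andP[hix xb]|[j /setD1P[ji jP] /andP[ljx xhj]]].
    have [j jP jx] : exists2 j, j \in P & lo j <= x < hi j.
      by apply/cover; rewrite xb (le_trans (ltW ahi) hix).
    exists j => //; apply/setD1P; split => //; apply/eqP => ji.
    by move: jx; rewrite ji ltNge hix andbF.
  have /andP[ax xb] : a <= x < b by apply/cover; exists j; rewrite // ljx xhj.
  rewrite xb andbT leNgt; apply/negP => xhi.
  have : j = i by apply: (disj j i x) => //; rewrite ?ljx ?xhj // loi ax.
  by apply/eqP.
- by move=> j j' x /setD1P[_ jP] /setD1P[_ jP']; exact: disj.
Qed.

(* Birkhoff contraction: the ratios of consecutive terms become constant. *)
Section Proportional.
Context {R : realType} {d : nat}.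
Variables (N : 'M[R]_d.+1) (v : nat -> 'rV[R]_d.+1) (p : nat).
Hypotheses (N0 : forall a b, 0 <= N a b) (Np : forall a b, 0 < (N ^+ p) a b).
Hypotheses (v0 : forall k b, 0 < v k 0 b) (vN : forall k, v k = v k.+1 *m N).

Let vNp k : v k = v (k + p)%N *m (N ^+ p).
Proof.
elim: (p) => [|q IHq]; first by rewrite addn0 expr0 mulmx1.
by rewrite IHq vN exprS addnS mulmxA.
Qed.

Let tot k : R := \sum_a v k 0 a.

Let tot0 k : 0 < tot k.
Proof.
by rewrite /tot (bigD1 ord0) //= ltr_pwDl // sumr_ge0 // => a _; rewrite ltW.
Qed.

Let bounds : exists m M : R, [/\ 0 < m, m <= M & forall a b, m <= (N ^+ p) a b <= M].
Proof.
have [m m0 mP] := min_positive_value (fun ab : 'I_d.+1 * 'I_d.+1 => (N ^+ p) ab.1 ab.2).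
exists m, (\sum_a \sum_b (N ^+ p) a b).
have mle a b : m <= (N ^+ p) a b <= \sum_a \sum_b (N ^+ p) a b.
  rewrite (mP (a, b)) //= (bigD1 a) //= (bigD1 b) //= -addrA lerDl.
  by apply: addr_ge0; apply: sumr_ge0 => *; [exact: ltW|apply: sumr_ge0 => *; exact: ltW].
by split => //; have /andP[/le_trans] := mle 0 0; apply.
Qed.

Lemma eventually_proportional : exists2 c, 0 < c & v 1%N = c *: v 0%N.
Proof.
have [m [M [m0 mM mNM]]] := bounds; have M0 : 0 < M := lt_le_trans m0 mM.
have wNp (w : 'rV[R]_d.+1) b : (forall a, 0 <= w 0 a) ->
    m * (\sum_a w 0 a) <= (w *m N ^+ p) 0 b <= M * (\sum_a w 0 a).
  move=> w0; rewrite mxE !mulr_sumr; apply/andP; split; apply: ler_sum => a _;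
  by rewrite [leLHS]mulrC [leRHS]mulrC ?(mulrC (w 0 a)) ler_wpM2r //; have /andP[] := mNM a b.
have vb k b : m * tot (k + p) <= v k 0 b <= M * tot (k + p).
  by rewrite [v k]vNp; apply: wNp => a; exact: ltW.
have ratio k : exists cC : R * R, [/\ forall b, cC.1 * v k 0 b <= v k.+1 0 b <= cC.2 * v k 0 b,
    exists b, v k.+1 0 b = cC.1 * v k 0 b & exists b, v k.+1 0 b = cC.2 * v k 0 b].
  pose r b := v k.+1 0 b / v k 0 b.
  have rK b : v k.+1 0 b = r b * v k 0 b by rewrite /r divfK // gt_eqF.
  have [b1 _ b1P] := @arg_minP _ _ 'I_d.+1 ord0 predT r isT.
  have [b2 _ b2P] := @arg_maxP _ _ 'I_d.+1 ord0 predT r isT.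
  exists (r b1, r b2); split; [|by exists b1|by exists b2].
  by move=> b; rewrite /= rK !ler_pM2r // b1P //=; exact: b2P.
(* [c k] and [C k] are the extreme ratios of the entries of [v k.+1] to those of [v k]. Applying [N]
   narrows their range, so it widens as [k] grows: [c] decreases and [C] increases. *)
have [cC cCP] := choice ratio; pose c k := (cC k).1; pose C k := (cC k).2.
have cle k b : c k * v k 0 b <= v k.+1 0 b by have [/(_ b)/andP[]] := cCP k.
have leC k b : v k.+1 0 b <= C k * v k 0 b by have [/(_ b)/andP[]] := cCP k.
have cat k : exists b, v k.+1 0 b = c k * v k 0 b by have [] := cCP k.
have Cat k : exists b, v k.+1 0 b = C k * v k 0 b by have [] := cCP k.
have cC_le k : c k <= C k.
  by rewrite -(ler_pM2r (v0 k 0)); exact: le_trans (cle _ _) (leC _ _).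
have c0 k : 0 < c k.
  have [b bE] := cat k; by rewrite -(pmulr_lgt0 _ (v0 k b)) -bE.
have vS k b : v k 0 b = \sum_a v k.+1 0 a * N a b by rewrite {1}vN mxE.
have cS k : c k.+1 <= c k.
  have [b bE] := cat k; rewrite -(ler_pM2r (v0 k b)) -bE (vS k) (vS k.+1) mulr_sumr.
  by apply: ler_sum => a _; rewrite mulrA ler_wpM2r.
have CS k : C k <= C k.+1.
  have [b bE] := Cat k; rewrite -(ler_pM2r (v0 k b)) -bE (vS k) (vS k.+1) mulr_sumr.
  by apply: ler_sum => a _; rewrite mulrA ler_wpM2r.
have cD k j : c (k + j)%N <= c k.
  by elim: j => [|j IHj]; rewrite ?addn0 // addnS; exact: le_trans (cS _) IHj.
have CD k j : C k <= C (k + j)%N.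
  by elim: j => [|j IHj]; rewrite ?addn0 // addnS; exact: le_trans IHj (CS _).
(* The entries of one vector lie between [m] and [M] times a common total; two consecutive vectors
   are compared, whence the square. *)
pose K := (M / m) ^+ 2.
have CK k : C k <= K * c 0%N.
  apply: (@le_trans _ _ (K * c k)); last first.
    rewrite ler_wpM2l ?exprn_ge0 ?divr_ge0 //; try exact: ltW.
    by rewrite -[k]add0n.
  have [b bE] := Cat k; have [b' bE'] := cat k.
  have /andP[h1 _] := vb k b; have /andP[_ h2] := vb k.+1 b.
  have /andP[_ h3] := vb k b'; have /andP[h4 _] := vb k.+1 b'.
  rewrite bE in h2; rewrite bE' in h4.
  have t1 := tot0 (k + p); have t2 := tot0 (k.+1 + p).
  have e1 : C k * (m * tot (k + p)) <= M * tot (k.+1 + p).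
    by apply: le_trans h2; rewrite ler_wpM2l // (le_trans (ltW (c0 k))).
  have e2 : m * tot (k.+1 + p) <= c k * (M * tot (k + p)).
    by apply: (le_trans h4); rewrite ler_wpM2l // ltW.
  have e3 : C k * (m * tot (k + p)) * m <= M * (c k * (M * tot (k + p))).
    apply: (@le_trans _ _ (M * tot (k.+1 + p) * m)); first by rewrite ler_wpM2r // ltW.
    by rewrite -mulrA ler_wpM2l ?(ltW M0) // mulrC.
  have mt : 0 < m ^+ 2 * tot (k + p) by rewrite mulr_gt0 ?exprn_gt0.
  rewrite -(ler_pM2r mt); apply: le_trans (_ : C k * (m * tot (k + p)) * m <= _); first by rewrite le_eqVlt; apply/orP; left; apply/eqP; ring.
  apply: (le_trans e3); rewrite le_eqVlt; apply/orP; left; apply/eqP.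
  rewrite /K expr_div_n; field; exact: lt0r_neq0.
pose D k := C k - c k.
have D0 k : 0 <= D k by rewrite subr_ge0.
pose kap0 := m ^+ 2 / (M ^+ 2 * d.+1%:R).
have kap00 : 0 < kap0 by rewrite divr_gt0 ?mulr_gt0 ?exprn_gt0 // ltr0n.
pose kap := Num.min kap0 (1 / 2).
have kap_gt0 : 0 < kap by rewrite lt_min kap00 divr_gt0.
(* With k' = k + p, the excess of [v k'.+1] over [c k' *: v k'] has an entry equal to [D k'] times
   that of [v k'], and [N ^+ p] spreads it to all entries with weight at least [m]. Relative to
   [v k] this is at least [kap0 * D k']. The minimum with 1/2 keeps the factor positive. *)
have Dcontr k : D k <= (1 - kap) * D (k + p)%N.
  set k' := (k + p)%N; pose w : 'rV[R]_d.+1 := v k'.+1 - c k' *: v k'.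
  have w0 a : 0 <= w 0 a by rewrite !mxE subr_ge0.
  have wN : v k.+1 - c k' *: v k = w *m N ^+ p.
    by rewrite /w mulmxBl -scalemxAl /k' -addSn -!vNp.
  have wsum : D k' * (m * tot (k' + p)) <= \sum_a w 0 a.
    have [b bE] := Cat k'; apply: (@le_trans _ _ (w 0 b)).
      have -> : w 0 b = D k' * v k' 0 b by rewrite !mxE bE -mulrBl.
      rewrite (ler_wpM2l (D0 _)) //.
      by have /andP[] := vb k' b.
    by rewrite [leRHS](bigD1 b) //= lerDl sumr_ge0.
  have totk : tot k' <= d.+1%:R * (M * tot (k' + p)).
    rewrite mulr_natl -[d.+1 in leRHS]card_ord -sumr_const; apply: ler_sum => a _.
    by have /andP[] := vb k' a.
  have [b bE] := cat k.
  have : m * (D k' * (m * tot (k' + p))) <= (c k - c k') * v k 0 b.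
    have /andP[wb _] := wNp w b w0.
    rewrite [leRHS]mulrBl -bE; apply: le_trans (_ : (w *m N ^+ p) 0 b <= _); last by rewrite -wN !mxE.
    by apply: le_trans wb; rewrite ler_wpM2l // ltW.
  move=> h1; have h2 : kap0 * D k' * v k 0 b <= m * (D k' * (m * tot (k' + p))).
    have /andP[_ h3] := vb k b; apply: (@le_trans _ _ (kap0 * D k' * (M * (d.+1%:R * (M * tot (k' + p)))))).
      rewrite (ler_wpM2l (mulr_ge0 (ltW kap00) (D0 k'))) //; apply: (le_trans h3).
      by rewrite ler_wpM2l // ltW.
    rewrite le_eqVlt; apply/orP; left; apply/eqP; rewrite /kap0; field.
    by rewrite (lt0r_neq0 M0) /= nat1r pnatr_eq0.
  have : kap0 * D k' <= c k - c k'.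
    by rewrite -(ler_pM2r (v0 k b)); exact: le_trans h2 h1.
  have : kap * D k' <= kap0 * D k' by rewrite ler_wpM2r ?D0 // ge_min lexx.
  by have := CD k p; rewrite -/k' /D; lra.
pose q := 1 - kap.
have q0 : 0 < q.
  rewrite /q; have : kap <= 1 / 2 by rewrite ge_min lexx orbT.
  lra.
have q1 : 1 < q^-1 by rewrite invf_gt1 // /q; lra.
(* The spread at 0 is a geometric factor times one arbitrarily far back in the orbit, and all
   spreads are bounded by [K * c 0]. *)
have Dj j : D 0%N <= q ^+ j * (K * c 0%N).
  apply: (@le_trans _ _ (q ^+ j * D (j * p)%N)); last first.
    rewrite ler_wpM2l ?exprn_ge0 ?(ltW q0) //.
    by apply: le_trans (CK (j * p)%N); rewrite /D gerDl oppr_le0 ltW.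
  elim: j => [|j IHj]; first by rewrite mul1r.
  apply: (le_trans IHj); rewrite exprSr -mulrA ler_wpM2l ?exprn_ge0 ?(ltW q0) //.
  by rewrite mulSn addnC.
have D00 : D 0%N = 0.
  apply/eqP; rewrite eq_le D0 andbT leNgt; apply/negP => D0'.
  have [j] := small_geometric (K * c 0%N) q1 D0'.
  by rewrite exprVn invrK mulrC ltNge Dj.
exists (c 0%N) => //; apply/rowP => b; rewrite !mxE; apply/eqP; rewrite eq_le cle andbT.
by move: D00 => /eqP; rewrite subr_eq0 => /eqP <-.
Qed.

End Proportional.

Section Conformal.
Context {R : realType} {d : nat}.
Variables (T : giet R d) (n : nat).
Hypotheses (TX : is_exchange T) (TT : translation_branches T) (SS : self_similar T n).
Hypothesis prim : primitive_mx (selfsim_matrix T n).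
Local Notation letter := ('I_d.+1).
Local Notation rho := (dilation T n).
Local Notation l := (glength T).
Local Notation flr := (floor_letter T n).
Local Notation shift := (floor_shift T n).

Let rho0 : 0 < rho := dilation_gt0 TX TT SS.
Let rho1 : 1 < rho := dilation_gt1 TX TT SS.

Definition floors : finType := {a : letter & 'I_(height T n a)}.

Definition floor_index (u : floors) : nat := tagged u.

Definition base (u : floors) : letter := flr (tag u) (floor_index u).

Definition floor_edge : rel floors := fun u v => base v == tag u.

Definition floor_symbol (u : floors) : symbol d := (tag u, floor_index u).

Lemma floor_symbol_inj : injective floor_symbol.
Proof.
move=> [a i] [b j] /= [ab]; rewrite /floor_index /=.
by case: b / ab j => j /= /val_inj ->.
Qed.

Lemma path_shiftE : path_shift T n = edge_shift floor_symbol floor_edge.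
Proof.
apply/seteqP; split => [x xE|_ [y yE ->] k]; last first.
  by rewrite /edge /is_floor /= !ltn_ord; exact: yE.
have xf k : is_floor T n (x k) by have /and3P[] := xE k.
exists (fun k => Tagged (fun a => 'I_(height T n a)) (Ordinal (xf k)) : floors).
  by move=> k; have /and3P[] := xE k.
by apply/funext => k; rewrite /coded /floor_symbol /= -surjective_pairing.
Qed.

Lemma floor_edge_pred u : exists v, floor_edge v u.
Proof.
exists (Tagged (fun a => 'I_(height T n a)) (Ordinal (height_gt0 TX TT SS (base u))) : floors).
by rewrite /floor_edge.
Qed.

Lemma floor_edge_succ u : exists v, floor_edge u v.
Proof.
have aL := gitv_lft TX (tag u).
have [a [z [i [_ ia iE _]]]] := floor_cover TX TT SS aL.
exists (Tagged (fun a => 'I_(height T n a)) (Ordinal ia) : floors).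
by rewrite /floor_edge /base /floor_index /= iE.
Qed.

Lemma floor_edge_connect u v : connect floor_edge u v.
Proof.
have : forall w, tag w = tag u -> connect floor_edge w v; last exact.
pose P c := forall w : floors, tag w = c -> connect floor_edge w v.
apply: (selfsim_reach TX TT SS prim (P := P) (a := base v)).
- move=> c i Pc ic w wt.
  pose x : floors := Tagged (fun a => 'I_(height T n a)) (Ordinal ic).
  apply: connect_trans (Pc x erefl); apply: connect1.
  by rewrite /floor_edge /base /floor_index /= wt.
- by move=> w wt; apply: connect1; rewrite /floor_edge wt.
Qed.

Section Weights.
Variable s : letter -> R.
Hypotheses (s0 : forall a, 0 < s a)
  (sinv : forall a, \prod_(k < height T n a) s (flr a k) = s a).

Definition floor_weight (u : floors) : R :=
  \prod_(k < floor_index u) s (flr (tag u) k).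

Lemma floor_weight_gt0 u : 0 < floor_weight u.
Proof. exact: prodr_gt0. Qed.

(* The primitive of a measure nu with nu (T A) = s a * nu A for A in I_a. *)
Definition conformal (F : R -> R) : Prop :=
  (forall x y, 0 <= x -> x < y -> y <= l -> F x < F y) /\
  (forall a x y, lft T a <= x <= rgt T a -> lft T a <= y <= rgt T a ->
     F (y + delta T a) - F (x + delta T a) = s a * (F y - F x)).

(** The right endpoint is outside the half-open letter; if its translate went too far, points just
    before it already would. *)
Lemma closed_floor a i z : (i < height T n a)%N -> lft T a <= z <= rgt T a ->
  lft T (flr a i) <= z / rho + shift a i <= rgt T (flr a i).
Proof.
move=> ia /andP[lz zr]; apply/andP; split.
  have /(gitvP TX)/andP[+ _] := floor_mem TX TT SS (gitv_lft TX a) ia.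
  by move/le_trans; apply; rewrite lerD2r ler_pM2r ?invr_gt0.
move: zr; rewrite le_eqVlt => /orP[/eqP ->|zr]; last first.
  have az : gitv T a z by apply/(gitvP TX); rewrite lz.
  by have /(gitvP TX)/andP[_ /ltW] := floor_mem TX TT SS az ia.
rewrite leNgt; apply/negP => br.
have ar := lft_rgt TX a.
pose z1 := Num.max (lft T a) (rho * (rgt T (flr a i) - shift a i)).
have z1r : z1 < rgt T a.
  rewrite gt_max ar /= -ltr_pdivlMl // mulrC.
  by move: br; rewrite mulrC; lra.
have az1 : gitv T a z1 by apply/(gitvP TX); rewrite le_max lexx z1r.
have /(gitvP TX)/andP[_] := floor_mem TX TT SS az1 ia.
rewrite ltNge -lerBlDr ler_pdivlMr //.
by rewrite [leLHS]mulrC le_max lexx orbT.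
Qed.

Lemma floor_increment F a i x y : conformal F -> (i <= height T n a)%N ->
  lft T a <= x <= rgt T a -> lft T a <= y <= rgt T a ->
  F (y / rho + shift a i) - F (x / rho + shift a i) =
  \prod_(k < i) s (flr a k) * (F (y / rho) - F (x / rho)).
Proof.
move=> [_ Fs] + ax ay; elim: i => [|i IHi] ia.
  by rewrite /floor_shift !big_ord0 mul1r !addr0.
rewrite big_ord_recr /= [_ * s _]mulrC -mulrA -(IHi (ltnW ia)).
rewrite -Fs; try exact: closed_floor.
by rewrite /floor_shift [in LHS]big_ord_recr /= !addrA.
Qed.

(** Climbing the tower over [a] multiplies increments by the product of the slopes met, which [sinv]
    identifies with [s a]. *)
Lemma conformal_dilation F : conformal F -> conformal (fun x => F (x / rho)).
Proof.
move=> FC; have [Fmono _] := FC; split => [x y x0 xy yl|a x y ax ay].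
  apply: Fmono; rewrite ?divr_ge0 ?(ltW rho0) ?ltr_pM2r ?invr_gt0 //.
  by rewrite ler_pdivrMr // (le_trans yl) // ler_peMr ?(ltW rho1) // ltW // glength_gt0.
have dE z : (z + delta T a) / rho = z / rho + shift a (height T n a).
  by rewrite mulrDl (floor_shift_height TX TT SS).
by rewrite !dE floor_increment // sinv.
Qed.

Lemma letter_bounds a x : lft T a <= x <= rgt T a -> 0 <= x <= l.
Proof.
have aL := gitv_lft TX a.
have /(gdomP TX)/andP[l0 _] := gitv_gdom aL.
move=> /andP[lx xr]; rewrite (le_trans l0 lx) /= (le_trans xr) //.
rewrite leNgt; apply/negP => lr.
have la : lft T a < l by have /(gdomP TX)/andP[] := gitv_gdom aL.
have : gitv T a l by apply/(gitvP TX); rewrite (ltW la).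
by move/gitv_gdom/(gdomP TX); rewrite ltxx andbF.
Qed.

Definition letter_mass (F : R -> R) : 'rV[R]_d.+1 := \row_a (F (rgt T a) - F (lft T a)).

Lemma letter_mass_gt0 F a : conformal F -> 0 < letter_mass F 0 a.
Proof.
move=> [Fmono _]; have lr := lft_rgt TX a; rewrite mxE subr_gt0; apply: Fmono => //.
- by have /andP[] := @letter_bounds a (lft T a) ltac:(by rewrite lexx ltW).
- by have /andP[] := @letter_bounds a (rgt T a) ltac:(by rewrite lexx ltW).
Qed.

(** For [s = 1] this is the self-similarity matrix. In general a floor counts with the factor by
    which its mass exceeds that of the base. *)
Definition weight_mx : 'M[R]_d.+1 :=
  \matrix_(a, b) \sum_(i < height T n a | flr a i == b) \prod_(k < i) s (flr a k).

Lemma mul_weight_mx (v : 'rV[R]_d.+1) b :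
  (v *m weight_mx) 0 b = \sum_(u | base u == b) floor_weight u * v 0 (tag u).
Proof.
rewrite mxE; under eq_bigr do rewrite mxE mulr_sumr.
rewrite (sig_big_dep xpredT (fun a (i : 'I_(height T n a)) => flr a i == b)
  (fun a i => v 0 a * \prod_(k < i) s (flr a k))) /=.
by apply: eq_bigr => u _; rewrite mulrC.
Qed.

(** Each letter is partitioned into the floors it contains, which are translates of contracted
    letters. *)
Lemma letter_massE F : conformal F ->
  letter_mass F = letter_mass (fun x => F (x / rho)) *m weight_mx.
Proof.
move=> FC; apply/rowP => b; rewrite mul_weight_mx mxE.
pose lo (u : floors) := lft T (tag u) / rho + shift (tag u) (floor_index u).
pose hi (u : floors) := rgt T (tag u) / rho + shift (tag u) (floor_index u).
have lohi u x : lo u <= x < hi u <->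
    gitv T (tag u) (rho * (x - shift (tag u) (floor_index u))).
  rewrite (gitvP TX) /lo /hi -lerBrDr -ltrBlDr.
  by rewrite ler_pdivrMr // ltr_pdivlMr // ![_ * rho]mulrC.
have xK u x : x = rho * (x - shift (tag u) (floor_index u)) / rho + shift (tag u) (floor_index u).
  by field; exact: lt0r_neq0.
rewrite (@interval_partition_sum _ floors F lo hi [set u | base u == b]%SET).
- rewrite big_mkcond /= [RHS]big_mkcond /=; apply: eq_bigr => u _.
  rewrite inE; case: ifP => // _; rewrite mxE /floor_weight.
  have lr := lft_rgt TX (tag u).
  by apply: (floor_increment FC (ltnW (ltn_ord (tagged u)))); rewrite ?lexx ?(ltW lr).
- by rewrite ltW // lft_rgt.
- by move=> u _; rewrite /lo /hi ltrD2r ltr_pM2r ?invr_gt0 // lft_rgt.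
- move=> x; split => [/(gitvP TX) bx|[u]].
    have [a [z [i [az ia ib xE]]]] := floor_cover TX TT SS bx.
    exists (Tagged (fun a => 'I_(height T n a)) (Ordinal ia) : floors).
      by rewrite inE /base /floor_index /= ib.
    apply/lohi => /=; rewrite xE /floor_index /= addrK mulrC divfK //.
    exact: lt0r_neq0.
  rewrite inE => /eqP <- /lohi ux; apply/(gitvP TX); rewrite (xK u x).
  exact: (floor_mem TX TT SS ux (ltn_ord _)).
- move=> u v x _ _ /lohi ux /lohi vx; apply: floor_symbol_inj.
  have [|tE iE] := floor_disjoint TX TT SS ux vx (ltn_ord (tagged u)) (ltn_ord (tagged v)).
    by rewrite -!xK.
  exact: (f_equal2 pair tE iE).
Qed.

(** Entrywise the matrix is at least a positive multiple of the self-similarity matrix, so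
    primitivity carries over. *)
Lemma weight_mx_pos : exists p, forall a b, 0 < (weight_mx ^+ p) a b.
Proof.
have [p _ Mp] := prim; exists p => a b.
have [c c0 cP] := min_positive_value floor_weight.
have w0 e f : 0 <= weight_mx e f.
  by rewrite mxE; apply: sumr_ge0 => i _; apply: prodr_ge0 => k _; exact: ltW.
have cw e f : c * selfsim_matrix T n e f <= weight_mx e f.
  rewrite !mxE -sum1_card natr_sum mulr_sumr.
  rewrite (eq_bigl (fun i : 'I__ => flr e i == f)); last by move=> i; rewrite inE.
  apply: ler_sum => i _; rewrite mulr1.
  pose u : floors := Tagged (fun a => 'I_(height T n a)) i.
  exact: (cP u (floor_weight_gt0 u)).
have M0 e f : 0 <= selfsim_matrix T n e f by rewrite mxE ler0n.
have Mk0 k e f : 0 <= (selfsim_matrix T n ^+ k) e f.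
  elim: k e f => [|k IHk] e f; first by rewrite expr0 mxE ler0n.
  by rewrite exprS mxE; apply: sumr_ge0 => i _; rewrite mulr_ge0.
suff cwk k e f : c ^+ k * (selfsim_matrix T n ^+ k) e f <= (weight_mx ^+ k) e f.
  by apply: lt_le_trans (cwk p a b); rewrite mulr_gt0 ?exprn_gt0.
elim: k e f => [|k IHk] e f; first by rewrite !expr0 mul1r.
rewrite !exprS ![in _ _ _]mxE mulr_sumr; apply: ler_sum => i _.
by rewrite mulrACA ler_pM // ?mulr_ge0 ?exprn_ge0 ?(ltW c0).
Qed.

(** The masses of the successive dilations form a backward orbit of [weight_mx], so consecutive ones
    are proportional by contraction. *)
Lemma conformal_rate F : conformal F -> exists2 r, 0 < r &
  letter_mass F *m weight_mx = r *: letter_mass F /\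
  forall k, letter_mass (fun x => F (x / rho ^+ k)) = r ^- k *: letter_mass F.
Proof.
move=> FC; pose v k := letter_mass (fun x => F (x / rho ^+ k)).
have vC k : conformal (fun x => F (x / rho ^+ k)).
  elim: k => [|k IHk]; first by rewrite expr0; under eq_fun do rewrite divr1.
  have := conformal_dilation IHk; congr conformal; apply/funext => x.
  by rewrite exprS invfM mulrA.
have v0 k b : 0 < v k 0 b by exact: letter_mass_gt0.
have vN k : v k = v k.+1 *m weight_mx.
  rewrite /v (letter_massE (vC k)); congr (letter_mass _ *m _); apply/funext => x.
  by rewrite exprS invfM mulrA.
have w0 a b : 0 <= weight_mx a b.
  by rewrite mxE; apply: sumr_ge0 => i _; apply: prodr_ge0 => k _; exact: ltW.
have [p Np] := weight_mx_pos.
have prop k : exists2 c, 0 < c & v k.+1 = c *: v k.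
  by apply: (@eventually_proportional _ _ _ (fun j => v (j + k)%N) _ w0 Np).
have [c c0 v1] := prop 0%N.
have Fv : letter_mass F = v 0%N.
  by rewrite /v; congr letter_mass; apply/funext => x; rewrite expr0 divr1.
have vw : v 0%N *m weight_mx = c^-1 *: v 0%N.
  by rewrite [in RHS]vN v1 -scalemxAl scalerA mulVf ?scale1r // gt_eqF.
exists c^-1; rewrite ?invr_gt0 // Fv; split => // k.
rewrite exprVn invrK; elim: k => [|k IHk]; first by rewrite expr0 scale1r.
(* All these vectors lie on one ray, which forces the ratio [ck] to be the same inverse eigenvalue
   at every step. *)
have [ck _ vk] := prop k; have := vN k.
rewrite -/(v k.+1) vk -/(v k) in IHk *; rewrite IHk.
rewrite -!scalemxAl vw !scalerA => /rowP/(_ ord0).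
have := v0 0%N ord0; rewrite !mxE => nz.
move/(mulIf (lt0r_neq0 nz)) => E; congr (_ *: _); rewrite exprS.
by rewrite {2}E; field; exact: lt0r_neq0.
Qed.

(* Following a walk of length [k], the letter at its end is contracted by
   [rho ^+ k] into a piece of level [k] of the letter at its start. *)
Fixpoint walk_map (p : seq floors) (x : R) : R :=
  if p is w :: p' then walk_map p' x / rho + shift (tag w) (floor_index w) else x.

Lemma walk_map_mono p x y : x < y -> walk_map p x < walk_map p y.
Proof. by move=> xy; elim: p => //= w p IHp; rewrite ltrD2r ltr_pM2r ?invr_gt0. Qed.

Lemma walk_map_surj p x : exists z, walk_map p z = x.
Proof.
elim: p x => [|w p IHp] x /=; first by exists x.
have [z zE] := IHp (rho * (x - shift (tag w) (floor_index w))).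
by exists z; rewrite zE; field; exact: lt0r_neq0.
Qed.

Lemma walk_map_closed u p x : path floor_edge u p ->
  lft T (tag (last u p)) <= x <= rgt T (tag (last u p)) ->
  lft T (tag u) <= walk_map p x <= rgt T (tag u).
Proof.
elim: p u => //= w p IHp u /andP[/eqP <- wp] px.
exact: (closed_floor (ltn_ord (tagged w)) (IHp w wp px)).
Qed.

Lemma walk_map_gitv u p x : path floor_edge u p ->
  gitv T (tag (last u p)) x -> gitv T (tag u) (walk_map p x).
Proof.
elim: p u => //= w p IHp u /andP[/eqP <- wp] px.
exact: (floor_mem TX TT SS (IHp w wp px) (ltn_ord (tagged w))).
Qed.

Lemma walk_map_cover k u x : gitv T (tag u) x -> exists p, [/\ size p = k,
  path floor_edge u p & exists2 z, gitv T (tag (last u p)) z & x = walk_map p z].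
Proof.
elim: k u x => [|k IHk] u x ux; first by exists [::]; split => //; exists x.
have [a [z [i [az ia ib xE]]]] := floor_cover TX TT SS ux.
pose w : floors := Tagged (fun a => 'I_(height T n a)) (Ordinal ia).
have [p [pk wp [y yp zE]]] := IHk w z az.
exists (w :: p); split; rewrite /= ?pk ?wp ?andbT //.
  by rewrite /floor_edge /base /floor_index /= ib.
by exists y => //; rewrite xE zE.
Qed.

Lemma walk_map_disjoint u p q x y : size p = size q ->
  path floor_edge u p -> path floor_edge u q ->
  gitv T (tag (last u p)) x -> gitv T (tag (last u q)) y ->
  walk_map p x = walk_map q y -> p = q.
Proof.
elim: p q u => [|w p IHp] [|w' q] u //= [pq] /andP[_ wp] /andP[_ wq] px qy E.
have pz := walk_map_gitv wp px; have qz := walk_map_gitv wq qy.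
have [tE iE] := floor_disjoint TX TT SS pz qz (ltn_ord (tagged w)) (ltn_ord (tagged w')) E.
have ww : w = w' by apply: floor_symbol_inj; exact: (f_equal2 pair tE iE).
congr cons => //; subst w'; apply: (IHp q w) => //.
move: E => /addIr /(mulIf _); apply; rewrite invr_eq0; exact: lt0r_neq0.
Qed.

Definition walk_factor (p : seq floors) : R := \prod_(w <- p) floor_weight w.

Lemma walk_increment F u p : conformal F -> path floor_edge u p ->
  forall x y, let e := tag (last u p) in
  lft T e <= x <= rgt T e -> lft T e <= y <= rgt T e ->
  F (walk_map p y) - F (walk_map p x) =
  walk_factor p * (F (y / rho ^+ size p) - F (x / rho ^+ size p)).
Proof.
elim: p u F => [|w p IHp] u F FC /=.
  by move=> _ x y _ _; rewrite /walk_factor big_nil mul1r expr0 !divr1.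
move=> /andP[_ wp] x y px py.
rewrite (floor_increment FC (ltnW (ltn_ord (tagged w)))); try exact: walk_map_closed wp _.
have /= -> := IHp w (fun x => F (x / rho)) (conformal_dilation FC) wp x y px py.
by rewrite /walk_factor big_cons mulrA !exprS !invfM !mulrA ![_ / rho / _]mulrAC.
Qed.

Lemma walk_mass F r u p : conformal F -> 0 < r ->
  (forall k, letter_mass (fun x => F (x / rho ^+ k)) = r ^- k *: letter_mass F) ->
  path floor_edge u p -> let e := tag (last u p) in
  F (walk_map p (rgt T e)) - F (walk_map p (lft T e)) =
  walk_factor p / r ^+ size p * letter_mass F 0 e.
Proof.
move=> FC r0 Fr up /=; have lr := lft_rgt TX (tag (last u p)).
rewrite (walk_increment FC up); rewrite ?lexx ?(ltW lr) //.
have /rowP/(_ (tag (last u p))) := Fr (size p).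
by rewrite [in LHS]mxE => ->; rewrite mxE mulrA.
Qed.

(** The successors of [u] are the floors contained in its letter, so the column of [weight_mx] at
    [tag u] is the sum over the edges from [u]. *)
Lemma floor_eigenvector F r : letter_mass F *m weight_mx = r *: letter_mass F ->
  forall u, transfer (fun u v => adjacency floor_edge u v * floor_weight v)
    (fun u => letter_mass F 0 (tag u)) u = r * letter_mass F 0 (tag u).
Proof.
move=> Fr u; have /rowP/(_ (tag u)) := Fr.
have -> : (r *: letter_mass F) 0 (tag u) = r * letter_mass F 0 (tag u) by rewrite [LHS]mxE.
rewrite mul_weight_mx => <-.
rewrite /transfer [RHS]big_mkcond /=; apply: eq_bigr => v _.
by rewrite /adjacency /floor_edge; case: eqP => _; rewrite ?mul1r ?mul0r.
Qed.

End Weights.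

End Conformal.

(** * Hoelder exponents *)

Section PieceHoelder.
Context {R : realType} {d : nat}.
Variables (T : giet R d) (n : nat).
Hypotheses (TX : is_exchange T) (TT : translation_branches T) (SS : self_similar T n).
Hypothesis prim : primitive_mx (selfsim_matrix T n).
Local Notation l := (glength T).
Local Notation wm := (@walk_map R d T n).
Local Notation edge := (@floor_edge R d T n).
Implicit Types (u : floors T n) (p : seq (floors T n)).

Definition piece_mass (F : R -> R) u p : R :=
  F (wm p (rgt T (tag (last u p)))) - F (wm p (lft T (tag (last u p)))).

(** Comparing increments of [B] with those of [A] measures the regularity of [B] composed with the
    inverse of [A]; later one of them is the identity and the other the inverse conjugacy. *)
Variables (A B : R -> R) (q e c C : R).
Hypotheses (Amono : forall x y, 0 <= x -> x < y -> y <= l -> A x < A y)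
  (Bmono : forall x y, 0 <= x -> x < y -> y <= l -> B x < B y).
Hypotheses (q1 : 1 < q) (e0 : 0 <= e) (c0 : 0 < c) (C0 : 0 < C).

Let q0 : 0 < q. Proof. exact: lt_trans q1. Qed.

Let Ale x y : 0 <= x -> x <= y -> y <= l -> A x <= A y.
Proof. by move=> x0; rewrite le_eqVlt => /orP[/eqP ->//|xy yl]; rewrite ltW // Amono. Qed.

Let Ble x y : 0 <= x -> x <= y -> y <= l -> B x <= B y.
Proof. by move=> x0; rewrite le_eqVlt => /orP[/eqP ->//|xy yl]; rewrite ltW // Bmono. Qed.

Let piece_bounds u p : path edge u p ->
  0 <= wm p (lft T (tag (last u p))) /\ wm p (rgt T (tag (last u p))) <= l.
Proof.
move=> up; have lr := lft_rgt TX (tag (last u p)).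
have /(letter_bounds TX)/andP[l0 _] := @walk_map_closed _ _ _ _ TX TT SS u p _ up
  (introT andP (conj (lexx _) (ltW lr))).
have /(letter_bounds TX)/andP[_ rl] := @walk_map_closed _ _ _ _ TX TT SS u p _ up
  (introT andP (conj (ltW lr) (lexx _))).
by split.
Qed.

Let ground a : floors T n :=
  Tagged (fun a => 'I_(height T n a)) (Ordinal (height_gt0 TX TT SS a)).

Let piece_at k x : 0 <= x < l -> exists a p, let u := ground a in
  [/\ size p = k, path edge u p,
  wm p (lft T (tag (last u p))) <= x < wm p (rgt T (tag (last u p))) & gitv T a x].
Proof.
move=> /(gdomP TX)[a _ ax].
have [p [pk up [z pz xE]]] := @walk_map_cover _ _ _ _ TX TT SS k (ground a) x ax.
exists a, p; split => //; move/(gitvP TX): (pz) => /andP[lz zr]; rewrite xE.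
rewrite (walk_map_mono TX TT SS) // andbT.
move: lz; rewrite le_eqVlt => /orP[/eqP <-|lz]; first by rewrite lexx.
by rewrite ltW // (walk_map_mono TX TT SS).
Qed.

Let piece_unique k a p a' p' x : size p = k -> size p' = k ->
  path edge (ground a) p -> path edge (ground a') p' ->
  let e := tag (last (ground a) p) in let e' := tag (last (ground a') p') in
  wm p (lft T e) <= x < wm p (rgt T e) -> wm p' (lft T e') <= x < wm p' (rgt T e') ->
  a = a' /\ p = p'.
Proof.
move=> pk pk' up up' /= px px'.
have preim u r : path edge u r ->
    wm r (lft T (tag (last u r))) <= x < wm r (rgt T (tag (last u r))) ->
    exists2 z, gitv T (tag (last u r)) z & x = wm r z.
  move=> ur rx; have [z xE] := @walk_map_surj _ _ _ _ TX TT SS r x.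
  exists z => //; apply/(gitvP TX); move: rx; rewrite -xE => /andP[lz zr].
  rewrite leNgt; apply/andP; split.
    by apply: contraTN lz => zl; rewrite -ltNge (walk_map_mono TX TT SS).
  rewrite ltNge; apply: contraTN zr; rewrite -leNgt le_eqVlt => /orP[/eqP ->//|rz].
  by rewrite ltW // (walk_map_mono TX TT SS).
have [z pz xE] := preim _ _ up px; have [z' pz' xE'] := preim _ _ up' px'.
have ax := @walk_map_gitv _ _ _ _ TX TT SS _ _ _ up pz.
have ax' := @walk_map_gitv _ _ _ _ TX TT SS _ _ _ up' pz'.
have aa : a = a' by apply: (gitv_inj TX ax); rewrite -xE xE'.
split => //; subst a'; apply: (@walk_map_disjoint _ _ _ _ TX TT SS (ground a) p p' z z') => //.
  by rewrite pk pk'.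
by rewrite -xE xE'.
Qed.

(** An increment of [A] below that of every level-[k] piece leaves no room for a whole piece, so the
    points from [x] to [y] meet at most two neighbouring ones. *)
Lemma two_pieces k x y m M : 0 <= x -> x < y -> y < l -> 0 <= M ->
  (forall u p, size p = k -> path edge u p -> m <= piece_mass A u p) ->
  (forall u p, size p = k -> path edge u p -> piece_mass B u p <= M) ->
  A y - A x < m -> B y - B x <= M *+ 2.
Proof.
move=> x0 xy yl M0 mA MB Axy.
have [a [p [pk up px _]]] : exists a p, let u := ground a in
  [/\ size p = k, path edge u p,
  wm p (lft T (tag (last u p))) <= x < wm p (rgt T (tag (last u p))) & gitv T a x].
  by apply: piece_at; rewrite x0 (lt_trans xy).
have [lo0 hil] := piece_bounds up; have MBp := MB _ _ pk up.
set lo := wm p (lft T _) in px lo0 MBp *; set hi := wm p (rgt T _) in px hil MBp *.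
have /andP[lox xhi] := px.
have Bx : B hi - B x <= M.
  by apply: le_trans MBp; rewrite /piece_mass -/lo -/hi lerD2l lerN2 Ble // ltW // (lt_trans xy).
have [yhi|hiy] := leP y hi.
  by rewrite mulr2n; have := Ble (le_trans x0 (ltW xy)) yhi hil; lra.
have hi0 : 0 <= hi by rewrite (le_trans x0) ?ltW.
have [a' [p' [pk' up' px' _]]] : exists a p, let u := ground a in
  [/\ size p = k, path edge u p,
  wm p (lft T (tag (last u p))) <= hi < wm p (rgt T (tag (last u p))) & gitv T a hi].
  by apply: piece_at; rewrite hi0 (lt_trans hiy).
have [lo0' hil'] := piece_bounds up'; have MBp' := MB _ _ pk' up'; have mAp' := mA _ _ pk' up'.
set lo' := wm p' (lft T _) in px' lo0' MBp' mAp' *.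
set hi' := wm p' (rgt T _) in px' hil' MBp' mAp' *.
have /andP[lohi' hihi'] := px'.
(* The piece containing the end of the first one begins there: starting earlier, it would overlap
   the first piece and so be equal to it. *)
have lo'E : lo' = hi.
  apply/eqP; rewrite eq_le lohi' leNgt; apply/negP => lo'hi.
  pose z := Num.max lo lo'.
  have lohi : lo < hi := le_lt_trans lox xhi.
  have zhi : z < hi by rewrite gt_max lohi.
  have [aa pp] : a = a' /\ p = p'.
    apply: (@piece_unique k a p a' p' z) => //=.
      by rewrite -/lo -/hi zhi le_max lexx.
    by rewrite -/lo' -/hi' le_max lexx orbT /= (lt_trans zhi).
  subst a' p'; by move: hihi'; rewrite /hi /hi' ltxx.
have yhi' : y < hi'.
  rewrite ltNge; apply/negP => hi'y.
  have h1 := Ale (le_trans hi0 (ltW hihi')) hi'y (ltW yl).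
  have h2 := Ale x0 (ltW xhi) hil.
  by move: mAp'; rewrite /piece_mass -/lo' -/hi' lo'E; lra.
have h1 := Ble (le_trans hi0 (ltW hiy)) (ltW yhi') hil'.
by move: MBp'; rewrite /piece_mass -/lo' -/hi' lo'E mulr2n; lra.
Qed.

Section Attained.
Hypothesis lowA : forall u p, path edge u p -> c / q ^+ size p <= piece_mass A u p.
Hypothesis upB : forall u p, path edge u p ->
  piece_mass B u p <= C * (q ^- size p) `^ e.

Lemma hoelder_attained : exists D, forall x y, 0 <= x -> x < y -> y < l ->
  B y - B x <= D * (A y - A x) `^ e.
Proof.
have BL x y : 0 <= x -> x < y -> y < l -> B y - B x <= B l - B 0.
  move=> x0 xy yl; have := Ble (le_trans x0 (ltW xy)) (ltW yl) (lexx _).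
  by have := Ble (lexx 0) x0 (ltW (lt_trans xy yl)); lra.
have l0 : 0 < l := glength_gt0 TX.
have B0l : 0 < B l - B 0 by rewrite subr_gt0 Bmono.
pose D1 := (B l - B 0) / c `^ e; pose D2 := C *+ 2 * (q / c) `^ e.
have ce : 0 < c `^ e by exact: powR_gt0.
exists (Num.max D1 D2) => x y x0 xy yl.
have del : 0 < A y - A x by rewrite subr_gt0 Amono // ltW.
set dl := A y - A x in del *; have dle : 0 < dl `^ e by exact: powR_gt0.
(* Large increments of [A] are covered by the total increment of [B]; smaller ones by the last level
   [k] at which [c / q ^+ k] still exceeds [dl]. *)
have [cdl|dlc] := leP c dl.
  apply: (@le_trans _ _ (D1 * dl `^ e)); last by rewrite ler_wpM2r ?(ltW dle) // le_max lexx.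
  apply: (le_trans (BL x y x0 xy yl)); rewrite /D1 mulrAC -mulrA ler_peMr ?(ltW B0l) //.
  rewrite ler_pdivlMr // mul1r; apply: ge0_ler_powR => //; rewrite ?nnegrE ?(ltW c0) ?(ltW del) //.
apply: (@le_trans _ _ (D2 * dl `^ e)); last by rewrite ler_wpM2r ?(ltW dle) // le_max lexx orbT.
have [j0 j0P] := small_geometric c q1 del.
have exj : exists j, c / q ^+ j <= dl by exists j0; exact: ltW.
have [j jle jmin] := ex_minnP exj.
have j1 : (0 < j)%N by case: j jle {jmin} => //; rewrite expr0 divr1 leNgt dlc.
have small : dl < c / q ^+ j.-1.
  by rewrite ltNge; apply/negP => /jmin; rewrite leqNgt prednK // leqnn.
apply: (le_trans (@two_pieces j.-1 x y (c / q ^+ j.-1) (C * (q ^- j.-1) `^ e) x0 xy yl _ _ _ small)).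
- by rewrite mulr_ge0 ?(ltW C0) // powR_ge0.
- by move=> u p <-; exact: lowA.
- by move=> u p <-; exact: upB.
rewrite /D2 -mulrnAl -mulrA ler_wpM2l ?mulrn_wge0 ?(ltW C0) //.
rewrite -powRM ?divr_ge0 ?(ltW q0) ?(ltW c0) ?(ltW del) //.
apply: ge0_ler_powR; rewrite ?nnegrE ?e0 ?invr_ge0 ?exprn_ge0 ?(ltW q0) //.
  by rewrite mulr_ge0 ?(ltW del) // divr_ge0 ?(ltW q0) ?(ltW c0).
rewrite -(prednK j1) exprS in jle.
have -> : q ^- j.-1 = q / c * (c / (q * q ^+ j.-1)).
  by field; rewrite ?expf_neq0 ?lt0r_neq0.
by rewrite ler_wpM2l // divr_ge0 ?(ltW q0) ?(ltW c0).
Qed.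

End Attained.

Section Optimal.
Hypothesis sharp : forall k, exists u p, [/\ size p = k, path edge u p,
  piece_mass A u p <= C / q ^+ k & c * (q ^- k) `^ e <= piece_mass B u p].
Hypothesis Bl : forall eps, 0 < eps -> exists y, [/\ 0 <= y, y < l & B l - eps < B y].

(** On the sharp pieces a bound with [e' > e] would put [c] below a geometric sequence tending to
    0. *)
Lemma hoelder_optimal e' D : 0 <= e' ->
  (forall x y, 0 <= x -> x < y -> y < l -> B y - B x <= D * (A y - A x) `^ e') -> e' <= e.
Proof.
move=> e'0 hol; pose D' := Num.max D 0.
have D'0 : 0 <= D' by rewrite le_max lexx orbT.
have hol1 x y : 0 <= x -> x < y -> y < l -> B y - B x <= D' * (A y - A x) `^ e'.
  by move=> x0 xy yl; apply: (le_trans (hol x y x0 xy yl)); rewrite ler_wpM2r ?powR_ge0 // le_max lexx.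
(* A sharp piece may end at [l], outside the half-open domain; [Bl] extends the bound to this
   endpoint. *)
have hol2 x y : 0 <= x -> x < y -> y <= l -> B y - B x <= D' * (A y - A x) `^ e'.
  move=> x0 xy; rewrite le_eqVlt => /orP[/eqP yl|]; last exact: hol1.
  rewrite yl; rewrite yl in xy; apply/ler_addgt0Pr => eps eps0.
  have [z [z0 zl Bz]] := Bl eps0; pose w := Num.max z ((x + l) / 2).
  have wl : w < l by rewrite gt_max zl /=; lra.
  have xw : x < w by rewrite lt_max; apply/orP; right; lra.
  have Bzw : B z <= B w by rewrite Ble ?le_max ?lexx // ltW.
  have := hol1 x w x0 xw wl.
  have : D' * (A w - A x) `^ e' <= D' * (A l - A x) `^ e'.
    rewrite ler_wpM2l // ge0_ler_powR ?nnegrE ?subr_ge0 //.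
    - by rewrite Ale // ltW.
    - by rewrite Ale // ltW.
    - by rewrite lerD2r Ale ?(ltW wl) // (le_trans x0 (ltW xw)).
  by lra.
rewrite leNgt; apply/negP => ee'.
pose K := D' * C `^ e'; have K0 : 0 <= K by rewrite mulr_ge0 ?powR_ge0.
have key k : c <= K / (q `^ (e' - e)) ^+ k.
  have [u [p [pk up pA pB]]] := sharp k.
  have [lo0 hil] := piece_bounds up.
  have lohi : wm p (lft T (tag (last u p))) < wm p (rgt T (tag (last u p))).
    by rewrite (walk_map_mono TX TT SS) // lft_rgt.
  have h := hol2 _ _ lo0 lohi hil.
  have qk0 : 0 < q ^- k by rewrite invr_gt0 exprn_gt0.
  have h2 : c * (q ^- k) `^ e <= D' * (C * q ^- k) `^ e'.
    apply: (le_trans pB); apply: (le_trans h); rewrite ler_wpM2l // ge0_ler_powR ?nnegrE //.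
    - by rewrite subr_ge0 Ale // ltW.
    - by rewrite mulr_ge0 ?(ltW C0) ?ltW.
  rewrite powRM ?(ltW C0) ?(ltW qk0) // mulrA -/K in h2.
  have qe0 : 0 < (q ^- k) `^ e by exact: powR_gt0.
  rewrite -(ler_pM2r qe0); apply: (le_trans h2); rewrite -[leRHS]mulrA (ler_wpM2l K0) //.
  have -> : e' = e + (e' - e) by lra.
  rewrite powRD; last by rewrite (gt_eqF qk0) implybT.
  rewrite mulrC addrAC subrr add0r ler_wpM2r ?(ltW qe0) //.
  rewrite -!powR_mulrn ?powR_ge0 ?(ltW q0) // -powRN -[in leRHS]powRN -!powRrM.
  by rewrite le_eqVlt; apply/orP; left; apply/eqP; congr powR; ring.
have qe1 : 1 < q `^ (e' - e).
  by rewrite /powR gt_eqF // expR_gt1 mulr_gt0 ?subr_gt0 // ln_gt0.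
have [k] := small_geometric K qe1 c0; by rewrite ltNge key.
Qed.

End Optimal.

End PieceHoelder.

(** * From estimates of increments to the Hoelder exponent *)

Section HoelderExponent.
Context {R : realType}.
Variable l : R.
Hypothesis l0 : 0 < l.
Local Notation J := (`[0, l[%classic : set R).
Implicit Types f g : R -> R.

Let JP x : J x <-> 0 <= x < l.
Proof. by rewrite /= in_itv. Qed.

Lemma derivative_onP f f1 z eps : derivative_on J f f1 -> J z -> 0 < eps ->
  exists2 r, 0 < r & forall w, `|z - w| < r -> w != z -> J w ->
    `|f1 z - (f w - f z) / (w - z)| <= eps.
Proof.
move=> fd Jz eps0; have /cvgrPdist_le/(_ eps eps0) := fd z Jz.
by move=> /nbhs_ballP[r r0 rP]; exists r.
Qed.

(** Derivatives relative to [J] are two-sided between [x] and [y] and give continuity at both ends,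
    as the mean value theorem requires. *)
Lemma derivative_on_lipschitz f f1 M : derivative_on J f f1 ->
  (forall x, J x -> `|f1 x| <= M) ->
  forall x y, J x -> J y -> `|f x - f y| <= M * `|x - y|.
Proof.
move=> fd fM.
suff mvt x y : J x -> J y -> x < y -> `|f x - f y| <= M * `|x - y|.
  move=> x y Jx Jy; have [xy|yx|->] := ltgtP x y; first exact: mvt.
    by rewrite distrC [`|x - y|]distrC; exact: mvt.
  by rewrite !subrr normr0 mulr0.
move=> Jx Jy xy.
have Jxy z : z \in `[x, y] -> J z.
  rewrite in_itv /= => /andP[xz zy]; apply/JP.
  move/JP: Jx => /andP[x0 _]; move/JP: Jy => /andP[_ yl].
  by rewrite (le_trans x0) // (le_lt_trans zy).
have [z||c cxy E] := @MVT_segment R f f1 x y (ltW xy).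
- move=> zxy; have Jz : J z by apply: Jxy; exact: subset_itv_oo_cc.
  suff quot : h^-1 *: ((f \o shift z) (h *: 1) - f z) @[h --> (0 : R)^'] --> f1 z.
    by apply: DeriveDef; [apply/cvg_ex; exists (f1 z)|exact: cvg_lim quot].
  apply/cvgrPdist_le => eps eps0; have [r r0 rP] := derivative_onP fd Jz eps0.
  move: zxy; rewrite in_itv /= => /andP[xz zy].
  pose r' := Num.min r (Num.min (z - x) (y - z)).
  have r'0 : 0 < r' by rewrite !lt_min r0 !subr_gt0 xz zy.
  apply/nbhs_ballP; exists r' => // h /=; rewrite /ball /= sub0r normrN => hr h0.
  have {hr} [hr hx hy] : [/\ `|h| < r, `|h| < z - x & `|h| < y - z].
    by move: hr; rewrite !lt_min => /and3P[].
  have := rP (h + z); rewrite opprD addrCA subrr addr0 normrN => /(_ hr).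
  rewrite -subr_eq0 addrK => /(_ h0).
  have Jhz : J (h + z).
    apply: Jxy; rewrite in_itv /=.
    move: hx hy; rewrite !ltr_norml => /andP[? ?] /andP[? ?]; lra.
  by move/(_ Jhz); rewrite /= [h%:A]mulr1 mulrC.
- apply/subspace_continuousP => z; move=> /Jxy Jz; apply/cvgrPdist_le => eps eps0.
  have [r r0 rP] := derivative_onP fd Jz ltr01.
  pose K := `|f1 z| + 1; have K0 : 0 < K by rewrite ltr_wpDl.
  pose r' := Num.min r (eps / K).
  have r'0 : 0 < r' by rewrite lt_min r0 divr_gt0.
  apply/nbhs_ballP; exists r' => // w; rewrite /ball /= => wr /Jxy Jw.
  have [->|wz] := eqVneq w z; first by rewrite subrr normr0 ltW.
  move: wr; rewrite lt_min => /andP[wr wK]; have := rP w wr wz Jw.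
  set q := (f w - f z) / (w - z) => qP.
  have -> : f z - f w = q * (z - w).
    by rewrite /q -(opprB w z) mulrN divfK ?subr_eq0 // opprB.
  rewrite normrM; apply: (@le_trans _ _ (K * `|z - w|)).
    rewrite ler_wpM2r //; have := ler_normD (q - f1 z) (f1 z).
    by rewrite subrK distrC /K; lra.
  by rewrite mulrC -ler_pdivlMr // ltW.
- rewrite distrC E normrM [`|x - y|]distrC ler_wpM2r //.
  by apply: fM; exact: Jxy.
Qed.

Lemma lipschitz_bounded f M : (forall x y, J x -> J y -> `|f x - f y| <= M * `|x - y|) ->
  exists B, forall x, J x -> `|f x| <= B.
Proof.
move=> fM; have J0 : J 0 by apply/JP; rewrite lexx l0.
exists (`|f 0| + `|M| * l) => x Jx.
have : `|f x - f 0| <= `|M| * l.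
  apply: (le_trans (fM x 0 Jx J0)); rewrite subr0.
  move/JP: (Jx) => /andP[x0 xl]; rewrite (ger0_norm x0).
  by rewrite (le_trans (ler_norm _)) // normrM (ger0_norm x0) ler_wpM2l // ltW.
by have := ler_normD (f x - f 0) (f 0); rewrite subrK; lra.
Qed.

Lemma iter_derivative_bounded k f g M : iter_derivative_on J k f g ->
  (forall x, J x -> `|g x| <= M) -> exists B, forall x, J x -> `|f x| <= B.
Proof.
elim: k f => [|k IHk] f /=.
  by move=> gf gM; exists M => x Jx; rewrite -gf ?inE //; exact: gM.
move=> [f1 fd /IHk{}IHk] /IHk[B f1B].
exact: lipschitz_bounded (derivative_on_lipschitz fd f1B).
Qed.

(** An admissible exponent of integer part at least 1 would come with a bounded derivative; [f]
    would be Lipschitz, and optimality would give [1 <= e]. *)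
Lemma hoelder_exponentE f e : 0 <= e < 1 -> hoelder_on J e f ->
  (forall e', 0 <= e' -> hoelder_on J e' f -> e' <= e) ->
  hoelder_exponent J f = e%:E.
Proof.
move=> /andP[e0 e1] fe eopt; apply/eqP; rewrite eq_le; apply/andP; split.
  apply: ge_ereal_sup => _ [e' [e'0 [g fg ge']] <-]; rewrite lee_fin.
  case: (Num.truncn e') (Num.Theory.truncn_itv e'0) fg ge' => [|k] /andP[te' _] /= fg ge'.
    apply: eopt => //; have [C CP] := ge'; exists C => x y Jx Jy.
    by rewrite -!fg ?inE // -[e' in X in _ <= X]subr0; exact: CP.
  have [C CP] := ge'.
  have J0 : J 0 by apply/JP; rewrite lexx l0.
  have [f1 fd f1g] := fg.
  have [x Jx|B f1B] := iter_derivative_bounded (M := `|g 0| + `|C| * l `^ (e' - k.+1%:R)) f1g.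
    have : `|g x - g 0| <= `|C| * l `^ (e' - k.+1%:R).
      apply: (le_trans (CP x 0 Jx J0)); rewrite subr0.
      move/JP: (Jx) => /andP[x0 xl]; rewrite (ger0_norm x0).
      apply: (@le_trans _ _ (`|C| * x `^ (e' - k.+1%:R))).
        by rewrite ler_wpM2r ?powR_ge0 // ler_norm.
      by rewrite ler_wpM2l // ge0_ler_powR ?nnegrE ?subr_ge0 ?(ltW xl) ?(ltW l0).
    by have := ler_normD (g x - g 0) (g 0); rewrite subrK; lra.
  have : 1 <= e.
    apply: eopt => //; exists B => x y Jx Jy; rewrite powRr1 //.
    exact: derivative_on_lipschitz fd f1B _ _ Jx Jy.
  by rewrite leNgt e1.
have t0 : Num.truncn e = 0%N by apply: Num.Theory.truncn_def; rewrite e0.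
apply: ereal_sup_ubound; exists e => //; split => //; exists f; first by rewrite t0.
by rewrite t0 subr0.
Qed.

End HoelderExponent.

(** * The conjugacy is conformal *)

Section Matching.
Context {R : realType} {d : nat}.
Variables (T : giet R d) (n : nat).
Hypotheses (TX : is_exchange T) (TT : translation_branches T) (SS : self_similar T n).
Hypothesis prim : primitive_mx (selfsim_matrix T n).
Variables (F : giet R d) (omega : 'cV[R]_d.+1) (h hinv : R -> R).
Hypotheses (FA : is_aiet F omega) (FT : gdom F = gdom T).
Hypotheses (rot : same_rotation_number F T) (conj : conjugacy F T h hinv).
Local Notation l := (glength T).

Let FX : is_exchange F. Proof. by case: FA. Qed.

Let hdom x : gdom T x -> gdom T (h x).
Proof.
have [[_ _ himg _] _ _ _ _] := conj.
by move=> xF; rewrite -himg; exists x => //; rewrite FT.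
Qed.

Let hinvdom y : gdom T y -> gdom T (hinv y).
Proof. by have [_ _ _ H _] := conj => /H; rewrite FT. Qed.

Let hK x : gdom T x -> hinv (h x) = x.
Proof. by have [_ _ H _ _] := conj => xF; apply: H; rewrite FT. Qed.

Let hinvK y : gdom T y -> h (hinv y) = y.
Proof. by have [_ _ _ _ H] := conj; exact: H. Qed.

Let hle x y : gdom T x -> gdom T y -> x <= y -> h x <= h y.
Proof. by have [[_ H _ _] _ _ _ _] := conj => xF yF; apply: H; rewrite FT. Qed.

Let hlt x y : gdom T x -> gdom T y -> x < y -> h x < h y.
Proof.
move=> xF yF xy; rewrite lt_neqAle hle ?(ltW xy) // andbT.
by apply/eqP => /(congr1 hinv); rewrite !hK // => E; rewrite E ltxx in xy.
Qed.

Let hinvlt x y : gdom T x -> gdom T y -> x < y -> hinv x < hinv y.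
Proof.
move=> xF yF xy; rewrite ltNge; apply/negP => /(hle (hinvdom yF) (hinvdom xF)).
by rewrite !hinvK // leNgt xy.
Qed.

Let hmap x : gdom T x -> h (gmap F x) = gmap T (h x).
Proof. by have [[_ _ _ H] _ _ _ _] := conj => xF; apply: H; rewrite FT. Qed.

Let zF : gdom T 0. Proof. by apply/(gdomP TX); rewrite lexx glength_gt0. Qed.

Let h0 : h 0 = 0.
Proof.
have /(gdomP TX)/andP[i0 _] := hinvdom zF.
apply/eqP; rewrite eq_le; apply/andP; split.
  by rewrite -[leRHS](hinvK zF); apply: hle => //; exact: hinvdom.
by have /(gdomP TX)/andP[] := hdom zF.
Qed.

Let iterF k : gdom T (iter k (gmap F) 0).
Proof. by elim: k => //= k; rewrite -FT; exact: gmap_gdom. Qed.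

Let h_iter k : h (iter k (gmap F) 0) = iter k (gmap T) 0.
Proof. by elim: k => [|k IHk] //=; rewrite (hmap (iterF k)) IHk. Qed.

(* The letters visited by the orbit of [0] are read off the return words. *)
Let itinerary k : exists b,
  gitv F b (iter k (gmap F) 0) /\ gitv T b (iter k (gmap T) 0).
Proof.
have [FR TR sameFT] := rot.
have [k1 k1P] := return_words_unbounded TX TT SS prim k TR.
have Tneq := translation_iter_RV TX TT (fun j (_ : (j < k1)%N) => TR j).
(* An affine map may be renormalizable with the same letter last in both rows; that this does not
   occur here is inherited from [T] through the rotation number. *)
have Fneq j : (j < k1)%N -> last_top (iter j RV F) != last_bot (iter j RV F).
  move=> /Tneq; have [tE bE _] := sameFT j.
  by rewrite /last_top /last_bot tE bE.
have [TX1 Tind _ _] := iter_RV TX (fun j _ => TR j) Tneq.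
have [FX1 Find _ _] := iter_RV FX (fun j _ => FR j) Fneq.
have [|a a1] := @position_surj d (gtop (iter k1 RV T)) 1 (exch_top TX1); first by lia.
have a1' : gtop (iter k1 RV F) a = 1%N by have [-> _ _] := sameFT k1.
have ka := k1P a a1; have [t0 _ _] := sameFT 0%N.
have wE := rv_words_eq t0 sameFT k1.
exists (nth a (rv_words T k1 a) k); split; last exact: (ind_letter Tind (gitv_first TX1 a1) ka).
by rewrite -wE; apply: (ind_letter Find (gitv_first FX1 a1')); rewrite wE.
Qed.

Let letter_orbit a y : gitv T a y -> zero_orbit T y -> gitv F a (hinv y).
Proof.
move=> ay [k yE]; have [b [Fb Tb]] := itinerary k.
rewrite yE in ay *; rewrite (gitv_inj TX ay Tb) -h_iter hK //.
Qed.

(** Let [b] be the letter of [F] at [hinv y]. As intervals are open on the right, some orbit point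
    of 0 just after [y] is still in letter [a] of [T] and has its preimage in letter [b] of [F];
    there [letter_orbit] gives [a = b]. *)
Let letter_match a y : gitv T a y -> gitv F a (hinv y).
Proof.
move=> ay; have yF := gitv_gdom ay.
have : gdom F (hinv y) by rewrite FT; exact: hinvdom.
case=> b _ bx; have /(gitvP FX)/andP[lx xr] := bx.
pose x2 := (hinv y + rgt F b) / 2.
have [xx2 x2r] : hinv y < x2 /\ x2 < rgt F b by rewrite /x2; split; lra.
have bx2 : gitv F b x2 by apply/(gitvP FX); rewrite x2r (le_trans lx) // ltW.
have x2F : gdom T x2 by rewrite -FT; exact: gitv_gdom bx2.
have yx2 : y < h x2 by rewrite -[y in y < _](hinvK yF); apply: hlt => //; exact: hinvdom.
have /(gitvP TX)/andP[ly yr] := ay.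
pose eta := Num.min (h x2 - y) (rgt T a - y) / 2.
have [e0 e1 e2] : [/\ 0 < eta, 2 * eta <= h x2 - y & 2 * eta <= rgt T a - y].
  rewrite /eta; split; last 2 first.
  - by rewrite mulrC divfK // ge_min lexx.
  - by rewrite mulrC divfK // ge_min lexx orbT.
  - by rewrite divr_gt0 // lt_min !subr_gt0 yx2.
have aye : gitv T a (y + eta) by apply/(gitvP TX); apply/andP; split; lra.
have [y' [ay' Oy' yy']] := zero_orbit_dense TX TT SS prim aye e0.
move: yy'; rewrite ltr_norml => /andP[yy1 yy2].
have y'F := gitv_gdom ay'.
have yy' : y < y' by lra.
have y'x2 : y' < h x2 by lra.
have hx1 : hinv y < hinv y' := hinvlt yF y'F yy'.
have hx2 : hinv y' < x2 by rewrite -[x2](hK x2F); apply: hinvlt => //; exact: hdom.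
have by' : gitv F b (hinv y') by apply/(gitvP FX); rewrite (le_trans lx (ltW hx1)) (lt_trans hx2).
by rewrite (gitv_inj FX (letter_orbit ay' Oy') by').
Qed.

(** The value at [l] gives a meaning to the increment over the letter ending at [l], and keeps the
    function left continuous there. *)
Definition extended_inverse (y : R) : R := if y < l then hinv y else l.
Local Notation ge := extended_inverse.

Let geE y : gdom T y -> ge y = hinv y.
Proof. by move=> /(gdomP TX)/andP[_ yl]; rewrite /ge yl. Qed.

Let ge_mono x y : 0 <= x -> x < y -> y <= l -> ge x < ge y.
Proof.
move=> x0 xy yl; have xl := lt_le_trans xy yl.
have xF : gdom T x by apply/(gdomP TX); rewrite x0.
rewrite geE //; move: yl; rewrite le_eqVlt => /orP[/eqP ->|yl].
  by rewrite /ge ltxx; have /(gdomP TX)/andP[] := hinvdom xF.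
have yF : gdom T y by apply/(gdomP TX); rewrite yl (le_trans x0 (ltW xy)).
by rewrite geE //; exact: hinvlt.
Qed.

(** An increasing function onto an interval has no jumps: [h] sends a level just below the value at
    [z] to a place before [z]. *)
Lemma extended_inverse_left z eps : 0 < z -> z <= l -> 0 < eps ->
  exists w0, [/\ 0 <= w0, w0 < z & forall w, w0 <= w -> w < l -> ge z - eps < ge w].
Proof.
move=> z0 zl eps0.
have gz0 : 0 < ge z.
  have /(gdomP TX)/andP[i0 _] := hinvdom zF.
  by have := ge_mono (lexx 0) z0 zl; rewrite geE //; lra.
have gzl : ge z <= l.
  move: zl; rewrite le_eqVlt => /orP[/eqP ->|zl]; first by rewrite /ge ltxx.
  have zF' : gdom T z by apply/(gdomP TX); rewrite zl ltW.
  by rewrite geE //; have /(gdomP TX)/andP[_ /ltW] := hinvdom zF'.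
pose v := Num.max 0 (ge z - eps / 2).
have vz : v < ge z by rewrite gt_max gz0 /=; lra.
have vF : gdom T v by apply/(gdomP TX); rewrite le_max lexx (lt_le_trans vz).
have /(gdomP TX)/andP[hv0 hvl] := hdom vF.
have hvz : h v < z.
  move: zl; rewrite le_eqVlt => /orP[/eqP ->//|zl].
  have zF' : gdom T z by apply/(gdomP TX); rewrite zl ltW.
  by rewrite -[ltRHS](hinvK zF') -geE //; apply: hlt => //; rewrite geE //; exact: hinvdom.
exists (h v); split => // w hvw wl.
apply: (@lt_le_trans _ _ v); first by rewrite lt_max; apply/orP; right; lra.
have wF : gdom T w by apply/(gdomP TX); rewrite wl (le_trans hv0).
move: hvw; rewrite le_eqVlt => /orP[/eqP E|hvw]; first by rewrite geE // -E hK.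
by rewrite geE // -[leLHS](hK vF) (ltW (hinvlt (hdom vF) wF hvw)).
Qed.

Lemma extended_inverse_conformal :
  conformal T (fun a => expR (omega a 0)) extended_inverse.
Proof.
split=> [|a]; first exact: ge_mono.
have [_ aff] := FA; have [c cP] := aff a; set s := expR _ in cP *.
have s0 : 0 < s by exact: expR_gt0.
have ge_affine y : gitv T a y -> ge (y + delta T a) = s * ge y + c.
  move=> ay; have yF := gitv_gdom ay.
  have TyF := gmap_gdom TX yF.
  rewrite -(gmap_delta TX TT ay) !geE // -(cP _ (letter_match ay)).
  have xF := hinvdom yF.
  rewrite -[in LHS](hinvK yF) -hmap // hK // -FT; apply: gmap_gdom => //.
  by rewrite FT.
have lr := lft_rgt TX a.
have /(letter_bounds TX)/andP[l0 _] : lft T a <= lft T a <= rgt T a by rewrite lexx ltW.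
have /(letter_bounds TX)/andP[r0 rl] : lft T a <= rgt T a <= rgt T a by rewrite lexx ltW.
have dF y : gitv T a y -> 0 <= y + delta T a < l.
  move=> ay; rewrite -(gmap_delta TX TT ay); apply/(gdomP TX)/(gmap_gdom TX).
  exact: gitv_gdom ay.
have dr : rgt T a + delta T a <= l.
  rewrite leNgt; apply/negP => dl.
  pose y := Num.max (lft T a) (l - delta T a).
  have ay : gitv T a y by apply/(gitvP TX); rewrite le_max lexx /= gt_max lr /=; lra.
  have /andP[_] := dF y ay; rewrite ltNge => /negP; apply.
  by rewrite -lerBlDr le_max lexx orbT.
have d0 : 0 < rgt T a + delta T a.
  by have /andP[] := dF _ (gitv_lft TX a); lra.
(* The affine relation is known on the half-open letter; left continuity at the right endpoint and
   at its translate carries it there, the two errors adding up to [e * (1 + s) = eps]. *)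
have ge_rgt : ge (rgt T a + delta T a) = s * ge (rgt T a) + c.
  apply/eqP; rewrite -subr_eq0 -normr_le0; apply/ler_addgt0Pr => eps eps0.
  rewrite add0r; pose e := eps / (1 + s).
  have e0 : 0 < e by rewrite divr_gt0 // addr_gt0.
  have rpos : 0 < rgt T a by lra.
  have [w1 [w10 w1r w1P]] := extended_inverse_left rpos rl e0.
  have [w2 [w20 w2r w2P]] := extended_inverse_left d0 dr e0.
  pose w := Num.max (lft T a) (Num.max w1 (w2 - delta T a)).
  have [wl ww1 ww2] : [/\ lft T a <= w, w1 <= w & w2 - delta T a <= w].
    by rewrite /w !le_max !lexx !orbT.
  have wr : w < rgt T a by rewrite !gt_max lr w1r /=; lra.
  have aw : gitv T a w by apply/(gitvP TX); rewrite wl.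
  have /andP[wd0 wdl] := dF w aw.
  have h1 := w1P w ww1 (lt_le_trans wr rl).
  have h2 : ge (rgt T a + delta T a) - e < ge (w + delta T a) by apply: w2P => //; lra.
  have h3 := ge_mono (le_trans w10 ww1) wr rl.
  have h4 : ge (w + delta T a) < ge (rgt T a + delta T a).
    by apply: ge_mono; rewrite ?ltrD2r.
  rewrite (ge_affine w aw) in h2 h4.
  have es : e * (1 + s) = eps by rewrite /e divfK // gt_eqF // addr_gt0.
  have h5 : s * (ge (rgt T a) - e) < s * ge w by rewrite ltr_pM2l.
  have h6 : s * ge w < s * ge (rgt T a) by rewrite ltr_pM2l.
  by rewrite ler_norml; apply/andP; split; nra.
have all y : lft T a <= y <= rgt T a -> ge (y + delta T a) = s * ge y + c.
  move=> /andP[ly]; rewrite le_eqVlt => /orP[/eqP ->//|yr].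
  by apply: ge_affine; apply/(gitvP TX); rewrite ly.
by move=> x y ax ay; rewrite !all //; ring.
Qed.

End Matching.

(** * Asymptotics of the pressure *)

Section Pressure.
Context {R : realType} {V : finType}.
Variables (e : rel V).
Implicit Types (w theta : V -> V -> R) (psi y : V -> R).

Definition exp_transfer theta : (V -> R) -> V -> R :=
  transfer (fun u v => adjacency e u v * expR (theta u v)).

Definition is_eigen theta (r : R) y : Prop :=
  (forall u, 0 < y u) /\ forall u, exp_transfer theta y u = r * y u.

Lemma gauge theta r y m psi : is_eigen theta r y ->
  is_eigen (fun u v => theta u v - m + psi u - psi v) (r * expR (- m))
    (fun u => expR (psi u) * y u).
Proof.
move=> [y0 yr]; split => u; first by rewrite mulr_gt0 ?expR_gt0.
have -> : r * expR (- m) * (expR (psi u) * y u) = expR (- m) * expR (psi u) * (r * y u).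
  by ring.
rewrite -yr /exp_transfer /transfer mulr_sumr; apply: eq_bigr => v _.
by rewrite !expRD !expRN; field; rewrite ?lt0r_neq0 ?expR_gt0.
Qed.

Hypothesis econ : forall u v, connect e u v.
Hypothesis nonempty : exists u v, e u v.

Lemma connected_cycle : exists c, [/\ c != [::], uniq c & cycle e c].
Proof.
have [u [v uv]] := nonempty; have /connectP[p vp up] := econ v u.
case/shortenP: vp up => p' vp' p'u _ uE.
by exists (v :: p'); split => //=; rewrite rcons_path vp' -uE.
Qed.

Lemma eigen_gt0 theta r y : is_eigen theta r y -> 0 < r.
Proof.
move=> [y0 yr]; have [u [v uv]] := nonempty.
rewrite -(pmulr_lgt0 _ (y0 u)) -yr /exp_transfer /transfer (bigD1 v) //=.
rewrite /adjacency uv mul1r ltr_pwDl //; first by rewrite mulr_gt0 ?expR_gt0.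
by apply: sumr_ge0 => z _; rewrite !mulr_ge0 ?ler0n ?expR_ge0 ?ltW.
Qed.

Lemma eigen_le theta theta' r r' y y' :
  is_eigen theta r y -> is_eigen theta' r' y' ->
  (forall u v, e u v -> theta u v <= theta' u v) ->
  r <= r' /\ (r = r' -> forall u v, e u v -> theta u v = theta' u v).
Proof.
move=> [y0 yr] [y0' yr'] le.
have [u0 [v0 _]] := nonempty.
have [||||rr eq] := @eigenvalue_comparison R V e
  (fun u v => adjacency e u v * expR (theta u v))
  (fun u v => adjacency e u v * expR (theta' u v)) y y' r r' econ _ _ _ y0 yr y0' yr'.
- move=> u v; rewrite /adjacency; case: (boolP (e u v)) => [uv|_].
    by rewrite !mul1r expR_ge0 ler_expR le.
  by rewrite !mul0r lexx.
- by move=> u v uv; rewrite /adjacency uv mul1r expR_gt0.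
- by move=> u v /negbTE uv; rewrite /adjacency uv mul0r.
- by exists u0.
split => // E u v uv; have := eq E u v; rewrite /adjacency uv !mul1r.
exact: expR_inj.
Qed.

Lemma subaction_walk w m psi u p :
  (forall u v, e u v -> w u v <= m + psi v - psi u) -> path e u p ->
  walk_weight w u p <= m * (size p)%:R + psi (last u p) - psi u.
Proof.
move=> sub; elim: p u => [|v p IHp] u /=; first by rewrite mulr0; lra.
move=> /andP[/sub uv /IHp vp]; rewrite -natr1 mulrDr mulr1; lra.
Qed.

Lemma coboundary_walk w m psi u p :
  (forall u v, e u v -> w u v = m + psi v - psi u) -> path e u p ->
  walk_weight w u p = m * (size p)%:R + psi (last u p) - psi u.
Proof.
move=> cob; elim: p u => [|v p IHp] u /=; first by rewrite mulr0; lra.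
move=> /andP[/cob uv /IHp vp]; rewrite -natr1 mulrDr mulr1; lra.
Qed.

End Pressure.

Section Extremal.
Context {R : realType} {V : finType}.
Variables (e : rel V) (w : V -> V -> R) (m : R).
Hypothesis mmax : maximal_cycle_mean e w m.
Local Notation E := (maximal_edge e w m).

Lemma maximal_edge_exists : exists u v, E u v.
Proof.
have [[c cm] _] := mmax; have [] := cm; case: c cm => // x c cm _ _ _ _.
by exists x, (next (x :: c) x); apply: maximal_edge_next cm (mem_head _ _).
Qed.

Lemma maximal_edge_succ u v : E u v -> exists z, E v z.
Proof.
move=> /asboolP[c [cm uc <-]]; exists (next c (next c u)).
by apply: maximal_edge_next cm _; rewrite mem_next.
Qed.

Lemma maximal_edge_pred u v : E u v -> exists z, E z u.
Proof.
move=> /asboolP[c [cm uc _]]; exists (prev c u).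
have [_ uc' _ _] := cm.
by rewrite -{2}(next_prev uc' u); apply: maximal_edge_next cm _; rewrite mem_prev.
Qed.

Lemma maximal_edge_recurrent : recurrent E.
Proof.
move=> u v /asboolP[c [cm uc <-]]; have [_ uc' _ _] := cm.
have vc : next c u \in c by rewrite mem_next.
have nextE x : x \in c -> connect E x (next c x).
  by move=> xc; apply/connect1/maximal_edge_next.
have iterE k : connect E (next c u) (iter k (next c) (next c u)).
  elim: k => //= k IHk; apply: (connect_trans IHk); apply: nextE.
  by elim: k {IHk} => //= k; rewrite mem_next.
have cyc : fcycle (next c) c by exact: cycle_next.
have : fconnect (next c) (next c u) u by rewrite (fconnect_cycle cyc vc).
by move=> uu; have := iterE (findex (next c) (next c u) u); rewrite iter_findex.
Qed.

Lemma maximal_walk k : exists u p, [/\ size p = k, path E u p & path e u p].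
Proof.
have [u [v uv]] := maximal_edge_exists.
have : exists p, size p = k /\ path E v p.
  elim: k u v uv => [|k IHk] u v uv; first by exists [::].
  have [z vz] := maximal_edge_succ uv; have [p [pk zp]] := IHk v z vz.
  by exists (z :: p); rewrite /= pk vz.
move=> [p [pk vp]]; exists v, p; split => //.
by apply: sub_path vp => x y; exact: maximal_edgeW.
Qed.

(* Conjugating by a strict subaction turns the weights into ones that equal 1 on
   the maximal edges and are exponentially small elsewhere. *)
Lemma pressure_asymptotics : exists h eta C, [/\ 0 <= h, 0 < eta,
  ln (\sum_u nb_walks_from E k u) / k%:R @[k --> \oo] --> (h : R) &
  forall t r y, 0 <= t -> is_eigen e (fun u v => t * w u v) r y ->
    0 <= ln r - t * m - h <= C * expR (- (eta * t))].
Proof.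
have [psi [kappa kappa0 psiP]] := strict_subaction mmax.
have [h [h0 [C C0 hC] hmin hlim]] :=
  @recurrent_growth R V E maximal_edge_recurrent maximal_edge_exists.
exists h, kappa, (#|V|%:R * C); split => // t r y t0 yr.
have [u0 [v0 uv0]] := maximal_edge_exists.
have nonempty : exists u v, e u v by exists u0, v0; exact: maximal_edgeW uv0.
have := gauge (t * m) (fun u => t * psi u) yr.
set theta := fun u v => _; set y' := fun u => _; set r' := r * _ => yr'.
have r0 := eigen_gt0 nonempty yr; have r0' := eigen_gt0 nonempty yr'.
have lnr' : ln r' = ln r - t * m by rewrite lnM ?posrE ?expR_gt0 // expRK.
have [y0' yE'] := yr'.
pose a u v := adjacency e u v * expR (theta u v).
have aP u v : adjacency E u v <= a u v <= adjacency E u v + expR (- (kappa * t)).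
  rewrite /a /adjacency; case: (boolP (E u v)) => Euv.
    rewrite (maximal_edgeW Euv) mul1r /theta.
    have := psiP u v (maximal_edgeW Euv); rewrite Euv => ->.
    have -> : t * (m + psi v - psi u) - t * m + t * psi u - t * psi v = 0 by ring.
    by rewrite expR0 lexx lerDl expR_ge0.
  case: (boolP (e u v)) => euv; last by rewrite mul0r lexx add0r expR_ge0.
  rewrite mul1r expR_ge0 add0r ler_expR /theta.
  by have := psiP u v euv; rewrite (negbTE Euv); nra.
rewrite -lnr' subr_ge0; apply/andP; split.
  apply: hmin => //; apply: (@nb_walks_eigen_le R V E a y' r') => // u v.
  by have /andP[] := aP u v.
have rle : r' <= expR h + expR (- (kappa * t)) * #|V|%:R * C.
  apply: (@eigenvalue_perturbation R V E h C C0 hC a y' r') => //.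
  by move=> u v; have /andP[+ ->] := aP u v; rewrite andbT; apply: le_trans; rewrite ler0n.
set x := expR (- _) * _ * _ in rle.
have x0 : 0 <= x by rewrite !mulr_ge0 ?expR_ge0 ?(ltW C0) ?ler0n.
have -> : #|V|%:R * C * expR (- (kappa * t)) = x by rewrite /x; ring.
(* As [h >= 0], [expR h + x <= expR h * (1 + x) <= expR (h + x)]. *)
rewrite lerBlDr; apply: (@le_trans _ _ (ln (expR h * expR x))).
  rewrite ler_ln ?posrE ?mulr_gt0 ?expR_gt0 //; apply: (le_trans rle).
  apply: (@le_trans _ _ (expR h * (1 + x))).
    by rewrite mulrDr mulr1 lerD2l ler_peMl // -expR0 ler_expR.
  by rewrite ler_wpM2l ?expR_ge0 // expR_ge1Dx.
by rewrite -expRD expRK addrC.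
Qed.

End Extremal.

(** One inequality is [nb_walks_eigen_le], the other is [eigenvalue_perturbation] with [eps = 0]. *)
Lemma entropy_eigen (R : realType) (V : finType) (e : rel V) r (y : V -> R) :
  (forall u v, connect e u v) -> (exists u v, e u v) -> is_eigen e (fun _ _ => 0) r y ->
  0 <= ln r /\ ln (\sum_u nb_walks_from e k u) / k%:R @[k --> \oo] --> (ln r : R).
Proof.
move=> econ nonempty yr; have r0 := eigen_gt0 nonempty yr.
have [y0 yE] := yr; have [u0 _] := nonempty.
have [h [h0 [C C0 hC] hmin hlim]] :=
  @recurrent_growth R V e (fun u v _ => econ v u) nonempty.
suff hE : h = ln r by rewrite -hE.
have aE : (fun u v => adjacency e u v * expR 0) = adjacency e :> (V -> V -> R).
  by apply/funext => u; apply/funext => v; rewrite expR0 mulr1.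
rewrite /exp_transfer aE in yE.
apply/eqP; rewrite eq_le; apply/andP; split.
  by apply: hmin => //; apply: (@nb_walks_eigen_le R V e _ y r) yE.
rewrite -[leRHS]expRK ler_ln ?posrE ?expR_gt0 //.
have -> : expR h = expR h + 0 * #|V|%:R * C by rewrite !mul0r addr0.
apply: (@eigenvalue_perturbation R V e h C C0 hC (adjacency e) y r 0) => //.
by move=> u v; rewrite addr0 lexx ler0n.
Qed.

(** * Exponents of the conjugacies *)

Lemma expr_expR (R : realType) (r : R) k : 0 < r -> r ^+ k = expR (ln r * k%:R).
Proof. by move=> r0; rewrite mulrC expRM_natl lnK. Qed.

Section PairExponent.
Context {R : realType} {d : nat}.
Variables (T : giet R d) (n : nat).
Hypotheses (TX : is_exchange T) (TT : translation_branches T) (SS : self_similar T n).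
Local Notation l := (glength T).
Local Notation edge := (@floor_edge R d T n).
Implicit Types (u : floors T n) (p : seq (floors T n)).
Variables (A B : R -> R) (w : floors T n -> floors T n -> R).
Variables (tA tB rA rB : R) (vA vB : floors T n -> R) (mu K : R).
Hypotheses (Amono : forall x y, 0 <= x -> x < y -> y <= l -> A x < A y)
  (Bmono : forall x y, 0 <= x -> x < y -> y <= l -> B x < B y).
Hypotheses (rA0 : 0 < rA) (rB0 : 0 < rB)
  (vA0 : forall u, 0 < vA u) (vB0 : forall u, 0 < vB u).
Hypotheses
  (massA : forall u p, path edge u p ->
    piece_mass A u p = expR (tA * walk_weight w u p) / rA ^+ size p * vA (last u p))
  (massB : forall u p, path edge u p ->
    piece_mass B u p = expR (tB * walk_weight w u p) / rB ^+ size p * vB (last u p)).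
Hypotheses
  (lowA : forall u p, path edge u p ->
    tA * (mu * (size p)%:R) - K <= tA * walk_weight w u p)
  (upB : forall u p, path edge u p ->
    tB * walk_weight w u p <= tB * (mu * (size p)%:R) + K)
  (sharp : forall k, exists u p, [/\ size p = k, path edge u p,
    tA * walk_weight w u p <= tA * (mu * k%:R) + K &
    tB * (mu * k%:R) - K <= tB * walk_weight w u p]).
Local Notation alphaA := (ln rA - tA * mu).
Local Notation alphaB := (ln rB - tB * mu).
Hypotheses (alphaB0 : 0 <= alphaB) (alphaAB : alphaB < alphaA).

Let alphaA0 : 0 < alphaA. Proof. exact: le_lt_trans alphaAB. Qed.
Let q : R := expR alphaA.
Let e : R := alphaB / alphaA.

Let q1 : 1 < q. Proof. by rewrite /q expR_gt1. Qed.

Let qk k : q ^- k = expR (- (alphaA * k%:R)).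
Proof. by rewrite expRN expr_expR ?expR_gt0 // expRK. Qed.

Let qke k : (q ^- k) `^ e = expR (- (alphaB * k%:R)).
Proof.
rewrite qk /powR gt_eqF ?expR_gt0 // expRK; congr expR.
by rewrite /e; field; exact: lt0r_neq0.
Qed.

Let massAE u p : path edge u p -> piece_mass A u p =
  expR (tA * walk_weight w u p - ln rA * (size p)%:R) * vA (last u p).
Proof. by move=> up; rewrite massA // expr_expR // expRD expRN. Qed.

Let massBE u p : path edge u p -> piece_mass B u p =
  expR (tB * walk_weight w u p - ln rB * (size p)%:R) * vB (last u p).
Proof. by move=> up; rewrite massB // expr_expR // expRD expRN. Qed.

Let bounds : exists c C, [/\ 0 < c, 0 < C & forall u,
  [/\ c <= vA u, c <= vB u, vA u <= C & vB u <= C]].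
Proof.
have [cA cA0 cAP] := min_positive_value vA; have [cB cB0 cBP] := min_positive_value vB.
exists (Num.min cA cB), (1 + \sum_u (vA u + vB u)); split.
- by rewrite lt_min cA0.
- by rewrite ltr_wpDr // sumr_ge0 // => u _; rewrite addr_ge0 ?ltW.
move=> u; have le : vA u + vB u <= 1 + \sum_u (vA u + vB u).
  rewrite (bigD1 u) //= addrCA lerDl addr_ge0 // sumr_ge0 // => v _.
  by rewrite addr_ge0 ?ltW.
split; rewrite ?ge_min ?cAP ?cBP ?orbT //; apply: le_trans le; rewrite ?lerDl ?lerDr ltW //.
Qed.

(** Up to constants, level-[k] pieces have [A]-mass at least e^(-alphaA k) and [B]-mass at most
    e^(-alphaB k), and some walk attains both. In use [mu] is the maximal mean when [A] is the
    identity, and the minimal one when [B] is. *)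
Lemma pair_exponent f : (forall y, 0 <= y < l -> f (A y) = B y) ->
  (forall y, 0 <= y < l -> 0 <= A y < l) ->
  (forall x, 0 <= x < l -> exists2 y, 0 <= y < l & A y = x) ->
  (forall eps, 0 < eps -> exists y, [/\ 0 <= y, y < l & B l - eps < B y]) ->
  hoelder_exponent (gdom T) f = (alphaB / alphaA)%:E.
Proof.
move=> fA Adom Asurj Bl; have [c [C [c0 C0 cC]]] := bounds.
have eK : 0 < expR K by exact: expR_gt0.
have cK : 0 < c * expR (- K) by rewrite mulr_gt0 ?expR_gt0.
have CK : 0 < C * expR K by rewrite mulr_gt0.
have e01 : 0 <= e < 1 by rewrite /e divr_ge0 ?(ltW alphaA0) //= ltr_pdivrMr // mul1r.
have /andP[e0 e1] := e01.
have AB x y : 0 <= x -> x < y -> y < l -> 0 < A y - A x /\ 0 < B y - B x.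
  by move=> x0 xy yl; rewrite !subr_gt0 Amono ?Bmono ?(ltW yl).
have [D DP] : exists D, forall x y, 0 <= x -> x < y -> y < l ->
    B y - B x <= D * (A y - A x) `^ e.
  apply: (hoelder_attained TX TT SS (q := q) (c := c * expR (- K)) (C := C * expR K)
    Amono Bmono) => // u p up.
    rewrite massAE // qk mulrAC [leRHS]mulrC -mulrA -expRD.
    have [cA _ _ _] := cC (last u p).
    rewrite ler_pM ?expR_ge0 ?(ltW c0) // ler_expR.
    by have := lowA up; lra.
  rewrite massBE // qke [leLHS]mulrC -mulrA -expRD.
  have [_ _ _ BC] := cC (last u p).
  rewrite ler_pM ?expR_ge0 ?(ltW (vB0 _)) // ler_expR.
  by have := upB up; lra.
rewrite (gdomE TX); apply: (hoelder_exponentE (glength_gt0 TX) e01).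
  exists (Num.max D 0) => x y /=; rewrite !in_itv /= => /Asurj[x' x'l <-] /Asurj[y' y'l <-].
  rewrite !fA //.
  wlog xy : x' y' x'l y'l / x' <= y'.
    move=> H; have [xy|/ltW yx] := leP x' y'; first exact: H.
    by rewrite distrC [`|A x' - _|]distrC; exact: H.
  move: xy; rewrite le_eqVlt => /orP[/eqP ->|xy].
    by rewrite !subrr normr0 mulr_ge0 ?powR_ge0 // le_max lexx orbT.
  have /andP[x0 _] := x'l; have /andP[_ yl] := y'l.
  have [A0 B0] := AB _ _ x0 xy yl.
  rewrite distrC [`|A x' - _|]distrC (gtr0_norm A0) (gtr0_norm B0).
  by apply: (le_trans (DP _ _ x0 xy yl)); rewrite ler_wpM2r ?powR_ge0 // le_max lexx.
move=> e' e'0 [D' D'P].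
apply: (hoelder_optimal TX TT SS (q := q) (c := c * expR (- K)) (C := C * expR K)
  Amono Bmono q1 cK CK _ Bl e'0 (D := D')).
  move=> k; have [u [p [pk up pA pB]]] := sharp k.
  exists u, p; have [cA cB AC BC] := cC (last u p); split => //.
    rewrite massAE // pk qk [leLHS]mulrC -mulrA -expRD.
    rewrite ler_pM ?expR_ge0 ?(ltW (vA0 _)) // ler_expR; lra.
  rewrite massBE // pk qke [leRHS]mulrC -mulrA -expRD.
  rewrite ler_pM ?expR_ge0 ?(ltW c0) // ler_expR; lra.
move=> x y x0 xy yl; have [A0 B0] := AB _ _ x0 xy yl.
have xl : 0 <= x < l by rewrite x0 (lt_trans xy).
have yl' : 0 <= y < l by rewrite yl (le_trans x0 (ltW xy)).
have := D'P (A y) (A x); rewrite /= !in_itv /= !Adom // !fA // (gtr0_norm A0) (gtr0_norm B0).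
exact.
Qed.

End PairExponent.

(** * Strict inequalities between eigenvalues *)

Section StrictPressure.
Context {R : realType} {V : finType}.
Variables (e : rel V).
Hypothesis econ : forall u v, connect e u v.
Hypothesis nonempty : exists u v, e u v.
Implicit Types (w : V -> V -> R).

Lemma maximal_subaction w m : maximal_cycle_mean e w m -> exists psi : V -> R,
  (forall u v, e u v -> w u v <= m + psi v - psi u) /\
  (forall u v, maximal_edge e w m u v -> w u v = m + psi v - psi u).
Proof.
move=> /strict_subaction[psi [kappa kappa0 psiP]]; exists psi; split => u v uv.
  by have := psiP u v uv; case: ifP => _; lra.
by have := psiP u v (maximal_edgeW uv); rewrite uv.
Qed.

Lemma oscillation (psi : V -> R) : exists2 K, 0 <= K & forall u v, psi u - psi v <= K.
Proof.
exists (\sum_u `|psi u| + \sum_u `|psi u|); first by rewrite addr_ge0 // sumr_ge0.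
move=> u v; have le x : `|psi x| <= \sum_u `|psi u|.
  by rewrite (bigD1 x) //= lerDl sumr_ge0.
by have := le u; have := le v; rewrite !ler_norml => /andP[? ?] /andP[? ?]; lra.
Qed.

Lemma walk_weightN w u p : walk_weight (fun u v => - w u v) u p = - walk_weight w u p.
Proof. by elim: p u => [|v p IHp] u /=; rewrite ?oppr0 // IHp opprD. Qed.

Variables (w : V -> V -> R) (t r r0 : R) (y y0 : V -> R).
Hypothesis noncob : forall m psi, ~ forall u v, e u v -> w u v = m + psi v - psi u.
Hypotheses (t0 : 0 < t) (yr : is_eigen e (fun u v => t * w u v) r y)
  (yr0 : is_eigen e (fun _ _ => 0) r0 y0).

(** Removing [m] and the coboundary of a subaction makes the weights nonpositive, so the eigenvalue
    is at most that of the zero potential; equality would make [w] cohomologous to a constant. *)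
Lemma pressure_upper m : maximal_cycle_mean e w m -> ln r - t * m < ln r0.
Proof.
move=> /maximal_subaction[psi [sub _]].
have r_gt0 := eigen_gt0 nonempty yr; have r0_gt0 := eigen_gt0 nonempty yr0.
have lnE : ln (r * expR (- (t * m))) = ln r - t * m.
  by rewrite lnM ?posrE ?expR_gt0 // expRK.
have := gauge (t * m) (fun u => t * psi u) yr => yr'.
have [|le eq] := eigen_le econ nonempty yr' yr0.
  by move=> u v /sub /(ler_wpM2l (ltW t0)); lra.
rewrite -lnE ltr_ln ?posrE ?mulr_gt0 ?expR_gt0 // lt_neqAle le andbT.
apply/eqP => /eq E; apply: (noncob (m := m) (psi := psi)) => u v uv.
by apply: (mulfI (lt0r_neq0 t0)); have := E u v uv; lra.
Qed.

Lemma pressure_lower m : maximal_cycle_mean e (fun u v => - w u v) m ->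
  ln r0 < ln r + t * m.
Proof.
move=> /maximal_subaction[psi [sub _]].
have r_gt0 := eigen_gt0 nonempty yr; have r0_gt0 := eigen_gt0 nonempty yr0.
have lnE : ln (r * expR (- (- (t * m)))) = ln r + t * m.
  by rewrite opprK lnM ?posrE ?expR_gt0 // expRK.
have := gauge (- (t * m)) (fun u => - (t * psi u)) yr => yr'.
have [|le eq] := eigen_le econ nonempty yr0 yr'.
  by move=> u v /sub /(ler_wpM2l (ltW t0)); lra.
rewrite -lnE ltr_ln ?posrE ?mulr_gt0 ?expR_gt0 // lt_neqAle le andbT.
apply/eqP => /eq E; apply: (noncob (m := - m) (psi := fun u => - psi u)) => u v uv.
by apply: (mulfI (lt0r_neq0 t0)); have := E u v uv; lra.
Qed.

End StrictPressure.

Lemma inv_cvg0_pinfty (R : realType) (g : R -> R) K :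
  (forall t, 0 < t -> `|g t| <= K / t) -> g t @[t --> +oo] --> (0 : R).
Proof.
move=> gK; apply/cvgrPdist_le => eps eps0; near=> t; rewrite sub0r normrN.
have t0 : 0 < t by near: t; exact: nbhs_pinfty_gt.
by apply: (le_trans (gK t t0)); rewrite ler_pdivrMr // mulrC -ler_pdivrMr.
Unshelve. all: by end_near. Qed.

(** * The potential of an invariant vector *)

Section Potential.
Context {R : realType} {d : nat}.
Variables (T : giet R d) (n : nat) (omega : 'cV[R]_d.+1).
Hypotheses (TX : is_exchange T) (TT : translation_branches T) (SS : self_similar T n).
Hypothesis prim : primitive_mx (selfsim_matrix T n).
Hypothesis inv : selfsim_matrix T n *m omega = omega.
Local Notation l := (glength T).
Local Notation V := (floors T n).
Local Notation edge := (@floor_edge R d T n).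
Local Notation flr := (floor_letter T n).

Definition floor_potential (u v : V) : R :=
  potential T n omega (floor_symbol u) (floor_symbol v).
Local Notation w := floor_potential.

Lemma invariant_sum a : \sum_(k < height T n a) omega (flr a k) 0 = omega a 0.
Proof.
rewrite -[in RHS]inv mxE (partition_big (fun k : 'I__ => flr a k) xpredT) //=.
apply: eq_bigr => b _; rewrite mxE -sum1_card natr_sum mulr_suml.
rewrite [RHS](eq_bigl (fun k : 'I__ => flr a k == b)); last by move=> k; rewrite inE.
by apply: eq_bigr => k /eqP ->; rewrite mul1r.
Qed.

Definition slope t (a : 'I_d.+1) : R := expR (t * omega a 0).

Lemma slope_gt0 t a : 0 < slope t a. Proof. exact: expR_gt0. Qed.

Lemma slope_inv t a : \prod_(k < height T n a) slope t (flr a k) = slope t a.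
Proof. by rewrite -expR_sum -mulr_sumr invariant_sum. Qed.

Lemma slope_weight t u v : floor_weight (slope t) v = expR (t * w u v).
Proof. by rewrite /floor_weight -expR_sum -mulr_sumr. Qed.

Lemma slope_walk t u p : walk_factor (slope t) p = expR (t * walk_weight w u p).
Proof.
elim: p u => [|v p IHp] u; first by rewrite /walk_factor big_nil /= mulr0 expR0.
by rewrite /walk_factor big_cons /= mulrDr expRD -slope_weight -[in RHS]IHp.
Qed.

Lemma conformal_id : conformal T (slope 0) id.
Proof.
by split => // a x y _ _; rewrite /slope mul0r expR0; ring.
Qed.

Lemma conformal_eigen t G : conformal T (slope t) G -> exists2 r, 0 < r &
  is_eigen edge (fun u v => t * w u v) r (fun u => letter_mass T G 0 (tag u)) /\
  forall u p, path edge u p -> piece_mass G u p =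
    expR (t * walk_weight w u p) / r ^+ size p * letter_mass T G 0 (tag (last u p)).
Proof.
move=> GC; have [r r0 [Gr Gk]] := conformal_rate TX TT SS prim (slope_gt0 t) (slope_inv t) GC.
exists r => //; split; first (split => u).
- exact: (letter_mass_gt0 TX (tag u) GC).
- rewrite -(floor_eigenvector Gr) /exp_transfer; congr transfer.
  by apply/funext => u'; apply/funext => v; rewrite (slope_weight t u').
- move=> u p up; rewrite -slope_walk.
  exact: (walk_mass TX TT SS (slope_inv t) GC r0 Gk up).
Qed.

Lemma floor_edge_exists : exists u v : V, edge u v.
Proof.
pose u : V := Tagged (fun a => 'I_(height T n a)) (Ordinal (height_gt0 TX TT SS ord0)).
by have [v uv] := floor_edge_succ TX TT SS u; exists u, v.
Qed.

Lemma potential_coboundary m psi :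
  (forall u v : V, edge u v -> w u v = m + psi v - psi u) -> omega = 0.
Proof.
move=> cob; apply/colP => a; rewrite [RHS]mxE.
pose ground a : V := Tagged (fun a => 'I_(height T n a)) (Ordinal (height_gt0 TX TT SS a)).
(* The potential of an edge depends on its target only, and floors over the same letter have the
   same successors. *)
have psiE u : psi u = psi (ground (tag u)).
  have [v uv] := floor_edge_succ TX TT SS u.
  have := cob _ _ uv; have := cob (ground (tag u)) v uv.
  by rewrite /w /potential /=; lra.
apply: (coboundary_trivial TX TT SS (omega := fun a => omega a 0)
  (cc := fun a => psi (ground a)) (kappa := m)) => [b i ib|b]; last exact: invariant_sum.
pose v : V := Tagged (fun a => 'I_(height T n a)) (Ordinal ib).
have := cob (ground (base v)) v; rewrite /floor_edge eqxx => /(_ isT).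
by rewrite (psiE v) /= => <-.
Qed.


Section Exponents.
Variables (t m m' r0 : R) (v0 : V -> R) (F : giet R d) (h hinv : R -> R).
Hypotheses (t0 : 0 < t) (omega0 : omega != 0).
Hypotheses (mmax : maximal_cycle_mean edge w m)
  (mmax' : maximal_cycle_mean edge (fun u v => - w u v) m').
Hypotheses (r0_gt0 : 0 < r0) (yr0 : is_eigen edge (fun _ _ => 0) r0 v0)
  (mass0 : forall u p, path edge u p -> piece_mass id u p =
    expR (0 * walk_weight w u p) / r0 ^+ size p * v0 (last u p)).
Hypothesis pressure0 : forall r y, is_eigen edge (fun u v => t * w u v) r y ->
  0 <= ln r - t * m.
Hypotheses (FA : Aff T (t *: omega) F) (conj : conjugacy F T h hinv).

Let noncob k psi : ~ forall u v : V, edge u v -> w u v = k + psi v - psi u.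
Proof. by move=> /potential_coboundary E; move: omega0; rewrite E eqxx. Qed.

Let econ := floor_edge_connect TX TT SS prim.
Let nonempty := floor_edge_exists.

Lemma conjugacy_exponents : exists r y, [/\ is_eigen edge (fun u v => t * w u v) r y,
  ln r - t * m < ln r0 < ln r + t * m',
  hoelder_exponent (gdom T) hinv = ((ln r - t * m) / ln r0)%:E &
  hoelder_exponent (gdom T) h = (ln r0 / (ln r + t * m'))%:E].
Proof.
have [aff FT rot _] := FA.
have GC : conformal T (slope t) (extended_inverse T hinv).
  have := extended_inverse_conformal TX TT SS prim aff FT rot conj.
  by congr conformal; apply/funext => a; rewrite mxE.
have Gleft := extended_inverse_left TX FT conj.
set G := extended_inverse T hinv in GC Gleft.
have [Gmono _] := GC.
have [r r_gt0 [+ massG]] := conformal_eigen GC.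
pose y (u : V) := letter_mass T G 0 (tag u); rewrite -/y => yr.
have y_gt0 : forall u, 0 < y u by case: yr.
have v0_gt0 : forall u, 0 < v0 u by case: yr0.
have up := pressure_upper econ nonempty noncob t0 yr yr0 mmax.
have low := pressure_lower econ nonempty noncob t0 yr yr0 mmax'.
exists r, y; split => //; first by rewrite up low.
- have [psi [sub eq]] := maximal_subaction mmax.
  have [K0 K0_ge0 oscK] := oscillation psi.
  have K_ge0 : 0 <= t * K0 by rewrite mulr_ge0 // ltW.
  (* For the inverse conjugacy, the heaviest pieces of [G] follow walks of maximal mean [m], while
     all lengths decay at the rate [ln r0]. *)
  have := @pair_exponent R d T n TX TT SS id G w 0 t r0 r v0 y m (t * K0).
  rewrite mul0r subr0; apply=> //.
  + by move=> u p _; rewrite !mul0r; lra.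
  + move=> u p /(subaction_walk sub) /(ler_wpM2l (ltW t0)).
    by have := ler_wpM2l (ltW t0) (oscK (last u p) u); lra.
  + move=> k; have [u [p [pk Ep ep]]] := maximal_walk mmax k.
    exists u, p; split => //; first by rewrite !mul0r; lra.
    rewrite (coboundary_walk eq Ep) pk.
    by have := ler_wpM2l (ltW t0) (oscK u (last u p)); lra.
  + exact: pressure0 yr.
  + by move=> z /andP[_ zl]; rewrite /G /extended_inverse zl.
  + by move=> x xl; exists x.
  + move=> eps eps0; have l0 := glength_gt0 TX.
    have [z [z0 zl zP]] := Gleft _ eps l0 (lexx _) eps0.
    by exists z; split => //; exact: zP.
have [psi [sub eq]] := maximal_subaction mmax'.
have [K0 K0_ge0 oscK] := oscillation psi.
have K_ge0 : 0 <= t * K0 by rewrite mulr_ge0 // ltW.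
have GE z : 0 <= z < l -> G z = hinv z by move=> /andP[_ zl]; rewrite /G /extended_inverse zl.
have [_ _ hK hinvdom hinvK] := conj.
have domE z : 0 <= z < l -> gdom T z by move/(gdomP TX).
(* For the conjugacy the roles are exchanged: the lightest pieces of [G] follow walks of minimal
   mean [- m']. *)
have := @pair_exponent R d T n TX TT SS G id w t 0 r r0 y v0 (- m') (t * K0).
rewrite mul0r subr0 mulrN opprK; apply=> //.
- move=> u p /(subaction_walk sub) /(ler_wpM2l (ltW t0)); rewrite walk_weightN.
  by have := ler_wpM2l (ltW t0) (oscK (last u p) u); lra.
- by move=> u p _; rewrite !mul0r; lra.
- move=> k; have [u [p [pk Ep ep]]] := maximal_walk mmax' k.
  exists u, p; split => //; last by rewrite !mul0r; lra.
  have := coboundary_walk eq Ep; rewrite walk_weightN pk.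
  move/(congr1 (fun x => t * x)).
  by have := ler_wpM2l (ltW t0) (oscK u (last u p)); lra.
- by have := pressure0 yr; lra.
- by move=> z zl; rewrite GE // hinvK //; exact: domE.
- move=> z zl; rewrite GE //; apply/(gdomP TX); rewrite -FT.
  by apply: hinvdom; exact: domE.
- move=> x xl; have xF : gdom F x by rewrite FT; exact: domE.
  have hx : gdom T (h x) by have [[_ _ <- _] _ _ _ _] := conj; exists x.
  have /(gdomP TX) hxl := hx.
  by exists (h x) => //; rewrite GE // hK.
- move=> eps eps0; have l0 := glength_gt0 TX.
  exists (Num.max 0 (l - eps / 2)); split.
  + by rewrite le_max lexx.
  + by rewrite gt_max l0; lra.
  + by rewrite /= lt_max; apply/orP; right; lra.
Qed.

End Exponents.

End Potential.

(* The guards t *: omega != 0 and omega != 0 exclude only the identity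
   conjugacy, whose Hoelder exponent is +oo. *)
Theorem theorem5p4 (R : realType) (d : nat) (T : giet R d) (n : nat)
    (omega : 'cV[R]_d.+1) :
  is_iet T ->
  hyperbolic_periodic_type T n ->
  selfsim_matrix T n *m omega = omega ->
  let I := gdom T in
  let X := path_shift T n in
  let Phi := potential T n omega in
  let hX : R := fine (htop X (@left_shift d)) in
  let hXmax : R := fine (htop (maximizing_subshift X Phi) (@left_shift d)) in
  let gap := max_mean X Phi - min_mean X Phi in
  exists2 eta : R, 0 < eta &
  forall (f : R -> giet R d) (h hinv : R -> R -> R),
    (forall t : R, 0 <= t ->
       Aff T (t *: omega) (f t) /\ conjugacy (f t) T (h t) (hinv t)) ->
    [/\ exists2 r : R -> R, exp_small eta r &
          forall t : R, 0 <= t -> t *: omega != 0 ->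
            hoelder_exponent I (hinv t) = ((hXmax + r t) / hX)%:E,
        exists2 r : R -> R, exp_small eta r &
          forall t : R, 0 <= t -> t *: omega != 0 ->
            hoelder_exponent I (h t) = (hX / (gap * t + hXmax + r t))%:E,
        omega != 0 ->
          hoelder_exponent I (hinv t) @[t --> +oo] --> (hXmax / hX)%:E &
        omega != 0 ->
          (t%:E * hoelder_exponent I (h t))%E @[t --> +oo] --> (hX / gap)%:E].
Proof.
move=> /iet_translation[TX TT] [SS prim _] inv I X Phi hX hXmax gap.
pose w := @floor_potential R d T n omega.
have econ := floor_edge_connect TX TT SS prim.
have nonempty := floor_edge_exists TX TT SS.
have sym_inj := @floor_symbol_inj R d T n.
have [c [c0 uc cc]] := connected_cycle econ nonempty.
have [m mmax] := maximal_cycle_mean_exists w c0 uc cc.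
have [m' mmax'] := maximal_cycle_mean_exists (fun u v => - w u v) c0 uc cc.
have XE : X = edge_shift (@floor_symbol R d T n) (@floor_edge R d T n) := path_shiftE T n.
have maxE : max_mean X Phi = m by rewrite XE; exact: (max_mean_edge_shift sym_inj mmax).
have minE : min_mean X Phi = - m'.
  rewrite min_mean_opp; first by rewrite XE; congr -%R; exact: (max_mean_edge_shift sym_inj mmax').
    by rewrite XE; exact: measurable_edge_shift.
  exists (\sum_p `|w p.1 p.2|) => x; rewrite XE => -[y yE ->].
  by rewrite -[Phi _ _]/(w (y 0) (y 1)) (bigD1 (y 0, y 1)) //= lerDl sumr_ge0.
have [hbar [eta [C [hbar0 eta0 hbarlim asym]]]] := pressure_asymptotics mmax.
have hXmaxE : hXmax = hbar.
  rewrite /hXmax XE (maximizing_subshiftE sym_inj mmax).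
  rewrite (htop_edge_shift sym_inj _ _ (maximal_edge_exists mmax) hbar0 hbarlim) //.
  - exact: maximal_edge_pred.
  - exact: maximal_edge_succ.
pose v0 (u : floors T n) : R := letter_mass T id 0 (tag u).
have [r0 r0_gt0 [yr0 mass0]] := conformal_eigen TX TT SS prim inv (conformal_id T omega).
have {}yr0 : is_eigen (@floor_edge R d T n) (fun _ _ => 0) r0 v0.
  have [? yr0E] := yr0; split => // u; rewrite -yr0E; congr exp_transfer.
  by apply/funext => u'; apply/funext => v; rewrite mul0r.
have [lnr0 hXlim] := entropy_eigen econ nonempty yr0.
have hXE : hX = ln r0.
  rewrite /hX XE (htop_edge_shift sym_inj _ _ nonempty lnr0 hXlim) //.
  - by move=> u v _; exact: floor_edge_pred.
  - by move=> u v _; exact: floor_edge_succ.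
have gapE : gap = m + m' by rewrite /gap maxE minE opprK.
exists eta => // f h hinv fP.
have tw t : t *: omega != 0 -> t != 0 /\ omega != 0.
  by rewrite scaler_eq0 negb_or => /andP.
have [omega0|omega0] := eqVneq omega 0.
  have small0 : exp_small eta (fun _ : R => 0 : R).
    by exists 0 => t _; rewrite normr0 mul0r.
  split => //; exists (fun=> 0) => // t _ /tw[_]; rewrite omega0 eqxx //.
(* One eigenvalue per [t], arbitrary for [t <= 0], so that both formulas share the same
   remainder. *)
have pr t : exists r : R, 0 < t -> [/\
    0 <= ln r - t * m - hbar <= C * expR (- (eta * t)),
    ln r - t * m < ln r0 < ln r + t * m',
    hoelder_exponent I (hinv t) = ((ln r - t * m) / ln r0)%:E &
    hoelder_exponent I (h t) = (ln r0 / (ln r + t * m'))%:E].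
  have [t0|] := ltP 0 t; last by exists 0.
  have [FA conj] := fP t (ltW t0).
  have [|r [y [yr lt E1 E2]]] := @conjugacy_exponents R d T n omega TX TT SS prim inv t m m' r0 v0
      (f t) (h t) (hinv t) t0 omega0 mmax mmax' r0_gt0 yr0 mass0 _ FA conj.
    move=> r y yr; have /andP[+ _] := asym t r y (ltW t0) yr; lra.
  by exists r => _; split => //; exact: asym (ltW t0) yr.
have [rho rhoP] := choice pr.
pose r t := if 0 < t then ln (rho t) - t * m - hbar else 0.
have C0 : 0 <= C.
  have [/andP[le1 le2] _ _ _] := rhoP 1 ltr01.
  by have := le_trans le1 le2; rewrite pmulr_lge0 ?expR_gt0.
have rP t : 0 < t -> ln (rho t) = t * m + hbar + r t by move=> t0; rewrite /r t0; lra.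
have r_small : exp_small eta r.
  exists C => t _; rewrite /r; case: ifPn => [t0|_]; last first.
    by rewrite normr0 mulr_ge0 ?expR_ge0.
  by have [/andP[le1 le2] _ _ _] := rhoP t t0; rewrite ger0_norm.
have hinvE t : 0 < t -> hoelder_exponent I (hinv t) = ((hXmax + r t) / hX)%:E.
  by move=> t0; have [_ _ -> _] := rhoP t t0; rewrite hXE hXmaxE rP //; congr (_ / _)%:E; lra.
have hE t : 0 < t -> hoelder_exponent I (h t) = (hX / (gap * t + hXmax + r t))%:E.
  by move=> t0; have [_ _ _ ->] := rhoP t t0; rewrite hXE hXmaxE gapE rP //; congr (_ / _)%:E; lra.
(* At [t = 1], [ln r0] lies strictly between [ln r - m] and [ln r + m']. *)
have gap0 : 0 < gap.
  by have [_ /andP[lt1 lt2] _ _] := rhoP 1 ltr01; rewrite gapE; lra.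
have r_bound t : 0 < t -> `|r t| <= C.
  move=> t0; rewrite /r t0.
  have [/andP[le1 le2] _ _ _] := rhoP t t0; rewrite ger0_norm //; apply: (le_trans le2).
  by rewrite ler_piMr // -expR0 ler_expR oppr_le0 (mulr_ge0 (ltW eta0) (ltW t0)).
have r0lim : r t @[t --> +oo] --> (0 : R).
  apply: (@inv_cvg0_pinfty _ _ (C / eta)) => t t0.
  rewrite /r t0; have [/andP[le1 le2] _ _ _] := rhoP t t0; rewrite ger0_norm //.
  (* The bound e^(-x) <= 1/x with x = [eta * t]. *)
  apply: (le_trans le2); rewrite -mulrA ler_wpM2l // -invfM expRN lef_pV2 ?posrE ?expR_gt0 ?mulr_gt0 //.
  by apply: le_trans (expR_ge1Dx _); rewrite lerDr.
split.
- exists r => // t t0 /tw[tn0 _]; apply: hinvE; by rewrite lt_def tn0.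
- exists r => // t t0 /tw[tn0 _]; apply: hE; by rewrite lt_def tn0.
- move=> _; apply: cvg_trans (_ : ((hXmax + r t) / hX)%:E @[t --> +oo] --> _).
    apply: near_eq_cvg; near=> t; rewrite hinvE //; near: t; exact: nbhs_pinfty_gt.
  apply: cvg_EFin; first by near=> t.
  have -> : hXmax / hX = (hXmax + 0) / hX by rewrite addr0.
  by apply: cvgM; [apply: cvgD => //; exact: cvg_cst|exact: cvg_cst].
(* Multiplying the exponent by [t] turns its denominator into [gap + g t], and [g] tends to 0. *)
- move=> _; pose g t := (hXmax + r t) / t.
  have glim : g t @[t --> +oo] --> (0 : R).
    apply: (@inv_cvg0_pinfty _ _ (`|hXmax| + C)) => t t0.
    rewrite normrM normfV (gtr0_norm t0) ler_pM2r ?invr_gt0 //.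
    by apply: (le_trans (ler_normD _ _)); rewrite lerD2l r_bound.
  apply: cvg_trans (_ : (hX / (gap + g t))%:E @[t --> +oo] --> _).
    apply: near_eq_cvg; near=> t; have t0 : 0 < t by near: t; exact: nbhs_pinfty_gt.
    rewrite hE // -EFinM; congr EFin.
    have -> : gap * t + hXmax + r t = t * (gap + g t) by rewrite /g; field; exact: lt0r_neq0.
    by rewrite invfM mulrCA mulVKf // lt0r_neq0.
  apply: cvg_EFin; first by near=> t.
  have -> : hX / gap = hX / (gap + 0) by rewrite addr0.
  apply: cvgM; first exact: cvg_cst.
  apply: cvgV; first by rewrite addr0 gt_eqF.
  by apply: cvgD => //; exact: cvg_cst.
Unshelve. all: by end_near. Qed.
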